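(* Let $\mathbb{K}$ be a principal ideal domain. For any marked categories $\mathcal{M}=(\mathcal{C},M)$ and $\mathcal{M}'=(\mathcal{C}',M')$ there is an isomorphism of chain complexes $$\Omega(\mathcal{M}\square\mathcal{M}')\cong\Omega\mathcal{M}\otimes\Omega\mathcal{M}'.$$ Moreover, setting $H_*=\mathsf{PH}_*(\mathcal{M})$, $H'_*=\mathsf{PH}_*(\mathcal{M}')$ and $H''_*=\mathsf{PH}_*(\mathcal{M}\square\mathcal{M}')$, for every $n$ there is a short exact sequence $$0\to\bigoplus_{i+j=n}H_i\otimes H'_j\to H''_n\to\bigoplus_{i+j=n-1}\mathsf{Tor}_1^{\mathbb{K}}(H_i,H'_j)\to0.$$
   Context: A marked category is a pair $\mathcal{M}=(\mathcal{C},M)$ where $\mathcal{C}$ is a small category and $M$ is a set of morphisms of $\mathcal{C}$ containing all identity morphisms. The complex $\mathsf{N}\mathcal{C}$ is the normalized chain complex over $\mathbb{K}$ of the nerve of $\mathcal{C}$: $(\mathsf{N}\mathcal{C})_0$ is free on the objects of $\mathcal{C}$; for $n\ge1$, $(\mathsf{N}\mathcal{C})_n$ is free on the symbols $\langle\gamma_1,\dots,\gamma_n\rangle$, where $\gamma_1,\dots,\gamma_n$ are composable non-identity morphisms ($\mathrm{codom}(\gamma_i)=\mathrm{dom}(\gamma_{i+1})$); a symbol with some $\gamma_i$ an identity is $0$. The differential is $\partial=\sum_{i=0}^n(-1)^i\tilde d_i$ with $\tilde d_0$ deleting $\gamma_1$, $\tilde d_n$ deleting $\gamma_n$, and $\tilde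 d_i$ ($1\le i\le n-1$) replacing $\gamma_i,\gamma_{i+1}$ by the composite $\gamma_{i+1}\gamma_i$; for $n=1$, $\tilde d_0\langle\gamma\rangle=\mathrm{codom}(\gamma)$ and $\tilde d_1\langle\gamma\rangle=\mathrm{dom}(\gamma)$. $\mathsf{N}M\subseteq\mathsf{N}\mathcal{C}$ is the graded submodule with $(\mathsf{N}M)_0=(\mathsf{N}\mathcal{C})_0$ and $(\mathsf{N}M)_n$ spanned by the $\langle\gamma_1,\dots,\gamma_n\rangle$ with all $\gamma_i\in M$. The chain complex $\Omega\mathcal{M}$ is the subcomplex of $\mathsf{N}\mathcal{C}$ with $\Omega_n\mathcal{M}=(\mathsf{N}M)_n\cap\partial^{-1}((\mathsf{N}M)_{n-1})$, and $\mathsf{PH}_*(\mathcal{M})=H_*(\Omega\mathcal{M})$ is the path homology. The box product is $\mathcal{M}\square\mathcal{M}'=(\mathcal{C}\times\mathcal{C}',\{(\mu,1_{c'})\mid\mu\in M,c'\in\mathrm{ob}(\mathcal{C}')\}\cup\{(1_c,\mu')\mid c\in\mathrm{ob}(\mathcal{C}),\mu'\in M'\})$. *)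

(* Defs.v *)
From HB Require Import structures.
From mathcomp Require Import all_boot ssralg ring_quotient boolp.
From mathcomp Require Import freeg.

Set Implicit Arguments.
Unset Strict Implicit.
Unset Printing Implicit Defensive.

Import GRing.Theory.
Local Open Scope ring_scope.

Definition is_PID (K : idomainType) : Prop :=
  forall I : {pred K^o}, submod_closed I ->
  exists a : K, forall x : K, x \in I <-> exists r : K, x = r * a.

Section Modules.
Variable R : comNzRingType.
Implicit Types U V W : lmodType R.

Definition of_prop V (P : V -> Prop) : {pred V} := fun x => `[< P x >].

Lemma of_propP V (P : V -> Prop) x : reflect (P x) (x \in of_prop P).
Proof. exact: asboolP. Qed.

Definition mksubmod V (P : V -> Prop) (PS : submod_closed (of_prop P)) :
    submodClosed V :=
  HB.pack (of_prop P) (GRing.isSubmodClosed.Build R V (of_prop P) PS).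

Lemma mksubmodP V (P : V -> Prop) (PS : submod_closed (of_prop P)) x :
  reflect (P x) (x \in mksubmod PS).
Proof. exact: asboolP. Qed.

Definition spanP V (A : V -> Prop) (x : V) : Prop :=
  exists2 r : seq (R * V),
    (forall p, p \in r -> A p.2) & x = \sum_(p <- r) p.1 *: p.2.

Lemma span_closed V (A : V -> Prop) : submod_closed (of_prop (spanP A)).
Proof.
split=> [|a x y /of_propP[r rA ->] /of_propP[s sA ->]]; apply/of_propP.
  by exists [::] => //; rewrite big_nil.
exists ([seq (a * p.1, p.2) | p <- r] ++ s) => [p|].
  by rewrite mem_cat => /orP[/mapP[q /rA Aq ->]|/sA].
by rewrite big_cat big_map scaler_sumr; congr (_ + _);
   apply: eq_bigr => p _; rewrite scalerA.
Qed.

Definition span V (A : V -> Prop) : submodClosed V := mksubmod (span_closed A).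

Lemma ker_closed U V (f : {linear U -> V}) :
  submod_closed (of_prop (fun x => f x = 0)).
Proof.
split=> [|a x y /of_propP fx /of_propP fy]; apply/of_propP; first exact: linear0.
by rewrite linearP fx fy scaler0 addr0.
Qed.

Definition kersub U V (f : {linear U -> V}) : submodClosed U :=
  mksubmod (ker_closed f).

Lemma im_closed U V (f : {linear U -> V}) :
  submod_closed (of_prop (fun y => exists x, f x = y)).
Proof.
split=> [|a y z /of_propP[x <-] /of_propP[x' <-]]; apply/of_propP.
  by exists 0; exact: linear0.
by exists (a *: x + x'); exact: linearP.
Qed.

Definition imsub U V (f : {linear U -> V}) : submodClosed V :=
  mksubmod (im_closed f).

Lemma pre_closed U V (f : {linear U -> V}) (S : submodClosed V) :
  submod_closed (of_prop (fun x => f x \in S)).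
Proof.
split=> [|a x y /of_propP fx /of_propP fy]; apply/of_propP.
  by rewrite linear0 rpred0.
by rewrite linearP rpredD // rpredZ.
Qed.

Definition presub U V (f : {linear U -> V}) (S : submodClosed V) :
  submodClosed U := mksubmod (pre_closed f S).

Lemma cap_closed V (S T : submodClosed V) :
  submod_closed (of_prop (fun x => x \in S /\ x \in T)).
Proof.
split=> [|a x y /of_propP[Sx Tx] /of_propP[Sy Ty]]; apply/of_propP.
  by split; rewrite rpred0.
by split; rewrite rpredD // rpredZ.
Qed.

Definition capsub V (S T : submodClosed V) : submodClosed V :=
  mksubmod (cap_closed S T).

Definition submod V (S : submodClosed V) := {x : V | x \in S}.
HB.instance Definition _ V (S : submodClosed V) := [isSub of submod S for sval].
HB.instance Definition _ V (S : submodClosed V) := [Choice of submod S by <:].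
HB.instance Definition _ V (S : submodClosed V) :=
  [SubChoice_isSubLmodule of submod S by <:].

Definition submod_val V (S : submodClosed V) : {linear submod S -> V} :=
  \val : {linear submod S -> V}.

Section Restrict.
Variables (U V : lmodType R) (f : {linear U -> V}).
Variables (S : submodClosed U) (T : submodClosed V).
Hypothesis fST : forall x, x \in S -> f x \in T.

Definition restrict (x : submod S) : submod T := 
  exist (fun y => y \in T) (f (val x)) (fST (valP x)).

Lemma restrict_linear : linear restrict.
Proof. by move=> a x y; apply: val_inj; rewrite /= linearP. Qed.

HB.instance Definition _ :=
  GRing.isLinear.Build R (submod S) (submod T) *:%R restrict restrict_linear.
End Restrict.

Section Quotmod.
Variables (V : lmodType R) (S : submodClosed V).

Lemma submodClosedB : zmod_closed S.
Proof. exact: (GRing.submod_closedB (GRing.submodClosedP S)). Qed.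

Definition zmod_of_submod : zmodClosed V :=
  HB.pack (GRing.SubmodClosed.sort S)
    (GRing.isZmodClosed.Build V (GRing.SubmodClosed.sort S) submodClosedB).

Definition quotmod := Quotient.quot zmod_of_submod.
HB.instance Definition _ := GRing.Zmodule.on quotmod.

Definition cls (x : V) : quotmod := \pi_quotmod%qT x.

Lemma cls_eq x y : (cls x == cls y) = (x - y \in S).
Proof. exact: esym (Quotient.idealrBE zmod_of_submod x y). Qed.

Lemma cls_eqP x y : x - y \in S -> cls x = cls y.
Proof. by rewrite -cls_eq => /eqP. Qed.

Lemma cls_repr (q : quotmod) : cls (repr q) = q.
Proof. exact: reprK. Qed.

Lemma clsD : {morph cls : x y / x + y}.
Proof. by move=> x y; exact: (Quotient.pi_add zmod_of_submod x y). Qed.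

Definition quot_scale (a : R) (q : quotmod) : quotmod := cls (a *: repr q).

Lemma quot_scaleE a x : quot_scale a (cls x) = cls (a *: x).
Proof.
by apply: cls_eqP; rewrite -scalerBr rpredZ // -cls_eq cls_repr.
Qed.

Lemma quot_scaleA a b q : quot_scale a (quot_scale b q) = quot_scale (a * b) q.
Proof. by rewrite -[q]cls_repr !quot_scaleE scalerA. Qed.

Lemma quot_scale1 : left_id 1 quot_scale.
Proof. by move=> q; rewrite -[q]cls_repr quot_scaleE scale1r. Qed.

Lemma quot_scaleDr : right_distributive quot_scale +%R.
Proof.
move=> a q r; rewrite -[q]cls_repr -[r]cls_repr -clsD !quot_scaleE -clsD.
by rewrite scalerDr.
Qed.

Lemma quot_scaleDl q : {morph quot_scale^~ q : a b / a + b}.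
Proof.
by move=> a b; rewrite -[q]cls_repr !quot_scaleE -clsD scalerDl.
Qed.

HB.instance Definition _ := GRing.Zmodule_isLmodule.Build R quotmod
  quot_scaleA quot_scale1 quot_scaleDr quot_scaleDl.

Lemma cls_linear : linear cls.
Proof. by move=> a x y; rewrite clsD -quot_scaleE. Qed.

HB.instance Definition _ := GRing.isLinear.Build R V quotmod *:%R cls cls_linear.

Lemma cls_surj (q : quotmod) : exists x, q = cls x.
Proof. by exists (repr q); rewrite cls_repr. Qed.

Lemma cls_eq0 x : (cls x == 0) = (x \in S).
Proof. by rewrite -(linear0 cls) cls_eq subr0. Qed.

Section Lift.
Variables (W : lmodType R) (f : {linear V -> W}).

Definition qlift (fS : forall x, x \in S -> f x = 0) (q : quotmod) : W :=
  f (repr q).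

Hypothesis fS : forall x, x \in S -> f x = 0.

Lemma qliftE x : qlift fS (cls x) = f x.
Proof.
apply/eqP; rewrite -subr_eq0 -linearB fS //.
by rewrite -cls_eq0 linearB /= cls_repr subrr.
Qed.

Lemma qlift_linear : linear (qlift fS).
Proof.
move=> a q r; case: (cls_surj q) (cls_surj r) => x -> [y ->].
by rewrite -linearP !qliftE linearP.
Qed.

HB.instance Definition _ :=
  GRing.isLinear.Build R quotmod W *:%R (qlift fS) qlift_linear.
End Lift.
End Quotmod.

Section FreeLift.
Variables (T : choiceType) (V : lmodType R) (f : T -> V).

Definition freelift (D : {freeg T / R}) : V := fglift f D.

Lemma freelift_linear : linear freelift.
Proof.
pose F : {additive {freeg T / R} -> V} :=
  HB.pack (fglift f : {freeg T / R} -> V)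
    (GRing.isZmodMorphism.Build _ _ (fglift f) (lift_is_additive f)).
have FU k x : F <<k *g x>> = k *: f x by exact: liftU.
have FE (D : {freeg T / R}) : F D = \sum_(x <- dom D) coeff x D *: f x.
  rewrite -[in LHS](freeg_sumE D) raddf_sum.
  by apply: eq_bigr => x _; rewrite FU.
move=> a x y; rewrite -[freelift]/(F : _ -> _) raddfD; congr (_ + _).
rewrite [in RHS]FE scaler_sumr -[a *: x]/(fgscale a x) raddf_sum.
by apply: eq_bigr => z _; rewrite FU scalerA.
Qed.

HB.instance Definition _ :=
  GRing.isLinear.Build R {freeg T / R} V *:%R freelift freelift_linear.

Lemma freeliftU x : freelift <<x>> = f x.
Proof. by rewrite /freelift liftU scale1r. Qed.

Lemma freelift_eq (g h : {linear {freeg T / R} -> V}) :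
  (forall x, g <<x>> = h <<x>>) -> g =1 h.
Proof.
move=> gh D; rewrite -(freeg_sumE D) !linear_sum; apply: eq_bigr => x _.
have -> : <<coeff x D *g x>> = coeff x D *: (<<x>> : {freeg T / R}).
  by apply/eqP/freeg_eqP => y; rewrite coeffZ !coeffU mul1r.
by rewrite !linearZ gh.
Qed.
End FreeLift.

Lemma span_eq0 V W (A : V -> Prop) (f : {linear V -> W}) :
  (forall x, A x -> f x = 0) -> forall x, x \in span A -> f x = 0.
Proof.
move=> fA x /mksubmodP[r rA ->]; rewrite linear_sum big_seq big1 // => p rp.
by rewrite linearZ_LR fA ?scaler0 //; exact: rA.
Qed.

Inductive tens_rel V W : {freeg (V * W) / R} -> Prop :=
| TensDl v v' w : tens_rel (<<(v + v', w)>> - (<<(v, w)>> + <<(v', w)>>))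
| TensDr v w w' : tens_rel (<<(v, w + w')>> - (<<(v, w)>> + <<(v, w')>>))
| TensZl a v w : tens_rel (<<(a *: v, w)>> - a *: <<(v, w)>>)
| TensZr a v w : tens_rel (<<(v, a *: w)>> - a *: <<(v, w)>>).

Definition tens V W : lmodType R := quotmod (span (@tens_rel V W)).

Definition pure V W (v : V) (w : W) : tens V W := cls _ <<(v, w)>>.

Section PureTensors.
Variables V W : lmodType R.

Lemma pureDl (v v' : V) (w : W) : pure (v + v') w = pure v w + pure v' w.
Proof.
apply/eqP; rewrite -subr_eq0 /pure -linearD -linearB cls_eq0.
apply/mksubmodP; exists [:: (1, <<(v + v', w)>> - (<<(v, w)>> + <<(v', w)>>))].
  by move=> p; rewrite inE => /eqP->; exact: TensDl.
by rewrite big_seq1 scale1r.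
Qed.

Lemma pureDr (v : V) (w w' : W) : pure v (w + w') = pure v w + pure v w'.
Proof.
apply/eqP; rewrite -subr_eq0 /pure -linearD -linearB cls_eq0.
apply/mksubmodP; exists [:: (1, <<(v, w + w')>> - (<<(v, w)>> + <<(v, w')>>))].
  by move=> p; rewrite inE => /eqP->; exact: TensDr.
by rewrite big_seq1 scale1r.
Qed.

Lemma pureZl a (v : V) (w : W) : pure (a *: v) w = a *: pure v w.
Proof.
apply/eqP; rewrite -subr_eq0 /pure -linearZ_LR -linearB cls_eq0.
apply/mksubmodP; exists [:: (1, <<(a *: v, w)>> - a *: <<(v, w)>>)].
  by move=> p; rewrite inE => /eqP->; exact: TensZl.
by rewrite big_seq1 scale1r.
Qed.

Lemma pureZr a (v : V) (w : W) : pure v (a *: w) = a *: pure v w.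
Proof.
apply/eqP; rewrite -subr_eq0 /pure -linearZ_LR -linearB cls_eq0.
apply/mksubmodP; exists [:: (1, <<(v, a *: w)>> - a *: <<(v, w)>>)].
  by move=> p; rewrite inE => /eqP->; exact: TensZr.
by rewrite big_seq1 scale1r.
Qed.
End PureTensors.

Lemma tens_eq V W (X : lmodType R) (f g : {linear tens V W -> X}) :
  (forall v w, f (pure v w) = g (pure v w)) -> f =1 g.
Proof.
move=> fg q; have [x ->] := cls_surj q.
pose F : {linear {freeg (V * W) / R} -> X} := f \o cls _.
pose G : {linear {freeg (V * W) / R} -> X} := g \o cls _.
by apply: (@freelift_eq _ _ F G) => -[v w]; exact: fg.
Qed.

Section TensFunctor.
Variables (V V' W W' : lmodType R).
Variables (f : {linear V -> V'}) (g : {linear W -> W'}).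

Lemma tmap_rel (x : {freeg (V * W) / R}) : x \in span (@tens_rel V W) ->
  freelift (fun p : V * W => pure (f p.1) (g p.2)) x = 0.
Proof.
apply: span_eq0 => _ [v v' w|v w w'|a v w|a v w];
  rewrite ?linearB ?linearD ?linearZ_LR /= !freeliftU /= ?linearD ?linearZ_LR.
- by rewrite pureDl -opprD subrr.
- by rewrite pureDr -opprD subrr.
- by rewrite pureZl scalerN subrr.
- by rewrite pureZr scalerN subrr.
Qed.

Definition tmap : tens V W -> tens V' W' := qlift tmap_rel.
HB.instance Definition _ := GRing.Linear.on tmap.

Lemma tmapE v w : tmap (pure v w) = pure (f v) (g w).
Proof. by rewrite /tmap qliftE /= freeliftU. Qed.
End TensFunctor.

(** Product of a family of modules; it is the direct sum when [I] is finite. *)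

Section Dprod.
Variables (I : Type) (V : I -> lmodType R).

Definition dprod := forall i, V i.
HB.instance Definition _ := gen_eqMixin dprod.
HB.instance Definition _ := gen_choiceMixin dprod.

Definition dprod_zero : dprod := fun=> 0.
Definition dprod_opp (f : dprod) : dprod := fun i => - f i.
Definition dprod_add (f g : dprod) : dprod := fun i => f i + g i.
Definition dprod_scale (a : R) (f : dprod) : dprod := fun i => a *: f i.

Lemma dprod_addA : associative dprod_add.
Proof.
by move=> f g h; apply: functional_extensionality_dep => i; exact: addrA.
Qed.
Lemma dprod_addC : commutative dprod_add.
Proof. by move=> f g; apply: functional_extensionality_dep => i; exact: addrC. Qed.
Lemma dprod_add0 : left_id dprod_zero dprod_add.
Proof. by move=> f; apply: functional_extensionality_dep => i; exact: add0r. Qed.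
Lemma dprod_addN : left_inverse dprod_zero dprod_opp dprod_add.
Proof. by move=> f; apply: functional_extensionality_dep => i; exact: addNr. Qed.

HB.instance Definition _ :=
  GRing.isZmodule.Build dprod dprod_addA dprod_addC dprod_add0 dprod_addN.

Lemma dprod_scaleA a b f :
  dprod_scale a (dprod_scale b f) = dprod_scale (a * b) f.
Proof. by apply: functional_extensionality_dep => i; exact: scalerA. Qed.
Lemma dprod_scale1 : left_id 1 dprod_scale.
Proof. by move=> f; apply: functional_extensionality_dep => i; exact: scale1r. Qed.
Lemma dprod_scaleDr : right_distributive dprod_scale +%R.
Proof.
by move=> a f g; apply: functional_extensionality_dep => i; exact: scalerDr.
Qed.
Lemma dprod_scaleDl f : {morph dprod_scale^~ f : a b / a + b}.
Proof.
by move=> a b; apply: functional_extensionality_dep => i; exact: scalerDl.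
Qed.

HB.instance Definition _ := GRing.Zmodule_isLmodule.Build R dprod
  dprod_scaleA dprod_scale1 dprod_scaleDr dprod_scaleDl.
End Dprod.

Definition short_exact U V W (f : {linear U -> V}) (g : {linear V -> W}) :=
  [/\ injective f, forall y, g y = 0 <-> exists x, f x = y
    & forall z, exists y, g y = z].

End Modules.

#[global] Arguments tmap : simpl never.

(** Graded by [nat]: the components of negative degree are understood to be zero. *)

Record complex (R : comNzRingType) := Complex {
  cobj :> nat -> lmodType R;
  cdiff : forall n, {linear cobj n.+1 -> cobj n};
  cdiffK : forall n x, cdiff n (cdiff n.+1 x) = 0
}.

Arguments cdiff {R} c n.

Section Complexes.
Variable R : comNzRingType.
Implicit Types C D : complex R.

Definition complex_iso C D : Prop :=
  exists2 f : forall n, {linear C n -> D n},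
    forall n, bijective (f n) &
    forall n x, f n (cdiff C n x) = cdiff D n (f n.+1 x).

Definition bdry C n : {linear C n -> C n.-1} :=
  match n with 0 => \0 : {linear C 0 -> C 0} | m.+1 => cdiff C m end.

Definition homology C n : lmodType R :=
  quotmod (presub (submod_val (kersub (bdry C n))) (imsub (cdiff C n))).

(** [subcx S] has [S_n] intersected with the preimage of [S_(n-1)] under the
    differential in degree [n]. *)

Section Subcomplex.
Variables (C : complex R) (S : forall n, submodClosed (C n)).

Definition subcx_sub n : submodClosed (C n) :=
  capsub (S n) (presub (bdry C n) (S n.-1)).

Lemma subcx_stable n x : x \in subcx_sub n.+1 -> cdiff C n x \in subcx_sub n.
Proof.
move=> /mksubmodP[_ /mksubmodP dSx]; apply/mksubmodP; split=> //.
apply/mksubmodP; case: n x dSx => [|n] x _ /=; first exact: rpred0.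
by rewrite cdiffK rpred0.
Qed.

Definition subcx_diff n : submod (subcx_sub n.+1) -> submod (subcx_sub n) :=
  restrict (@subcx_stable n).
HB.instance Definition _ n := GRing.Linear.on (@subcx_diff n).

Lemma subcx_diffK n (x : submod (subcx_sub n.+2)) : subcx_diff (subcx_diff x) = 0.
Proof. by apply: val_inj => /=; rewrite cdiffK. Qed.

Definition subcx : complex R :=
  @Complex R (fun n => submod (subcx_sub n)) (fun n => @subcx_diff n) subcx_diffK.
End Subcomplex.

Definition bideg n := {p : nat * nat | (p.1 + p.2)%N == n}.

Definition bidegl n (p : bideg n) : bideg n.+1 :=
  exist (fun q : nat * nat => (q.1 + q.2)%N == n.+1)
    ((val p).1.+1, (val p).2) (valP p).

Lemma bidegr_proof n (p : bideg n) : ((val p).1 + (val p).2.+1)%N == n.+1.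
Proof. by rewrite addnS eqSS (valP p). Qed.

Definition bidegr n (p : bideg n) : bideg n.+1 :=
  exist (fun q : nat * nat => (q.1 + q.2)%N == n.+1)
    ((val p).1, (val p).2.+1) (bidegr_proof p).

Lemma tmap_cdiffKl C i (V V' : lmodType R) (g : {linear V -> V'}) y :
  tmap (cdiff C i) g (tmap (cdiff C i.+1) idfun y) = 0.
Proof.
pose F : {linear _ -> _} := tmap (cdiff C i) g \o tmap (cdiff C i.+1) idfun.
rewrite -[LHS]/(F y) -[RHS]/((\0 : {linear _ -> _}) y).
apply: tens_eq => v w; rewrite {}/F /= !tmapE cdiffK.
by rewrite -(scale0r (0 : C i)) pureZl scale0r.
Qed.

Definition bisum n (F : nat -> nat -> lmodType R) : lmodType R :=
  dprod (fun p : bideg n => F (val p).1 (val p).2).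

(** The sum of the [F i j] over all [i + j = n - 1], which is zero for [n = 0]. *)
Definition bisum_pred n (F : nat -> nat -> lmodType R) : lmodType R :=
  dprod (fun p : {p : nat * nat | (p.1 + p.2).+1%N == n} => F (val p).1 (val p).2).

Section TensComplex.
Variables C D : complex R.

Definition tcx_obj n : lmodType R :=
  bisum n (fun i j => tens (C i) (D j)).

(** The differential
    [d (x (x) y) = d x (x) y + (-1)^i x (x) d y] for [x] of degree [i],
    written out in each component: the [(i, j)]-component of [d z] comes from the
    [(i+1, j)]- and [(i, j+1)]-components of [z]. *)
Definition tcx_diff n (z : tcx_obj n.+1) : tcx_obj n := fun p =>
  tmap (cdiff C (val p).1) idfun (z (bidegl p))
  + (-1) ^+ (val p).1 *: tmap idfun (cdiff D (val p).2) (z (bidegr p)).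

Lemma tcx_diff_linear n : linear (@tcx_diff n).
Proof.
move=> a x y; apply: functional_extensionality_dep => p.
rewrite /tcx_diff [(a *: x + y) _]/(a *: x _ + y _).
rewrite [(a *: x + y) (bidegr p)]/(a *: x _ + y _) !linearP.
rewrite [RHS]/(a *: (_ + _) + (_ + _)) scalerDr !scalerA addrACA.
by [].
Qed.

HB.instance Definition _ n := GRing.isLinear.Build R _ _ *:%R (@tcx_diff n)
  (@tcx_diff_linear n).

Lemma tcx_diffK n (x : tcx_obj n.+2) : tcx_diff (tcx_diff x) = 0.
Proof.
apply: functional_extensionality_dep => p.
have comp0l := @tmap_cdiffKl C.
have compr0 j (V V' : lmodType R) (g : {linear V -> V'}) y :
    tmap g (cdiff D j) (tmap idfun (cdiff D j.+1) y) = 0.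
  pose F : {linear _ -> _} := tmap g (cdiff D j) \o tmap idfun (cdiff D j.+1).
  rewrite -[LHS]/(F y) -[RHS]/((\0 : {linear _ -> _}) y).
  apply: tens_eq => v w; rewrite {}/F /= !tmapE cdiffK.
  by rewrite -(scale0r (0 : D j)) pureZr scale0r.
have swap i j y :
    tmap (cdiff C i) idfun (tmap idfun (cdiff D j) y)
    = tmap idfun (cdiff D j) (tmap (cdiff C i) idfun y).
  pose F : {linear _ -> _} := tmap (cdiff C i) idfun \o tmap idfun (cdiff D j).
  pose G : {linear _ -> _} := tmap idfun (cdiff D j) \o tmap (cdiff C i) idfun.
  rewrite -[LHS]/(F y) -[RHS]/(G y).
  by apply: tens_eq => v w; rewrite {}/F {}/G /= !tmapE.
rewrite /tcx_diff /= !linearD !linearZ_LR /= comp0l compr0.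
rewrite -[RHS]/(0 : tens (C (val p).1) (D (val p).2)) swap.
rewrite !scaler0 add0r addr0 exprS mulN1r scaleNr.
have xE (h h' : ((val p).1.+1 + (val p).2.+1 == n.+2)%N) :
    x (exist (fun q : nat * nat => (q.1 + q.2)%N == n.+2) (_, _) h)
    = x (exist (fun q : nat * nat => (q.1 + q.2)%N == n.+2) (_, _) h').
  by rewrite (bool_irrelevance h h').
have -> : x (bidegr (bidegl p)) = x (bidegl (bidegr p)) by exact: xE.
by rewrite addNr.
Qed.

Definition tcx : complex R :=
  @Complex R tcx_obj (fun n => @tcx_diff n) tcx_diffK.
End TensComplex.

(** [Tor], computed from the standard free resolution
    [... -> R[ker e] -> R[V] -> V], in which [R[X]] is the free module on the
    underlying set of [X]. *)

Record arrow := Arrow {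
  asrc : lmodType R;
  atgt : lmodType R;
  amap : {linear asrc -> atgt}
}.

Definition free_cover (V : lmodType R) : {linear {freeg V / R} -> V} :=
  freelift (fun v : V => v).

Definition next_arrow (f : arrow) : arrow :=
  @Arrow {freeg (submod (kersub (amap f))) / R} (asrc f)
    (submod_val (kersub (amap f)) \o free_cover (submod (kersub (amap f)))).

Definition std_arrow (V : lmodType R) (n : nat) : arrow :=
  iter n next_arrow (Arrow (free_cover V)).

Definition std_diff (V : lmodType R) n :
    {linear asrc (std_arrow V n.+1) -> asrc (std_arrow V n)} :=
  amap (std_arrow V n.+1).

Lemma std_diffK (V : lmodType R) n x : std_diff V n (std_diff V n.+1 x) = 0.
Proof.
set f := std_arrow V n.+1; pose k := free_cover (submod (kersub (amap f))) x.
by apply: (mksubmodP _ _ (valP k)).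
Qed.

Definition std_res (V : lmodType R) : complex R :=
  @Complex R (fun n => asrc (std_arrow V n)) (std_diff V) (@std_diffK V).

Section TensModule.
Variables (C : complex R) (W : lmodType R).

Definition tmod_diff n : {linear tens (C n.+1) W -> tens (C n) W} :=
  tmap (cdiff C n) idfun.

Lemma tmod_diffK n x : tmod_diff n (tmod_diff n.+1 x) = 0.
Proof. exact: tmap_cdiffKl. Qed.

Definition tmod : complex R :=
  @Complex R (fun n => tens (C n) W) tmod_diff tmod_diffK.
End TensModule.

Definition Tor n (V W : lmodType R) : lmodType R := homology (tmod (std_res V) W) n.
End Complexes.

(** Small categories; [comp f g] is "[f] followed by [g]". *)

Record smallcat := SmallCat {
  ob :> Type;
  hom : ob -> ob -> Type;
  idm : forall x, hom x x;
  comp : forall x y z, hom x y -> hom y z -> hom x z;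
  compIm : forall x y (f : hom x y), comp (idm x) f = f;
  compmI : forall x y (f : hom x y), comp f (idm y) = f;
  compA : forall x y z t (f : hom x y) (g : hom y z) (h : hom z t),
    comp f (comp g h) = comp (comp f g) h
}.

Arguments hom {s}.
Arguments idm {s}.
Arguments comp {s x y z}.

Inductive is_id (C : smallcat) (x : C) : forall y : C, hom x y -> Prop :=
  IsId : is_id (idm x).

Record markedcat := MarkedCat {
  mcat :> smallcat;
  marked : forall x y : mcat, hom x y -> Prop;
  marked_id : forall x, marked (idm x)
}.

Arguments marked {m x y}.

Section ProdCat.
Variables C D : smallcat.

Definition prod_hom (p q : C * D) : Type := (hom p.1 q.1 * hom p.2 q.2)%type.
Definition prod_id (p : C * D) : prod_hom p p := (idm p.1, idm p.2).
Definition prod_comp (p q r : C * D) (f : prod_hom p q) (g : prod_hom q r) :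
  prod_hom p r := (comp f.1 g.1, comp f.2 g.2).

Lemma prod_compIm p q (f : prod_hom p q) : prod_comp (prod_id p) f = f.
Proof. by case: f => f g; rewrite /prod_comp /= !compIm. Qed.

Lemma prod_compmI p q (f : prod_hom p q) : prod_comp f (prod_id q) = f.
Proof. by case: f => f g; rewrite /prod_comp /= !compmI. Qed.

Lemma prod_compA p q r s
    (f : prod_hom p q) (g : prod_hom q r) (h : prod_hom r s) :
  prod_comp f (prod_comp g h) = prod_comp (prod_comp f g) h.
Proof. by rewrite /prod_comp /= !compA. Qed.

Definition prodcat : smallcat := SmallCat prod_compIm prod_compmI prod_compA.
End ProdCat.

Section Box.
Variables M M' : markedcat.

Inductive box_marked : forall p q : prodcat M M', hom p q -> Prop :=
| BoxL (x y : M) (m : hom x y) (c' : M') : marked m ->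
    @box_marked (x, c') (y, c') (m, idm c')
| BoxR (c : M) (x' y' : M') (m' : hom x' y') : marked m' ->
    @box_marked (c, x') (c, y') (idm c, m').

Lemma box_marked_id p : box_marked (idm p).
Proof. by case: p => c c'; apply: BoxL; exact: marked_id. Qed.

Definition box : markedcat := MarkedCat box_marked_id.
End Box.

(** [chain n x] is the type of sequences of [n] composable arrows of which the
    first starts at [x]; for [n = 0] only the object [x] is left. *)

Section Chains.
Variable C : smallcat.

Fixpoint chain (n : nat) (x : C) : Type :=
  if n is m.+1 then {y : C & (hom x y * chain m y)%type} else unit.

Definition simplex n := {x : C & chain n x}.

Fixpoint chain_all (P : forall x y : C, hom x y -> Prop) n :
    forall x : C, chain n x -> Prop :=
  match n with
  | 0 => fun _ _ => True
  | m.+1 => fun x c =>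
      P x (projT1 c) (projT2 c).1 /\ chain_all P (projT2 c).2
  end.

Definition nondeg n (s : simplex n) :=
  chain_all (fun x y (f : hom x y) => ~ is_id f) (projT2 s).

(** [cface i] is the face map [d_(i+1)], which keeps the starting point; for
    [i] the last index, it deletes the last arrow. *)
Fixpoint cface n (i : nat) : forall x : C, chain n.+1 x -> chain n x :=
  match n with
  | 0 => fun _ _ => tt
  | m.+1 => fun x c => let: existT y (f, c') := c in
      match i with
      | 0 => let: existT z (g, c'') := c' in existT _ z (comp f g, c'')
      | j.+1 => existT _ y (f, cface j c')
      end
  end.

Definition face n (i : nat) (s : simplex n.+1) : simplex n :=
  let: existT x c := s in
  match i with
  | 0 => existT _ (projT1 c) (projT2 c).2
  | j.+1 => existT _ x (cface j c)
  end.

Fixpoint idat n (k : nat) : forall x : C, chain n x -> Prop :=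
  match n with
  | 0 => fun _ _ => False
  | m.+1 => fun x c =>
      match k with
      | 0 => is_id (projT2 c).1
      | j.+1 => idat j (projT2 c).2
      end
  end.

Lemma degP n x (c : chain n x) :
  ~ chain_all (fun x y (f : hom x y) => ~ is_id f) c <->
  exists2 k, (k < n)%N & idat k c.
Proof.
elim: n x c => [|n IH] x /=; first by split=> [[]//|[]].
case=> y [f c] /=; split.
  case: (pselect (is_id f)) => [fid _|fid /not_andP[|/IH[k kn ck]]]; first by exists 0.
    by [].
  by exists k.+1.
move=> [[|k] kn ck [fid call]]; first exact: fid.
by have := (IH _ c).2; apply=> //; exists k.
Qed.

Lemma cface_idat n k x (c : chain n.+2 x) :
  (k < n.+1)%N -> idat k.+1 c -> cface k c = cface k.+1 c.
Proof.
elim: n k x c => [|n IH] [|k] x [y [f [z [g c]]]] //= kn.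
- by move=> gid; case: z g / gid c => -[]; rewrite compmI.
- by case: c => t [h c] gid; case: z g / gid h => h; rewrite compmI compIm.
- move=> ck; apply: (congr1 (fun c' => existT _ y (f, c'))).
  exact: (IH k y (existT _ z (g, c))).
Qed.

Lemma face_idat n k x (c : chain n.+1 x) :
  (k < n.+1)%N -> idat k c -> face k (existT _ x c) = face k.+1 (existT _ x c).
Proof.
case: k => [|k] kn ck; last first.
  by case: n c kn ck => // n c kn ck;
    exact: (congr1 (existT (chain n.+1) x) (cface_idat (kn : (k < n.+1)%N) ck)).
case: n c ck {kn} => [|n] [y [f c]] /= fid; case: y f / fid c => c.
  by case: c.
by case: c => z [g c]; rewrite compIm.
Qed.

Lemma cface_idat_lt n i k x (c : chain n.+1 x) :
  (k < n.+1)%N -> (i < n.+1)%N -> (i.+1 < k)%N -> idat k c -> idat k.-1 (cface i c).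
Proof.
elim: n i k x c => [|n IH] i [|k] x //.
case=> y [f c] kn; case: i => [|i] iN /=.
  by case: k kn c => [|k] // kn [z [g c]].
case: k kn => // k kn ik /=; exact: (IH i k.+1 y c).
Qed.

Lemma cface_idat_gt n i k x (c : chain n.+1 x) :
  (k < i)%N -> (i < n.+1)%N -> idat k c -> idat k (cface i c).
Proof.
elim: n i k x c => [|n IH] [|i] k x //; case=> y [f c] ki iN.
by case: k ki => [|k] ki //=; exact: IH.
Qed.

Lemma face_deg n i k x (c : chain n.+1 x) :
  (k < n.+1)%N -> (i < n.+2)%N -> idat k c -> i != k -> i != k.+1 ->
  ~ nondeg (face i (existT _ x c)).
Proof.
move=> kn iN ck ik ik1; apply/degP.
case: (ltnP i k) => [lik|lki].
  exists k.-1; first by case: k lik kn {ck ik ik1}.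
  case: i iN lik {ik ik1} => [|i] iN lik; last exact: cface_idat_lt.
  by case: k lik {kn} ck => // k _; case: c => y [].
have {lki ik ik1} : (k.+1 < i)%N by rewrite ltn_neqAle eq_sym ik1 ltn_neqAle eq_sym ik.
case: i iN => // i iN ki; exists k; last exact: cface_idat_gt.
exact: (leq_trans (ki : (k.+1 <= i)%N) (iN : (i <= n)%N)).
Qed.

Lemma cface_cface n i j x (c : chain n.+2 x) :
  (i < n.+2)%N -> (j < i)%N ->
  cface j (cface i c) = cface i.-1 (cface j c).
Proof.
elim: n i j x c => [|n IH] [|i] j x // [y [f [z [g c]]]] iN.
case: j => [|j] ji /=.
  case: i iN {ji} => [|i] iN /=; last by [].
  by case: c => t [h c]; rewrite compA.
case: i iN ji => // i iN ji.
apply: (congr1 (fun c' => existT _ y (f, c'))).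
exact: (IH i.+1 j y (existT _ z (g, c))).
Qed.

Lemma face_face n i j (s : simplex n.+2) :
  (i < n.+3)%N -> (j < i)%N -> face j (face i s) = face i.-1 (face j s).
Proof.
case: s => x; case: i => [|i] // c; case: j => [|j] iN ji.
  by case: c => y [f [z [g c]]]; case: i iN {ji} => [|i] iN.
case: i iN ji => // i iN ji.
exact: (congr1 (existT (chain n) x) (cface_cface c (iN : (i.+1 < n.+2)%N)
  (ji : (j < i.+1)%N))).
Qed.
End Chains.

Arguments face : simpl never.

Section Nerve.
Variables (R : comNzRingType) (C : smallcat).

Definition ndsimplex n := {s : {classic simplex C n} | `[< nondeg (s : simplex C n) >]}.

Definition nerve_obj n : lmodType R := {freeg (ndsimplex n) / R}.

(** The symbol of a simplex, which is [0] when some arrow is an identity. *)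
Definition symb n (s : simplex C n) : nerve_obj n :=
  if insub (s : {classic simplex C n}) is Some t then <<(t : ndsimplex n)>> else 0.

Definition bsum n (s : simplex C n.+1) : nerve_obj n :=
  \sum_(i < n.+2) (-1) ^+ i *: symb (face i s).

Definition nerve_diff n : nerve_obj n.+1 -> nerve_obj n :=
  freelift (fun t : ndsimplex n.+1 => bsum (val t)).
HB.instance Definition _ n := GRing.Linear.on (@nerve_diff n).

Lemma symb_deg n (s : simplex C n) : ~ nondeg s -> symb s = 0.
Proof. by move=> sd; rewrite /symb insubF //; exact/asboolP. Qed.

Lemma bsum_deg n (s : simplex C n.+1) : ~ nondeg s -> bsum s = 0.
Proof.
case: s => x c /degP[k kn ck]; rewrite /bsum.
rewrite (bigD1 (Ordinal (ltnW kn : (k < n.+2)%N))) //=.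
rewrite (bigD1 (Ordinal (kn : (k.+1 < n.+2)%N))) /=; last first.
  by rewrite -val_eqE /= eqn_leq ltnn.
rewrite big1 => [|i /andP[ik ik1]]; last first.
  by rewrite symb_deg ?scaler0 //; exact: (face_deg kn (ltn_ord i) ck).
by rewrite face_idat // exprS mulN1r scaleNr addr0 subrr.
Qed.

Lemma nerve_diff_symb n (s : simplex C n.+1) : nerve_diff (symb s) = bsum s.
Proof.
rewrite /symb; case: insubP => [t _ <-|/asboolPn sd].
  by rewrite /nerve_diff freeliftU.
by rewrite linear0 bsum_deg.
Qed.

Lemma sum_cancel (V : lmodType R) m (G : nat -> nat -> V) :
  (forall i j, (j < i)%N -> (i < m.+1)%N -> G i j = - G j i.-1) ->
  \sum_(i < m.+1) \sum_(j < m) G i j = 0.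
Proof.
move=> GE; have splitG (i : 'I_m.+1) : \sum_(j < m) G i j =
    \sum_(j < m | (j < i)%N) G i j + \sum_(j < m | (i <= j)%N) G i j.
  rewrite (bigID (fun j : 'I_m => (j < i)%N)) /=; congr (_ + _).
  by apply: eq_bigl => j; rewrite -leqNgt.
rewrite (eq_bigr _ (fun i _ => splitG i)) big_split /=.
rewrite [X in _ + X]big_ord_recr /= [X in _ + (_ + X)]big1 ?addr0; last first.
  by move=> j; rewrite leqNgt ltn_ord.
rewrite (exchange_big_dep xpredT) //= -big_split big1 //= => j _.
rewrite big_mkcond big_ord_recl /= add0r [X in _ + X]big_mkcond -big_split.
rewrite big1 //= => i _; rewrite /bump /= add1n ltnS.
by case: leqP => ji; rewrite ?addr0 // GE ?ltnS //= addNr.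
Qed.

Lemma nerve_diffK n (x : nerve_obj n.+2) : nerve_diff (nerve_diff x) = 0.
Proof.
pose F : {linear nerve_obj n.+2 -> nerve_obj n} :=
  @nerve_diff n \o @nerve_diff n.+1.
rewrite -[LHS]/(F x) -[RHS]/((\0 : {linear _ -> _}) x).
apply: freelift_eq => t; rewrite {}/F /= {2}/nerve_diff freeliftU /bsum.
rewrite linear_sum /=.
under eq_bigr => i _ do
  rewrite linearZ_LR /= nerve_diff_symb /bsum scaler_sumr.
apply: (@sum_cancel _ n.+2 (fun i j =>
  (-1) ^+ i *: ((-1) ^+ j *: symb (face j (face i (val t)))))) => i j ji iN.
rewrite face_face //; case: i ji iN => // i ji iN /=.
by rewrite exprS mulN1r scaleNr !scalerA mulrC.
Qed.

Definition nerve : complex R :=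
  @Complex R nerve_obj (fun n => @nerve_diff n) nerve_diffK.
End Nerve.

Section PathHomology.
Variables (R : comNzRingType) (M : markedcat).

Definition marked_sub n : submodClosed (nerve R M n) :=
  span (fun v => exists2 s : simplex M n,
    chain_all (fun x y (f : hom x y) => marked f) (projT2 s) &
    v = symb R s).

Definition Omega : complex R := subcx marked_sub.

Definition PH n : lmodType R := homology Omega n.
End PathHomology.

(* Main.v *)
(** Write [NC] for the normalized nerve, spanned by non-degenerate simplices, and
    [NM] for the span of the marked ones, so that [Omega_n M] is the kernel of
    [NM_n -> NC_n-1 / NM_n-1].

    A marked simplex of the box product is a shuffle of a marked simplex of [M] and
    one of [M'].  When an element of [Omega (box M M')] is differentiated, a face
    composing an arrow of [M] with an arrow of [M'] is unmarked, and it comes from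
    exactly two shuffles, which differ by the exchange of two adjacent arrows.
    Hence its coefficients are antisymmetric under such exchanges: it is the
    Eilenberg-Zilber shuffle product of its components on the simplices in which all
    the arrows of [M] come first, and these components are those of the
    Alexander-Whitney map.  As shuffle products commute with the differentials, this
    identifies [Omega (box M M')] with the [theta] in [NM (x) NM'] whose
    differential is again in [NM (x) NM'].  Comparing bidegrees, the two partial
    differentials of [theta] must be marked separately, and over a principal ideal
    domain kernels split off, so that [theta] lies in [Omega M (x) Omega M'].

    The path complexes embed in free modules, so all their modules of cycles and
    boundaries are projective.  With the resulting splittings the Kunneth sequence is
    explicit: a cycle is sent to [H_i (x) H'_j] by the two retractions onto cycles,
    and to [ker (B_i (x) H'_j -> Z_i (x) H'_j) = Tor_1 (H_i, H'_j)] by the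
    differential of the first factor and the retraction of the second. *)

From HB Require Import structures.
From mathcomp Require Import all_boot ssrAC ssralg boolp.
From mathcomp Require wochoice.
From mathcomp Require Import freeg.
Require Import Defs.

Set Implicit Arguments.
Unset Strict Implicit.
Unset Printing Implicit Defensive.

Import GRing.Theory.
Local Open Scope ring_scope.

(** * Submodules of free modules over a principal ideal domain *)

(** The categories may be infinite, so submodules of free modules of arbitrary rank have to be
    projective; this comes from a well-order on the basis and generators of the ideals of leading
    coefficients. The spans of marked simplices are not subcomplexes, and the Alexander-Whitney
    components used here are not a chain map on the whole nerve. The isomorphism is therefore the
    shuffle map [Theta]; the components [AW] only serve to prove it injective ([AW] after [EZ] is
    the identity) and surjective ([EZ_AW]). Over a general ring, a tensor killed by [s (x) 1] and by
    [1 (x) s'] need not come from [ker s (x) ker s']: with [s = s'] multiplication by 2 on the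
    integers modulo 4, the element 2 does not. This is where the principal ideal domain enters the
    isomorphism. Lengths of chains add up only propositionally. To avoid transports, maps on chains
    take a continuation or a separate total length, and elements of tensor complexes are extended by
    zero to families over all bidegrees. *)

Lemma well_ordered_by (T : eqType) : exists R : rel T,
  [/\ total R, antisymmetric R, transitive R &
   forall P : T -> Prop,
     (forall s, (forall t, t != s -> R t s -> P t) -> P s) -> forall s, P s].
Proof.
have [R Rwo] := wochoice.well_ordering_principle T; exists R.
have /wochoice.withinW-/(_ predT) Rch := Rwo.
have Rtot : total R by move=> x y; exact: (wochoice.wo_chainW Rch).
have Rasym : antisymmetric R.
  by move=> x y; exact: (wochoice.wo_chain_antisymmetric Rch).
split=> // [y x z Rxy Ryz|P IP s].
  (* Transitivity is read off from the least element of the set of [x], [y] and [z]; antisymmetry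
     settles the cases where it is not [x]. *)
  have [|m [[/= mA mmin] _]] := Rwo [pred u | u \in [:: x; y; z]].
    by exists x; rewrite !inE eqxx.
  have xA : x \in [pred u | u \in [:: x; y; z]] by rewrite !inE eqxx.
  have yA : y \in [pred u | u \in [:: x; y; z]] by rewrite !inE eqxx orbT.
  have zA : z \in [pred u | u \in [:: x; y; z]] by rewrite !inE eqxx !orbT.
  move: mA; rewrite !inE => /or3P[] /eqP mE; rewrite {}mE in mmin.
  - exact: mmin.
  - by rewrite (Rasym x y) // Rxy mmin.
  - by rewrite -(Rasym y z) // Ryz mmin.
apply: contrapT => nPs.
have [|m [[/= mA mmin] _]] := Rwo (fun t => ~~ `[< P t >]).
  by exists s; exact/asboolPn.
move/asboolPn: mA; apply; apply: IP => t tm Rtm; apply: contrapT => nPt.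
have /mmin Rmt : t \in (fun t => ~~ `[< P t >]) by exact/asboolPn.
by move/eqP: tm; apply; apply: Rasym; rewrite Rtm.
Qed.

Lemma maximum_of_seq (T : eqType) (R : rel T) (s : seq T) :
  total R -> transitive R -> s != [::] ->
  exists2 m, m \in s & forall t, t \in s -> R t m.
Proof.
move=> Rtot Rtr; elim: s => // x s IH _.
have Rxx u : R u u by have := Rtot u u; rewrite orbb.
case: (s =P [::]) => [->|/eqP/IH[m ms mmax]].
  by exists x; rewrite ?mem_head // => t; rewrite inE => /eqP->.
case/orP: (Rtot x m) => [Rxm|Rmx].
  by exists m; rewrite ?inE ?ms ?orbT // => t; rewrite inE => /orP[/eqP->|/mmax].
exists x; rewrite ?mem_head // => t; rewrite inE => /orP[/eqP->//|/mmax Rtm].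
exact: Rtr Rtm Rmx.
Qed.

Section Linear.
Variable R : comNzRingType.
Implicit Types U V W X : lmodType R.

Definition mklin U V (f : U -> V) (lf : linear f) : {linear U -> V} :=
  HB.pack f (GRing.isLinear.Build R U V *:%R f lf).

Lemma linear_inverse U V (f : {linear U -> V}) : injective f ->
  (forall v, exists u, f u = v) ->
  {g : {linear V -> U} | cancel f g /\ cancel g f}.
Proof.
move=> finj fsurj.
pose g v := projT1 (cid (fsurj v)).
have gK v : f (g v) = v by rewrite /g; case: cid.
have glin : linear g by move=> a x y; apply: finj; rewrite linearP !gK.
by exists (mklin glin); split=> [x|//]; apply: finj; rewrite gK.
Qed.

Lemma linear_inj U V (f : {linear U -> V}) :
  (forall u, f u = 0 -> u = 0) -> injective f.
Proof.
by move=> f0 x y fxy; apply/subr0_eq/f0; rewrite linearB fxy subrr.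
Qed.

Section Freeg.
Variable T : choiceType.
Implicit Types D : {freeg T / R}.

Lemma freegUZ k (x : T) : <<k *g x>> = k *: (<<x>> : {freeg T / R}).
Proof. by apply/eqP/freeg_eqP => y; rewrite coeffZ !coeffU mul1r. Qed.

Lemma freeg_sumZ D : D = \sum_(x <- dom D) coeff x D *: <<x>>.
Proof.
by rewrite -[LHS]freeg_sumE; apply: eq_bigr => x _; rewrite freegUZ.
Qed.

Lemma freeliftE V (f : T -> V) D :
  freelift f D = \sum_(x <- dom D) coeff x D *: f x.
Proof.
rewrite {1}[D]freeg_sumZ linear_sum; apply: eq_bigr => x _.
by rewrite linearZ_LR /= freeliftU.
Qed.

Lemma coeff_linear (x : T) : linear (@coeff R T x : {freeg T / R} -> R^o).
Proof. by move=> a u v; rewrite coeffD coeffZ. Qed.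

Definition coefl (x : T) : {linear {freeg T / R} -> R^o} :=
  mklin (coeff_linear x).

Lemma coeflU (x y : T) : coefl x <<y>> = (y == x)%:R.
Proof. by rewrite /= coeffU mul1r. Qed.

Lemma freeg_ind (P : {freeg T / R} -> Prop) :
  P 0 -> (forall a u v, P u -> P v -> P (a *: u + v)) -> (forall x, P <<x>>) ->
  forall D, P D.
Proof.
move=> P0 PD PU D; rewrite [D]freeg_sumZ.
elim: (dom D) (fun x => coeff x D) => [|x s IH] c; first by rewrite big_nil.
by rewrite big_cons; apply: PD => //; exact: IH.
Qed.

Lemma freelift_lift U V (p : {linear U -> V}) (f : {linear {freeg T / R} -> V}) :
  (forall D, exists u, p u = f D) ->
  {g : {linear {freeg T / R} -> U} | forall D, p (g D) = f D}.
Proof.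
move=> pf; exists (freelift (fun x => projT1 (cid (pf <<x>>)))) => D.
rewrite -[LHS]/((p \o freelift _ : {linear _ -> _}) D).
by apply: freelift_eq => x /=; rewrite freeliftU; case: cid.
Qed.
End Freeg.

Lemma free_coverE V (v : V) : free_cover V <<v>> = v.
Proof. exact: freeliftU. Qed.

(** Being a direct summand of the standard free module over [V] amounts to
    projectivity. *)
Definition projective V :=
  exists s : {linear V -> {freeg V / R}}, forall v, free_cover V (s v) = v.

Lemma projective_lift U V W (p : {linear U -> W}) (f : {linear V -> W}) :
  projective V -> (forall v, exists u, p u = f v) ->
  {g : {linear V -> U} | forall v, p (g v) = f v}.
Proof.
move=> /cid[s sK] pf.
have [|g gE] := @freelift_lift V U W p (f \o free_cover V).
  by move=> D /=; exact: pf.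
by exists (g \o s) => v /=; rewrite gE /= sK.
Qed.

Lemma freeg_projective (T : choiceType) : projective {freeg T / R}.
Proof.
exists (freelift (fun x => <<(<<x>> : {freeg T / R})>>)) => D.
rewrite -[LHS]/((free_cover _ \o freelift _ : {linear _ -> _}) D).
rewrite -[RHS]/((idfun : {linear _ -> _}) D).
by apply: freelift_eq => x /=; rewrite freeliftU free_coverE.
Qed.

(** An abstract embedding, rather than being a submodule of a fixed free module, makes the property
    pass to submodules of submodules such as cycles in [Omega]. *)
Definition subfree V :=
  exists T : choiceType, exists f : {linear V -> {freeg T / R}}, injective f.

Lemma subfree_inj U V (f : {linear U -> V}) :
  injective f -> subfree V -> subfree U.
Proof.
by move=> finj [T [g ginj]]; exists T, (g \o f); exact: inj_comp ginj finj.
Qed.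

Lemma subfree_freeg (T : choiceType) : subfree {freeg T / R}.
Proof. by exists T, idfun. Qed.

Lemma submod_val_inj V (S : submodClosed V) : injective (submod_val S).
Proof. exact: val_inj. Qed.

Lemma subfree_submod V (S : submodClosed V) : subfree V -> subfree (submod S).
Proof. exact/subfree_inj/submod_val_inj. Qed.
End Linear.

Section PID.
Variables (K : idomainType) (K_PID : is_PID K).

(** The coefficients at [s] of the [f v] supported below [s] form an ideal, and [y s] realises a
    generator. If the ideal is zero, the coefficient of [f (y s)] at [s] vanishes and [y s] has to
    be discarded later. *)
Lemma leading_basis (V : lmodType K) (S : choiceType) (R : rel S)
    (f : {linear V -> {freeg S / K}}) :
  exists y : S -> V, forall s,
    (forall t, coeff t (f (y s)) != 0 -> R t s) /\
    forall v, (forall t, coeff t (f v) != 0 -> R t s) ->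
      exists r, coeff s (f v) = r * coeff s (f (y s)).
Proof.
suff ex s : exists y : V, (forall t, coeff t (f y) != 0 -> R t s) /\
    forall v, (forall t, coeff t (f v) != 0 -> R t s) ->
      exists r, coeff s (f v) = r * coeff s (f y).
  by exists (fun s => projT1 (cid (ex s))) => s; case: cid.
pose I : {pred K^o} := fun a => `[< exists2 v : V,
  (forall t, coeff t (f v) != 0 -> R t s) & a = coeff s (f v) >].
have Iclosed : submod_closed I.
  split=> [|a x z /asboolP[v vs ->] /asboolP[w ws ->]]; apply/asboolP.
    by exists 0 => [t|]; rewrite linear0 coeff0 ?eqxx.
  exists (a *: v + w) => [t|]; rewrite linearP coeffD coeffZ //.
  apply: contraR => nR.
  have /eqP -> : coeff t (f v) == 0 by apply: contraR nR => /vs.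
  have /eqP -> : coeff t (f w) == 0 by apply: contraR nR => /ws.
  by rewrite mulr0 addr0 eqxx.
have [a aP] := K_PID Iclosed.
have /asboolP[y ys ay] : a \in I by apply/aP; exists 1; rewrite mul1r.
exists y; split=> // v vs; rewrite -ay; apply/aP/asboolP.
by exists v.
Qed.

Lemma subfree_projective (V : lmodType K) : subfree V -> projective V.
Proof.
(* The [y s] with a non-zero leading coefficient form a basis. *)
case=> S [f finj]; have [R [Rtot Rasym Rtr Rind]] := well_ordered_by S.
have [y yP] := leading_basis R f.
have f0 v : f v = 0 -> v = 0 by move=> fv; apply: finj; rewrite fv linear0.
pose Phi : {linear {freeg S / K} -> V} := freelift y.
(* Good combinations involve only the [y s] that belong to the basis; on them [Phi] is shown to be
   bijective. *)
pose good (D : {freeg S / K}) :=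
  forall s, coeff s D != 0 -> coeff s (f (y s)) != 0.
have maxP (D : {freeg S / K}) : D != 0 ->
    exists2 m, coeff m D != 0 & forall t, coeff t D != 0 -> R t m.
  rewrite -dom_eq0 => /(maximum_of_seq Rtot Rtr)[m mD mmax].
  by exists m => [|t tD]; [rewrite -mem_dom | apply: mmax; rewrite mem_dom].
have goodD a D D' : good D -> good D' -> good (a *: D + D').
  move=> gD gD' s; rewrite coeffD coeffZ; case: (coeff s D =P 0) => [->|/eqP/gD//].
  by rewrite mulr0 add0r => /gD'.
(* At the largest index [m] of [D] only [y m] contributes, and its contribution is a product of two
   nonzero elements of a domain. *)
have uniqD D : good D -> Phi D = 0 -> D = 0.
  move=> gD D0; apply/eqP; apply: contraT => /maxP[m mD mmax].
  have : coeff m (f (Phi D)) = 0 by rewrite D0 linear0 coeff0.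
  rewrite /Phi /= freeliftE linear_sum raddf_sum /=.
  rewrite (bigD1_seq m) ?mem_dom ?uniq_dom //= big_seq_cond big1 => [|t].
    rewrite addr0 linearZ_LR coeffZ => /eqP; rewrite mulf_eq0 (negPf mD).
    by rewrite (negPf (gD _ mD)).
  case/andP; rewrite mem_dom => tD tm; rewrite linearZ_LR coeffZ.
  suff /eqP -> : coeff m (f (y t)) == 0 by rewrite mulr0.
  apply: contraNT tm => /(yP t).1 Rmt; apply/eqP/Rasym.
  by rewrite mmax.
have exD s v : (forall t, coeff t (f v) != 0 -> R t s) ->
    exists2 D, good D & Phi D = v.
  move: v; apply: (Rind (fun s => forall v,
    (forall t, coeff t (f v) != 0 -> R t s) -> exists2 D, good D & Phi D = v)).
  move=> {}s IH v vs; have [r rE] := (yP s).2 v vs.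
  (* When the ideal at [s] is zero, [f v] has no coefficient at [s] to cancel, and the value 0 keeps
     the combination good. *)
  pose r' := if coeff s (f (y s)) == 0 then 0 else r.
  have gr : good (r' *: <<s>>).
    move=> t; rewrite coeffZ coeffU; have [<-|_] := eqVneq s t; last first.
      by rewrite !mulr0 eqxx.
    by rewrite /r'; case: (coeff s _ =P 0) => // _; rewrite mul0r eqxx.
  have PE : Phi (r' *: <<s>>) = r' *: y s by rewrite linearZ_LR /= freeliftU.
  have [wE|w0] := eqVneq (f (v - r' *: y s)) 0.
    by exists (r' *: <<s>>) => //; rewrite PE; apply/esym/subr0_eq/f0.
  have ws t : coeff t (f (v - r' *: y s)) != 0 -> R t s.
    rewrite linearB linearZ_LR coeffB coeffZ => tn; apply: contraT => nR.
    have /eqP vt : coeff t (f v) == 0 by apply: contraR nR => /vs.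
    have /eqP yt : coeff t (f (y s)) == 0 by apply: contraR nR => /(yP s).1.
    by rewrite vt yt mulr0 subr0 eqxx in tn.
  have [m mD mmax] := maxP _ w0.
  (* Subtracting [r' *: y s] cancels the coefficient at [s], so the leading index strictly decreases
     and the induction hypothesis applies. *)
  have ms : m != s.
    apply: contra_neq mD => ->; rewrite linearB linearZ_LR coeffB coeffZ rE /r'.
    by case: eqP => [->|_]; rewrite ?mulr0 ?mul0r subrr.
  have [D gD DE] := IH m ms (ws _ mD) _ mmax.
  exists (1 *: (r' *: <<s>>) + D); last first.
    by rewrite scale1r linearD PE DE addrC subrK.
  exact: goodD.
have {exD}exD v : exists2 D, good D & Phi D = v.
  have [fv|/maxP[m _ /exD]//] := eqVneq (f v) 0.
  by exists 0; [move=> s; rewrite coeff0 eqxx | rewrite linear0 (f0 v fv)].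
(* Good preimages are unique, which makes the chosen one depend linearly on [v]. *)
pose sec v := s2val (cid2 (exD v)).
have secP v : good (sec v) /\ Phi (sec v) = v by rewrite /sec; case: cid2.
have sec_lin : linear sec.
  move=> a u v; apply/subr0_eq/uniqD.
    have [[gu _] [gv _]] := (secP u, secP v); have [guv _] := secP (a *: u + v).
    by rewrite -scaleN1r [sec _ + _]addrC; apply: (goodD (-1)) => //; exact: (goodD a).
  by rewrite linearB linearP !(secP _).2 subrr.
exists (freelift (fun s => <<y s>>) \o mklin sec_lin) => v.
rewrite -[RHS](secP v).2.
rewrite -[LHS]/((free_cover V \o freelift _ : {linear _ -> _}) (sec v)).
by apply: freelift_eq => s /=; rewrite !freeliftU.
Qed.
End PID.

(** * Tensor products *)

Section Tensors.
Variable R : comNzRingType.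
Implicit Types U V W X : lmodType R.

Lemma kersubP U V (f : {linear U -> V}) x : reflect (f x = 0) (x \in kersub f).
Proof. exact: mksubmodP. Qed.

Lemma imsubP U V (f : {linear U -> V}) y :
  reflect (exists x, f x = y) (y \in imsub f).
Proof. exact: mksubmodP. Qed.

Lemma presubP U V (f : {linear U -> V}) (S : submodClosed V) x :
  reflect (f x \in S) (x \in presub f S).
Proof. exact: mksubmodP. Qed.

Lemma kersub_val U V (f : {linear U -> V}) (x : submod (kersub f)) :
  f (val x) = 0.
Proof. exact/kersubP/valP. Qed.

Lemma pure0l V W (w : W) : pure (0 : V) w = 0.
Proof. by rewrite -(scale0r (0 : V)) pureZl scale0r. Qed.

Lemma pure0r V W (v : V) : pure v (0 : W) = 0.
Proof. by rewrite -(scale0r (0 : W)) pureZr scale0r. Qed.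

Lemma tens_lift V W X (B : V -> W -> X) :
  (forall w, linear (B^~ w)) -> (forall v, linear (B v)) ->
  {F : {linear tens V W -> X} | forall v w, F (pure v w) = B v w}.
Proof.
move=> Bl Br.
have BDl v v' w : B (v + v') w = B v w + B v' w := linearD (mklin (Bl w)) v v'.
have BDr v w w' : B v (w + w') = B v w + B v w' := linearD (mklin (Br v)) w w'.
have BZl a v w : B (a *: v) w = a *: B v w := linearZ_LR (mklin (Bl w)) a v.
have BZr a v w : B v (a *: w) = a *: B v w := linearZ_LR (mklin (Br v)) a w.
have relB (x : {freeg (V * W) / R}) :
    x \in span (@tens_rel R V W) -> freelift (fun p => B p.1 p.2) x = 0.
  apply: span_eq0 => _ [v v' w|v w w'|a v w|a v w];
    rewrite ?linearB ?linearD ?linearZ_LR /= !freeliftU /=.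
  - by rewrite BDl -opprD subrr.
  - by rewrite BDr -opprD subrr.
  - by rewrite BZl scalerN subrr.
  - by rewrite BZr scalerN subrr.
exists (qlift relB : {linear _ -> _}) => v w.
by apply: etrans (qliftE relB _) _; rewrite /= freeliftU.
Qed.

Lemma tens_ind V W (P : tens V W -> Prop) :
  P 0 -> (forall x y, P x -> P y -> P (x + y)) -> (forall v w, P (pure v w)) ->
  forall x, P x.
Proof.
move=> P0 PD Pp x; have [D ->] := cls_surj x; rewrite -[cls _ _]scale1r.
move: D (1 : R); apply: freeg_ind => [a|b u v IHu IHv a|[v w] a].
- by rewrite linear0 scaler0.
- by rewrite linearP scalerDr scalerA; apply: PD.
- by rewrite -[cls _ _]/(pure v w) -pureZl.
Qed.

Section TmapLinear.
Variables (U V U' V' : lmodType R) (f : {linear U -> V}) (g : {linear U' -> V'}).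

Lemma tmap0 : tmap f g 0 = 0. Proof. exact: linear0. Qed.
Lemma tmapD x y : tmap f g (x + y) = tmap f g x + tmap f g y.
Proof. exact: linearD. Qed.
Lemma tmapB x y : tmap f g (x - y) = tmap f g x - tmap f g y.
Proof. exact: linearB. Qed.
Lemma tmapZ a x : tmap f g (a *: x) = a *: tmap f g x.
Proof. exact: linearZ_LR. Qed.
End TmapLinear.

Lemma tmap_comp U V W U' V' W' (f : {linear V -> W}) (g : {linear V' -> W'})
    (f' : {linear U -> V}) (g' : {linear U' -> V'}) x :
  tmap f g (tmap f' g' x) = tmap (f \o f') (g \o g') x.
Proof.
elim/tens_ind: x => [|x y hx hy|v w]; first by rewrite !tmap0.
  by rewrite !tmapD hx hy.
by rewrite !tmapE.
Qed.

Lemma tmap_ext U V U' V' (f f' : {linear U -> V}) (g g' : {linear U' -> V'}) x :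
  f =1 f' -> g =1 g' -> tmap f g x = tmap f' g' x.
Proof.
move=> ff' gg'.
elim/tens_ind: x => [|x y hx hy|v w]; first by rewrite !tmap0.
  by rewrite !tmapD hx hy.
by rewrite !tmapE ff' gg'.
Qed.

Lemma tmap_id V W (f : {linear V -> V}) (g : {linear W -> W}) x :
  f =1 id -> g =1 id -> tmap f g x = x.
Proof.
move=> fid gid.
elim/tens_ind: x => [|x y hx hy|v w]; first by rewrite !tmap0.
  by rewrite !tmapD hx hy.
by rewrite !tmapE fid gid.
Qed.

Lemma tmap0l U V U' V' (f : {linear U -> V}) (g : {linear U' -> V'}) x :
  (forall u, f u = 0) -> tmap f g x = 0.
Proof.
move=> f0; elim/tens_ind: x => [|x y hx hy|v w]; rewrite ?tmap0 //.
  by rewrite tmapD hx hy addr0.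
by rewrite tmapE f0 pure0l.
Qed.

Lemma tmap0r U V U' V' (f : {linear U -> V}) (g : {linear U' -> V'}) x :
  (forall u, g u = 0) -> tmap f g x = 0.
Proof.
move=> f0; elim/tens_ind: x => [|x y hx hy|v w]; rewrite ?tmap0 //.
  by rewrite tmapD hx hy addr0.
by rewrite tmapE f0 pure0r.
Qed.

Lemma tmapDl U V U' V' (f f' : {linear U -> V}) (g : {linear U' -> V'}) x :
  tmap (f \+ f') g x = tmap f g x + tmap f' g x.
Proof.
elim/tens_ind: x => [|x y hx hy|v w]; first by rewrite !tmap0 addr0.
  by rewrite !tmapD hx hy addrACA.
by rewrite !tmapE /= pureDl.
Qed.

Lemma tmapDr U V U' V' (f : {linear U -> V}) (g g' : {linear U' -> V'}) x :
  tmap f (g \+ g') x = tmap f g x + tmap f g' x.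
Proof.
elim/tens_ind: x => [|x y hx hy|v w]; first by rewrite !tmap0 addr0.
  by rewrite !tmapD hx hy addrACA.
by rewrite !tmapE /= pureDr.
Qed.

Lemma tmap_surj U V U' V' (f : {linear U -> V}) (g : {linear U' -> V'}) :
  (forall v, exists u, f u = v) -> (forall v, exists u, g u = v) ->
  forall y, exists x, tmap f g x = y.
Proof.
move=> fs gs; elim/tens_ind => [|x y [x' <-] [y' <-]|v w].
- by exists 0; rewrite tmap0.
- by exists (x' + y'); rewrite tmapD.
- by have [[u <-] [u' <-]] := (fs v, gs w); exists (pure u u'); rewrite tmapE.
Qed.

Lemma tens_swap V W : {s : {linear tens V W -> tens W V} |
  forall v w, s (pure v w) = pure w v}.
Proof.
apply: tens_lift => [w a v v'|v a w w'].
  by rewrite pureDr pureZr.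
by rewrite pureDl pureZl.
Qed.

(** Lifting the second factor along [p] is ambiguous only up to the image of [i], so it gives a
    well-defined map [F] from [V (x) W'] to the cokernel [Q] of [1 (x) i]. As [F] after [1 (x) p] is
    the quotient map, the kernel of [1 (x) p] lies in the image of [1 (x) i]. *)
Lemma tens_right_exact V U W W' (i : {linear U -> W}) (p : {linear W -> W'}) :
  (forall z, exists w, p w = z) ->
  (forall w, p w = 0 -> exists u, i u = w) ->
  forall x : tens V W, tmap idfun p x = 0 -> exists y, tmap idfun i y = x.
Proof.
move=> /(_ _)/cid ps ker x px.
pose Q := quotmod (imsub (tmap (idfun : {linear V -> V}) i)).
pose B v w' : Q := cls _ (pure v (projT1 (ps w'))).
have BE v w : B v (p w) = cls _ (pure v w).
  apply: cls_eqP; apply/mksubmodP; case: (ps _) => w' /= pw'.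
  have [|u iu] := ker (w' - w); first by rewrite linearB pw' subrr.
  exists (pure v u); rewrite tmapE /= iu pureDr.
  by rewrite -[X in _ + pure v X]scaleN1r pureZr scaleN1r.
have [|v a w' z'|F FE] := @tens_lift V W' Q B.
- by move=> w' a v v'; rewrite /B pureDl pureZl linearP.
- case: (ps w') (ps z') => w <- [z <-].
  by rewrite -linearP !BE pureDr pureZr linearP.
have : F (tmap idfun p x) = cls _ x.
  elim/tens_ind: x {px} => [|x y hx hy|v w]; rewrite ?linear0 //.
    by rewrite !linearD /= hx hy.
  by rewrite tmapE FE BE.
by rewrite px linear0 => /esym/eqP; rewrite cls_eq0 => /mksubmodP.
Qed.

Lemma tens_coord U (T : choiceType) (t : T) :
  {c : {linear tens U {freeg T / R} -> U} |
    forall u D, c (pure u D) = coeff t D *: u}.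
Proof.
apply: tens_lift => [D a u u'|u a D D'].
  by rewrite scalerDr !scalerA mulrC.
by rewrite coeffD coeffZ scalerDl scalerA.
Qed.

Definition tcoord U (T : choiceType) (t : T) := sval (@tens_coord U T t).

Arguments tcoord {U T} t.

Lemma tcoordE U (T : choiceType) (t : T) (u : U) (D : {freeg T / R}) :
  tcoord t (pure u D) = coeff t D *: u.
Proof. by rewrite /tcoord; case: tens_coord. Qed.

(** The expansion is claimed for every duplicate-free list containing [s], so that the supports of
    two summands can be merged in the induction. *)
Lemma tcoord_sum U (T : choiceType) (x : tens U {freeg T / R}) :
  exists s : seq T, forall s', uniq s' -> {subset s <= s'} ->
    x = \sum_(t <- s') pure (tcoord t x) <<t>>.
Proof.
elim/tens_ind: x => [|x y [s sE] [t tE]|u D].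
- by exists [::] => s' _ _; rewrite big1 // => t _; rewrite linear0 pure0l.
- exists (s ++ t) => s' us' st.
  rewrite [in LHS](sE s' us') => [|z zs]; last by rewrite st ?mem_cat ?zs.
  rewrite [in LHS](tE s' us') => [|z zs]; last by rewrite st ?mem_cat ?zs ?orbT.
  by rewrite -big_split; apply: eq_bigr => z _; rewrite linearD pureDl.
- exists (dom D) => s' us' st.
  have DE : D = \sum_(t <- s') coeff t D *: <<t>>.
    rewrite [LHS]freeg_sumZ [RHS](bigID (fun t => t \in dom D)) /=.
    rewrite [X in _ = _ + X]big1 ?addr0 => [|t tD]; last first.
      by rewrite coeff_outdom // scale0r.
    rewrite -[RHS]big_filter; apply: perm_big; apply: uniq_perm.
    - exact: uniq_dom.
    - exact: filter_uniq.
    by move=> t; rewrite mem_filter; case: (boolP (t \in dom D)) => // /st ->.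
  rewrite {1}DE; elim: (s') => [|t r IH]; first by rewrite !big_nil pure0r.
  by rewrite !big_cons pureDr IH tcoordE pureZl pureZr.
Qed.

Lemma tcoord_eq0 U (T : choiceType) (x : tens U {freeg T / R}) :
  (forall t, tcoord t x = 0) -> x = 0.
Proof.
move=> x0; have [s sE] := tcoord_sum x; rewrite (sE (undup s)) ?undup_uniq //.
  by rewrite big1 // => t _; rewrite x0 pure0l.
by move=> t; rewrite mem_undup.
Qed.

Lemma tcoord_tmap U V (T : choiceType) (f : {linear U -> V}) t
    (x : tens U {freeg T / R}) :
  tcoord t (tmap f idfun x) = f (tcoord t x).
Proof.
elim/tens_ind: x => [|x y hx hy|u D]; first by rewrite !linear0.
  by rewrite !linearD /= hx hy.
by rewrite tmapE !tcoordE linearZ_LR.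
Qed.

(** [W] is a direct summand of a free module, and when the second factor is free, vanishing is
    tested coordinate by coordinate, where [f] acts as itself. *)
Lemma projective_flatl U V W (f : {linear U -> V}) :
  projective W -> injective f ->
  injective (tmap f (idfun : {linear W -> W})).
Proof.
move=> [s sK] finj; apply: linear_inj => x fx.
have sx0 : tmap idfun s x = 0.
  apply: tcoord_eq0 => t; apply: finj; rewrite -tcoord_tmap tmap_comp linear0.
  have -> : tmap (f \o idfun) (idfun \o s) x = tmap idfun s (tmap f idfun x).
    by rewrite tmap_comp; apply: tmap_ext.
  by rewrite fx !linear0.
have <- : tmap idfun (free_cover W) (tmap idfun s x) = x.
  by rewrite tmap_comp; apply: tmap_id.
by rewrite sx0 linear0.
Qed.

Lemma tens_swap_tmap U V U' V' (f : {linear U -> V}) (g : {linear U' -> V'}) x :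
  sval (tens_swap V V') (tmap f g x) = tmap g f (sval (tens_swap U U') x).
Proof.
case: (tens_swap V V') (tens_swap U U') => s sE [s' s'E] /=.
elim/tens_ind: x => [|x y hx hy|u v]; first by rewrite !linear0.
  by rewrite !linearD /= hx hy.
by rewrite s'E !tmapE sE.
Qed.

Lemma tens_swapK V W : cancel (sval (tens_swap V W)) (sval (tens_swap W V)).
Proof.
case: (tens_swap V W) (tens_swap W V) => s sE [s' s'E] /= x.
elim/tens_ind: x => [|x y hx hy|u v]; first by rewrite !linear0.
  by rewrite !linearD /= hx hy.
by rewrite sE s'E.
Qed.

Lemma projective_flatr U V W (f : {linear U -> V}) :
  projective W -> injective f ->
  injective (tmap (idfun : {linear W -> W}) f).
Proof.
move=> Wp finj x y /(congr1 (sval (tens_swap W V))); rewrite !tens_swap_tmap.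
by move=> /(projective_flatl Wp finj)/(can_inj (@tens_swapK W U)).
Qed.

Lemma tens_left_exact V U W W' (i : {linear U -> W}) (p : {linear W -> W'}) :
  (forall z, exists w, p w = z) ->
  (forall w, p w = 0 -> exists u, i u = w) ->
  forall x : tens W V, tmap p idfun x = 0 -> exists y, tmap i idfun y = x.
Proof.
move=> ps ker x /(congr1 (sval (tens_swap W' V))).
rewrite tens_swap_tmap [RHS]linear0 => /(tens_right_exact ps ker)[y yE].
exists (sval (tens_swap V U) y).
by rewrite -tens_swap_tmap yE tens_swapK.
Qed.

Lemma tmap_fuse U V W U' V' W' (f : {linear V -> W}) (g : {linear V' -> W'})
    (f' : {linear U -> V}) (g' : {linear U' -> V'})
    (f2 : {linear U -> W}) (g2 : {linear U' -> W'}) x :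
  (forall u, f (f' u) = f2 u) -> (forall u, g (g' u) = g2 u) ->
  tmap f g (tmap f' g' x) = tmap f2 g2 x.
Proof. by move=> fE gE; rewrite tmap_comp; exact: tmap_ext. Qed.

Lemma tmap_fuse0l U V W U' V' W' (f : {linear V -> W}) (g : {linear V' -> W'})
    (f' : {linear U -> V}) (g' : {linear U' -> V'}) x :
  (forall u, f (f' u) = 0) -> tmap f g (tmap f' g' x) = 0.
Proof. by move=> f0; rewrite tmap_comp tmap0l. Qed.

Lemma tmap_fuse0r U V W U' V' W' (f : {linear V -> W}) (g : {linear V' -> W'})
    (f' : {linear U -> V}) (g' : {linear U' -> V'}) x :
  (forall u, g (g' u) = 0) -> tmap f g (tmap f' g' x) = 0.
Proof. by move=> g0; rewrite tmap_comp tmap0r. Qed.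
End Tensors.

(** * Torsion groups from arbitrary projective presentations *)

Section Homology.
Variable R : comNzRingType.
Implicit Types (C D : complex R).

(** The hypotheses make [h] bijective on the kernel of [g], and [f] is its inverse there. Thus the
    Kunneth sequence needs only maps out of homology, which are easily defined on a quotient. *)
Lemma short_exact_retract (U V W : lmodType R) (g : {linear V -> W})
    (h : {linear V -> U}) :
  (forall w, exists v, g v = w) ->
  (forall u, exists2 v, g v = 0 & h v = u) ->
  (forall v, g v = 0 -> h v = 0 -> v = 0) ->
  exists f : {linear U -> V}, short_exact f g.
Proof.
move=> gs hs gh0; pose h' : {linear submod (kersub g) -> U} := h \o submod_val _.
have [||f [fK h'K]] := @linear_inverse _ _ _ h'.
- apply: linear_inj => v h'v; apply/val_inj/gh0 => //.
  exact: kersub_val.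
- move=> u; have [v gv <-] := hs u.
  have kv : v \in kersub g by apply/kersubP.
  by exists (exist (fun v => v \in kersub g) v kv).
exists (submod_val _ \o f); split=> // [|v].
  exact: inj_comp (@submod_val_inj _ _ _) (can_inj h'K).
split=> [gv|[u <-]]; last exact: kersub_val.
have kv : v \in kersub g by apply/kersubP.
exists (h v).
exact: (congr1 val (fK (exist (fun v => v \in kersub g) v kv))).
Qed.

Section Tor.
Variables (V W B Z : lmodType R) (b : {linear B -> Z}) (p : {linear Z -> V}).
Hypotheses (Bp : projective B) (Zp : projective Z) (binj : injective b).
Hypotheses (ps : forall v, exists z, p z = v).
Hypotheses (pb : forall x, p (b x) = 0).
Hypotheses (pker : forall z, p z = 0 -> exists x, b x = z).

Section Resolution.
Variables (F : complex R) (d0 : {linear F 0 -> V}).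
Let d1 : {linear F 1 -> F 0} := cdiff F 0.
Let d2 : {linear F 2 -> F 1} := cdiff F 1.
Hypotheses (F0p : projective (F 0)) (F1p : projective (F 1)).
Hypotheses (d0s : forall v, exists x, d0 x = v) (d01 : forall x, d0 (d1 x) = 0).
Hypothesis exact0 : forall x, d0 x = 0 -> exists y, d1 y = x.
Hypothesis exact1 : forall x, d1 x = 0 -> exists y, d2 y = x.

(** Comparison of the presentation [B -> Z -> V] with the resolution [F], in degrees 0 and 1: [be0],
    [be1] and [al0], [al1] are chain maps both ways over the identity of [V], and [h], [k0], [k1]
    are the homotopies. They give [al1 be1 = 1 + h b] and [be1 al1 = 1 + k0 d1 + d2 k1]; after
    tensoring with [W], the extra terms vanish on cycles or are boundaries. *)
Lemma H1_resolution :
  exists t : {linear submod (kersub (tmap b (idfun : {linear W -> W}))) ->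
              homology (tmod F W) 1},
    injective t /\ forall y, exists x, t x = y.
Proof.
have d12 x : d1 (d2 x) = 0 by exact: cdiffK.
have [be0 be0E] := @projective_lift _ _ _ _ d0 p Zp (fun z => d0s (p z)).
have [|be1 be1E] := @projective_lift _ _ _ _ d1 (be0 \o b) Bp.
  by move=> x; apply: exact0; rewrite /= be0E pb.
have [al0 al0E] := @projective_lift _ _ _ _ p d0 F0p (fun x => ps (d0 x)).
have [|al1 al1E] := @projective_lift _ _ _ _ b (al0 \o d1) F1p.
  by move=> x; apply: pker; rewrite /= al0E d01.
have [|h hE] := @projective_lift _ _ _ _ b ((al0 \o be0) \- idfun) Zp.
  by move=> z; apply: pker; rewrite /= linearB al0E be0E subrr.
have [|k0 k0E] := @projective_lift _ _ _ _ d1 ((be0 \o al0) \- idfun) F0p.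
  by move=> z; apply: exact0; rewrite /= linearB be0E al0E subrr.
have [|k1 k1E] :=
    @projective_lift _ _ _ _ d2 ((be1 \o al1) \- (idfun \+ (k0 \o d1))) F1p.
  move=> z; apply: exact1; rewrite /= linearB linearD be1E /= al1E /= k0E /=.
  by rewrite subrKC subrr.
have be1_cycle x : x \in kersub (tmap b (idfun : {linear W -> W})) ->
    tmap be1 idfun x \in kersub (bdry (tmod F W) 1).
  move=> /kersubP bx; apply/kersubP.
  rewrite -[LHS]/(tmap d1 idfun (tmap be1 idfun x)) tmap_comp.
  rewrite (tmap_ext (f' := be0 \o b) (g' := idfun \o idfun)) //.
  by rewrite -tmap_comp bx tmap0.
exists (cls _ \o restrict be1_cycle : {linear _ -> homology (tmod F W) 1}); split.
  apply: linear_inj => -[x kx] /eqP; rewrite cls_eq0 => /presubP/imsubP[y /= yE].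
  apply: val_inj; have /kersubP bx := kx; rewrite /=.
  have /(congr1 (tmap al1 idfun)) : tmap d2 idfun y = tmap be1 idfun x by [].
  rewrite !tmap_comp [LHS]tmap0l => [|u]; last first.
    by apply: binj; rewrite /= al1E /= d12 !linear0.
  rewrite (tmap_ext (f' := idfun \+ (h \o b)) (g' := idfun)) // => [|u].
    by rewrite tmapDl -[tmap (h \o b) _ _](tmap_comp _ idfun b idfun) bx tmap0 addr0
       tmap_id.
  by apply: binj; rewrite /= al1E /= be1E /= linearD hE /= subrKC.
move=> y; have [[z kz] ->] := cls_surj y.
change (tens (F 1) W : Type) in z.
have dz : tmap d1 idfun z = 0 by exact/kersubP.
have kx : tmap al1 idfun z \in kersub (tmap b (idfun : {linear W -> W})).
  apply/kersubP; rewrite /= tmap_comp.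
  rewrite (tmap_ext (f' := al0 \o d1) (g' := idfun \o idfun)) //.
  by rewrite -tmap_comp dz tmap0.
exists (exist (fun x => x \in kersub _) _ kx); apply: cls_eqP.
apply/presubP/imsubP; exists (tmap k1 idfun z).
rewrite -[LHS]/(tmap d2 idfun (tmap k1 idfun z)).
rewrite -[RHS]/(tmap be1 idfun (tmap al1 idfun z) - z) !tmap_comp.
have k0z : tmap (k0 \o d1) (idfun : {linear W -> W}) z = 0.
  rewrite (tmap_ext (f' := k0 \o d1) (g' := idfun \o idfun)) //.
  by rewrite -tmap_comp dz tmap0.
rewrite [X in _ = X - _](tmap_ext (g' := idfun)
  (f' := (d2 \o k1) \+ (idfun \+ (k0 \o d1)))) // => [|u].
  by rewrite !tmapDl k0z addr0 [tmap idfun idfun z]tmap_id // addrK.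
by rewrite /= k1E subrK.
Qed.
End Resolution.

Lemma Tor1_resolution :
  exists t : {linear submod (kersub (tmap b (idfun : {linear W -> W}))) ->
              Tor 1 V W},
    injective t /\ forall y, exists x, t x = y.
Proof.
have exact (f : arrow R) x :
    amap f x = 0 -> exists y, amap (next_arrow f) y = x.
  move=> dx; have kx : x \in kersub (amap f) by apply/kersubP.
  exists <<(exist (fun u => u \in kersub (amap f)) x kx : submod _)>>.
  by rewrite /= freeliftU.
apply: (@H1_resolution (std_res V) (free_cover V)).
- exact: freeg_projective.
- exact: freeg_projective.
- by move=> v; exists <<v>>; exact: free_coverE.
- by move=> x; exact: kersub_val.
- by move=> x; exact: (exact (std_arrow V 0)).
- by move=> x; exact: (exact (std_arrow V 1)).
Qed.
End Tor.
End Homology.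

(** * The Kunneth sequence *)

(** Extension by a default value frees the indices from the proof of [P], so that shifted bidegrees
    can be written directly. *)
Lemma extend_family (P : pred (nat * nat)) (F : nat -> nat -> Type)
    (F0 : forall i j, F i j) (w : forall p : {p | P p}, F (val p).1 (val p).2) :
  exists E : forall i j, F i j,
    (forall p : {p | P p}, E (val p).1 (val p).2 = w p) /\
    (forall i j, ~~ P (i, j) -> E i j = F0 i j).
Proof.
have E i j : {x : F i j | (forall h : P (i, j),
    x = w (exist (fun p => P p) (i, j) h)) /\ (~~ P (i, j) -> x = F0 i j)}.
  have [Pij|nPij] := pselect (P (i, j)); last by exists (F0 i j); split.
  exists (w (exist (fun p => P p) (i, j) Pij)); split=> [h|/negP//].
  by rewrite (bool_irrelevance h Pij).
exists (fun i j => sval (E i j)); split=> [[[i j] h]|i j].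
  exact: (svalP (E i j)).1 h.
exact: (svalP (E i j)).2.
Qed.

Section Split.
Variable R : comNzRingType.

(** [sZ n] and [sB n] stand for the cycles and the boundaries in degree [n], and
    [H n] for their quotient. *)
Record splitting (C : complex R) (H : nat -> lmodType R) := Splitting {
  sZ : nat -> lmodType R;
  sB : nat -> lmodType R;
  sincl : forall n, {linear sZ n -> C n};
  sretr : forall n, {linear C n -> sZ n};
  sbdry : forall n, {linear sB n -> sZ n};
  sdiff : forall n, {linear C n.+1 -> sB n};
  ssec : forall n, {linear sB n -> C n.+1};
  sproj : forall n, {linear sZ n -> H n};
  sretrK : forall n z, sretr n (sincl n z) = z;
  ssecK : forall n x, sdiff n (ssec n x) = x;
  sdiffE : forall n x, cdiff C n x = sincl n (sbdry n (sdiff n x));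
  sdiff_incl : forall n z, sdiff n (sincl n.+1 z) = 0;
  ssplit0 : forall x, sincl 0 (sretr 0 x) = x;
  ssplitS : forall n x, sincl n.+1 (sretr n.+1 x) + ssec n (sdiff n x) = x;
  sbdry_inj : forall n, injective (sbdry n);
  sproj_surj : forall n h, exists z, sproj n z = h;
  sproj_bdry : forall n x, sproj n (sbdry n x) = 0;
  sproj_ker : forall n z, sproj n z = 0 -> exists x, sbdry n x = z
}.

Variables (C : complex R) (H : nat -> lmodType R) (SC : splitting C H).

Lemma sretr_diff n x : sretr SC n (cdiff C n x) = sbdry SC n (sdiff SC n x).
Proof. by rewrite (sdiffE SC) sretrK. Qed.

Lemma sproj_retr_diff n x : sproj SC n (sretr SC n (cdiff C n x)) = 0.
Proof. by rewrite sretr_diff sproj_bdry. Qed.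

Lemma sincl_inj n : injective (sincl SC n).
Proof. exact: can_inj (@sretrK _ _ SC n). Qed.

Lemma sretr_sec n x : sretr SC n.+1 (ssec SC n x) = 0.
Proof.
apply: sincl_inj; have := ssplitS SC (ssec SC n x); rewrite ssecK linear0.
by move=> /(canRL (addrK _)); rewrite subrr.
Qed.

Lemma cdiff_incl n z : cdiff C n (sincl SC n.+1 z) = 0.
Proof. by rewrite (sdiffE SC) sdiff_incl !linear0. Qed.

Lemma cdiff_sec n x : cdiff C n (ssec SC n x) = sincl SC n (sbdry SC n x).
Proof. by rewrite (sdiffE SC) ssecK. Qed.

Lemma sdiff_diff n x : sdiff SC n (cdiff C n.+1 x) = 0.
Proof. by rewrite (sdiffE SC) sdiff_incl. Qed.
End Split.

(** * Cycles and boundaries among bigraded families of tensors *)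

Section Families.
Variable R : comNzRingType.
Variables (C D : complex R) (HC HD : nat -> lmodType R).
Variables (SC : splitting C HC) (SD : splitting D HD).

(** No total degree is imposed: the neighbours [(i.+1, j)] and [(i, j.+1)] of a bidegree are then
    available without casts. *)
Definition tfam := forall i j, tens (C i) (D j).

Definition tdiff (F : tfam) : tfam := fun i j =>
  tmap (cdiff C i) idfun (F i.+1 j) +
  (-1) ^+ i *: tmap idfun (cdiff D j) (F i j.+1).

Lemma tdiffB (F G : tfam) i j :
  tdiff (fun i j => F i j - G i j) i j = tdiff F i j - tdiff G i j.
Proof. by rewrite /tdiff !tmapB scalerBr opprD addrACA. Qed.

Lemma tdiffK (F : tfam) i j : tdiff (tdiff F) i j = 0.
Proof.
pose p : bideg (i + j) :=
  exist (fun q => (q.1 + q.2)%N == (i + j)%N) (i, j) (eqxx (i + j)%N).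
pose Fn : tcx_obj C D (i + j).+2 := fun p => F (val p).1 (val p).2.
exact: (congr1 (fun z : tcx_obj C D _ => z p) (tcx_diffK Fn)).
Qed.

Definition gtens i j : {linear tens (C i.+1) (D j) -> tens (sB SC i) (HD j)} :=
  tmap (sdiff SC i) (sproj SD j \o sretr SD j).

Definition htens i j : {linear tens (C i) (D j) -> tens (HC i) (HD j)} :=
  tmap (sproj SC i \o sretr SC i) (sproj SD j \o sretr SD j).

Lemma gtens_diff (F : tfam) i j : gtens i j (tdiff F i.+1 j) = 0.
Proof.
rewrite /tdiff /gtens /= tmapD tmapZ tmap_fuse0l; last exact: sdiff_diff.
rewrite tmap_fuse0r => [|u /=]; last exact: sproj_retr_diff.
by rewrite scaler0 addr0.
Qed.

Lemma htens_diff (F : tfam) i j : htens i j (tdiff F i j) = 0.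
Proof.
rewrite /tdiff /htens /= tmapD tmapZ.
rewrite tmap_fuse0l => [|u /=]; last exact: sproj_retr_diff.
rewrite tmap_fuse0r => [|u /=]; last exact: sproj_retr_diff.
by rewrite scaler0 addr0.
Qed.

(** Retracting the cycle equation onto cycles and passing to homology in the second factor kills the
    second differential and turns the first one into [sbdry]. *)
Lemma gtens_cycle (F : tfam) i j : tdiff F i j = 0 ->
  tmap (sbdry SC i) idfun (gtens i j (F i.+1 j)) = 0.
Proof.
move=> /(congr1 (tmap (sretr SC i) (sproj SD j \o sretr SD j))).
rewrite tmap0 /tdiff /gtens /= tmapD tmapZ [X in _ *: X]tmap_fuse0r => [|u /=].
  rewrite scaler0 addr0 => <-; rewrite !tmap_comp; apply: tmap_ext => // u /=.
  by rewrite sretr_diff.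
exact: sproj_retr_diff.
Qed.

(** Representatives are sums of tensors of two cycles, which are killed by both partial
    differentials and by [sdiff]. *)
Lemma htens_lift (Y : forall i j, tens (HC i) (HD j)) :
  exists F : tfam, [/\ forall i j, tdiff F i j = 0,
    forall i j, gtens i j (F i.+1 j) = 0 & forall i j, htens i j (F i j) = Y i j].
Proof.
have ex i j : exists x, tmap (sproj SC i) (sproj SD j) x = Y i j.
  by apply: tmap_surj; exact: sproj_surj.
exists (fun i j => tmap (sincl SC i) (sincl SD j) (sval (cid (ex i j)))).
split=> i j.
- rewrite /tdiff tmap_fuse0l => [|u]; last exact: cdiff_incl.
  by rewrite tmap_fuse0r => [|u]; rewrite ?scaler0 ?addr0 //; exact: cdiff_incl.
- by rewrite /gtens /= tmap_fuse0l // => u; exact: sdiff_incl.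
- apply: etrans (svalP (cid (ex i j))); rewrite /htens /=.
  by apply: tmap_fuse => u /=; rewrite sretrK.
Qed.

(** [T] lifts to [X] in [B_i (x) Z'_j]. The image of [X] in [Z_i (x) Z'_j] dies in [Z_i (x) H'_j],
    so by right exactness it comes from some [Y] in [Z_i (x) B'_j]. Applying the section of the
    first differential to [X] and that of the second to [Y] gives [F1] and [F2] with equal
    differentials; the sign in [F2] cancels that of [tdiff]. Their difference is a cycle with Tor
    component [T]. *)
Lemma gtens_lift (T : forall i j, tens (sB SC i) (HD j)) :
  (forall i j, tmap (sbdry SC i) idfun (T i j) = 0) ->
  exists2 F : tfam, forall i j, tdiff F i j = 0 &
    forall i j, gtens i j (F i.+1 j) = T i j.
Proof.
move=> bT.
have exX i j : exists x, tmap (idfun : {linear sB SC i -> _}) (sproj SD j) x = T i j.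
  by apply: tmap_surj => [v|]; [exists v | exact: sproj_surj].
pose X i j := sval (cid (exX i j)).
have XE i j : tmap (idfun : {linear sB SC i -> _}) (sproj SD j) (X i j) = T i j.
  exact: svalP (cid (exX i j)).
have exY i j : exists y, tmap (idfun : {linear sZ SC i -> _}) (sbdry SD j) y =
    tmap (sbdry SC i) idfun (X i j).
  apply: (tens_right_exact (@sproj_surj _ _ _ SD j) (@sproj_ker _ _ _ SD j)).
  by rewrite -(bT i j) -XE !tmap_comp; exact: tmap_ext.
pose Y i j := sval (cid (exY i j)).
have YE i j : tmap (idfun : {linear sZ SC i -> _}) (sbdry SD j) (Y i j) =
    tmap (sbdry SC i) idfun (X i j).
  exact: svalP (cid (exY i j)).
pose F1 i j : tens (C i) (D j) :=
  if i is i'.+1 then tmap (ssec SC i') (sincl SD j) (X i' j) else 0.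
pose F2 i j : tens (C i) (D j) :=
  if j is j'.+1 then (-1) ^+ i *: tmap (sincl SC i) (ssec SD j') (Y i j') else 0.
exists (fun i j => F1 i j - F2 i j) => i j.
  rewrite tdiffB /tdiff /F1 /F2 /= !tmapZ.
  rewrite (tmap_fuse (f2 := sincl SC i \o sbdry SC i) (g2 := sincl SD j)) //;
    last exact: cdiff_sec.
  rewrite (_ : tmap idfun (cdiff D j) (if i is i'.+1 then _ else _) = 0);
    last first.
    case: (i) => [|i']; rewrite ?tmap0 // tmap_fuse0r // => u.
    exact: cdiff_incl.
  rewrite (_ : tmap (cdiff C i) idfun (if j is j'.+1 then _ else _) = 0);
    last first.
    case: (j) => [|j']; rewrite ?tmap0 // tmapZ tmap_fuse0l ?scaler0 // => u.
    exact: cdiff_incl.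
  rewrite (tmap_fuse (f2 := sincl SC i) (g2 := sincl SD j \o sbdry SD j)) //;
    last exact: cdiff_sec.
  rewrite scaler0 addr0 add0r scalerA -expr2 sqrr_sign scale1r.
  have <- : tmap (sincl SC i) (sincl SD j) (tmap idfun (sbdry SD j) (Y i j)) =
      tmap (sincl SC i) (sincl SD j \o sbdry SD j) (Y i j) by exact: tmap_fuse.
  by rewrite YE (tmap_fuse (f2 := sincl SC i \o sbdry SC i) (g2 := sincl SD j))
    ?subrr.
rewrite /F1 /gtens /= tmapB (tmap_fuse (f2 := idfun) (g2 := sproj SD j)) //.
- rewrite XE /F2; case: (j) => [|j']; rewrite ?tmap0 ?subr0 // tmapZ.
  by rewrite tmap_fuse0l ?scaler0 ?subr0 // => u; exact: sdiff_incl.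
- exact: ssecK.
- by move=> u /=; rewrite sretrK.
Qed.

Hypothesis Cproj : forall n, projective (C n).

Lemma tfam_exact (F : tfam) : (forall i j, tdiff F i j = 0) ->
  (forall i j, gtens i j (F i.+1 j) = 0) -> (forall i j, htens i j (F i j) = 0) ->
  exists V : tfam, forall i j, tdiff V i j = F i j.
Proof.
(* Subtracting a first boundary makes [F] vanish in [C (x) HD], and subtracting a
   second one makes its image under the retraction onto the cycles of [D] vanish;
   then it vanishes, as the boundaries of [D] inject into its cycles. *)
move=> dF gF hF.
have exX i j : exists x, tmap (sbdry SC i) (sproj SD j) x =
    tmap (sretr SC i) (sproj SD j \o sretr SD j) (F i j).
  have [|x xE] := @tens_left_exact _ (HD j) _ _ _ _ _ (@sproj_surj _ _ _ SC i)
      (@sproj_ker _ _ _ SC i) (tmap (sretr SC i) (sproj SD j \o sretr SD j) (F i j)).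
    by rewrite -(hF i j) /htens /=; exact: tmap_fuse.
  have [|y yE] := @tmap_surj _ _ _ _ _ (idfun : {linear sB SC i -> _}) _
    _ (@sproj_surj _ _ _ SD j) x; first by move=> v; exists v.
  by exists y; rewrite -xE -yE; symmetry; exact: tmap_fuse.
pose X i j := sval (cid (exX i j)).
have XE i j : tmap (sbdry SC i) (sproj SD j) (X i j) =
    tmap (sretr SC i) (sproj SD j \o sretr SD j) (F i j).
  exact: svalP (cid (exX i j)).
pose V1 i j : tens (C i) (D j) :=
  if i is i'.+1 then tmap (ssec SC i') (sincl SD j) (X i' j) else 0.
have dV1 i j : tdiff V1 i j = tmap (sincl SC i \o sbdry SC i) (sincl SD j) (X i j).
  rewrite /tdiff (tmap_fuse (f2 := sincl SC i \o sbdry SC i) (g2 := sincl SD j)) //;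
    last exact: cdiff_sec.
  rewrite (_ : tmap idfun _ _ = 0) ?scaler0 ?addr0 //.
  rewrite /V1; case: (i) => [|i']; rewrite ?tmap0 // tmap_fuse0r // => u.
  exact: cdiff_incl.
pose F1 i j := F i j - tdiff V1 i j.
have dF1 i j : tdiff F1 i j = 0 by rewrite tdiffB dF tdiffK subrr.
have F1proj i j : tmap idfun (sproj SD j) (tmap idfun (sretr SD j) (F1 i j)) = 0.
  rewrite (tmap_fuse (f2 := idfun) (g2 := sproj SD j \o sretr SD j)) //.
  rewrite tmapB dV1 (tmap_fuse (f2 := sincl SC i \o sbdry SC i)
    (g2 := sproj SD j)) // => [|u]; last by rewrite /= sretrK.
  have -> : tmap (sincl SC i \o sbdry SC i) (sproj SD j) (X i j) =
      tmap (sincl SC i) idfun (tmap (sbdry SC i) (sproj SD j) (X i j)).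
    by symmetry; exact: tmap_fuse.
  rewrite XE; apply/eqP; rewrite subr_eq0; apply/eqP.
  rewrite [RHS](tmap_fuse (f2 := sincl SC i \o sretr SC i)
    (g2 := sproj SD j \o sretr SD j)) //.
  (* In degree 0 every element is a cycle. In positive degree the part of [C] outside the cycles is
     the section of the differential, and its contribution vanishes by [gF]. *)
  case: i => [|i]; first by apply: tmap_ext => // u; rewrite /= ssplit0.
  rewrite [LHS](tmap_ext (f' := (sincl SC i.+1 \o sretr SC i.+1)
    \+ (ssec SC i \o sdiff SC i)) (g' := sproj SD j \o sretr SD j)) //.
    rewrite tmapDl -[RHS]addr0; congr (_ + _).
    have <- : tmap (ssec SC i) idfun (gtens i j (F i.+1 j)) =
        tmap (ssec SC i \o sdiff SC i) (sproj SD j \o sretr SD j) (F i.+1 j).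
      exact: tmap_fuse.
    by rewrite gF tmap0.
  by move=> u; rewrite /= ssplitS.
have exY i j := tens_right_exact (@sproj_surj _ _ _ SD j) (@sproj_ker _ _ _ SD j)
  (F1proj i j).
pose Y i j := sval (cid (exY i j)).
have YE i j : tmap idfun (sbdry SD j) (Y i j) = tmap idfun (sretr SD j) (F1 i j).
  exact: svalP (cid (exY i j)).
pose V2 i j : tens (C i) (D j) :=
  if j is j'.+1 then (-1) ^+ i *: tmap idfun (ssec SD j') (Y i j') else 0.
pose F2 i j := F1 i j - tdiff V2 i j.
have dF2 i j : tdiff F2 i j = 0 by rewrite tdiffB dF1 tdiffK subrr.
have F2retr i j : tmap idfun (sretr SD j) (F2 i j) = 0.
  rewrite /F2 tmapB -YE /tdiff tmapD tmapZ.
  have -> : tmap idfun (sretr SD j) (tmap (cdiff C i) idfun (V2 i.+1 j)) = 0.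
    rewrite /V2; case: (j) => [|j']; rewrite ?tmap0 // !tmapZ.
    rewrite (tmap_fuse (f2 := cdiff C i) (g2 := ssec SD j')) //.
    by rewrite tmap_fuse0r ?scaler0 // => u; exact: sretr_sec.
  rewrite add0r /V2 !tmapZ scalerA -expr2 sqrr_sign scale1r.
  rewrite [X in _ - tmap _ _ X](tmap_fuse (f2 := idfun)
    (g2 := sincl SD j \o sbdry SD j)) //; last exact: cdiff_sec.
  rewrite (tmap_fuse (f2 := idfun) (g2 := sbdry SD j)) ?subrr // => u.
  by rewrite /= sretrK.
suff F20 i j : F2 i j = 0.
  exists (fun i j => V1 i j + V2 i j) => i j.
  have := F20 i j; rewrite /F2 /F1 => /subr0_eq/(canRL (subrK _)) ->.
  by rewrite /tdiff !tmapD scalerDr addrACA addrC.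
case: j => [|j].
  rewrite -[F2 i 0](tmap_id (f := idfun) (g := sincl SD 0 \o sretr SD 0)) //.
    rewrite -(tmap_fuse (f := idfun) (f' := idfun) (g := sincl SD 0)
      (g' := sretr SD 0)) //.
    by rewrite F2retr tmap0.
  exact: ssplit0.
(* The retracted cycle equation reduces to the image of this element under [1 (x) sbdry], which is
   injective because [C i] is projective, hence flat. *)
have q0 : tmap idfun (sdiff SD j) (F2 i j.+1) = 0.
  apply: (projective_flatr (Cproj i) (@sbdry_inj _ _ _ SD j)); rewrite tmap0.
  have := congr1 (tmap idfun (sretr SD j)) (dF2 i j).
  rewrite tmap0 /tdiff tmapD tmapZ.
  rewrite (_ : tmap idfun _ (tmap (cdiff C i) idfun _) =
    tmap (cdiff C i) idfun (tmap idfun (sretr SD j) (F2 i.+1 j))); last first.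
    by rewrite !tmap_comp; exact: tmap_ext.
  rewrite F2retr tmap0 add0r => /(congr1 (fun x => (-1) ^+ i *: x)).
  rewrite scaler0 scalerA -expr2 sqrr_sign scale1r => <-.
  by rewrite !tmap_comp; apply: tmap_ext => // u; rewrite /= sretr_diff.
rewrite -[LHS](tmap_id (f := idfun) (g := (sincl SD j.+1 \o sretr SD j.+1)
    \+ (ssec SD j \o sdiff SD j))) // => [|u]; last by rewrite /= ssplitS.
rewrite tmapDr -(tmap_fuse (f := idfun) (f' := idfun) (g := sincl SD j.+1)
  (g' := sretr SD j.+1)) // F2retr tmap0 add0r.
by rewrite -(tmap_fuse (f := idfun) (f' := idfun) (g := ssec SD j)
  (g' := sdiff SD j)) // q0 tmap0.
Qed.
End Families.

Section Corestrict.
Variables (R : comNzRingType) (U V : lmodType R) (f : {linear U -> V}).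
Variables (S : submodClosed V) (fS : forall x, f x \in S).

Lemma corestrict_linear :
  linear (fun x => exist (fun y => y \in S) (f x) (fS x) : submod S).
Proof. by move=> a x y; apply: val_inj; rewrite /= linearP. Qed.

Definition corestrict : {linear U -> submod S} := mklin corestrict_linear.
End Corestrict.

(** A projective module of boundaries yields a section [s] of the corestricted differential [q], and
    [1 - s q] retracts the chains onto the cycles. The two equations let projectivity of cycles and
    boundaries be transported to the fields [sZ] and [sB]. *)
Lemma projective_splitting (R : comNzRingType) (C : complex R) :
  (forall n, projective (submod (imsub (cdiff C n)))) ->
  exists S : splitting C (homology C),
    (forall n, sZ S n = submod (kersub (bdry C n))) /\
    (forall n, sB S n = submod (imsub (cdiff C n))).
Proof.
move=> Bp.
have qS n x : cdiff C n x \in imsub (cdiff C n) by apply/imsubP; exists x.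
pose q n := corestrict (qS n).
have bS n x : x \in imsub (cdiff C n) -> idfun x \in kersub (bdry C n).
  move=> /imsubP[y <-] {x}; apply/kersubP.
  by case: n y => //= n y; rewrite cdiffK.
pose b n : {linear submod (imsub (cdiff C n)) -> submod (kersub (bdry C n))} :=
  restrict (bS n).
have sE n : {s : {linear submod (imsub (cdiff C n)) -> C n.+1} |
    forall x, q n (s x) = x}.
  apply: (@projective_lift _ _ _ _ (q n) idfun (Bp n)) => x.
  by have /imsubP[y yE] := valP x; exists y; exact: val_inj.
pose s n := sval (sE n).
have qs n x : q n (s n x) = x by rewrite /s; case: (sE n).
pose e n : {linear C n -> C n} := match n with
  | 0 => idfun
  | m.+1 => idfun \- (s m \o q m)
  end.
have eS n x : e n x \in kersub (bdry C n).
  apply/kersubP; case: n x => //= n x.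
  by rewrite linearB; have /= -> := congr1 val (qs n (q n x)); rewrite subrr.
pose r n := corestrict (eS n).
have qi n (z : submod (kersub (bdry C n.+1))) : q n (val z) = 0.
  by apply: val_inj; exact: (kersub_val z).
unshelve eexists (@Splitting _ C (homology C)
  (fun n => submod (kersub (bdry C n))) (fun n => submod (imsub (cdiff C n)))
  (fun n => submod_val _) r b q s (fun n => cls _) _ _ _ _ _ _ _ _ _ _) => //.
- move=> n z; apply: val_inj; case: n z => // n z.
  by rewrite -[LHS]/(val z - s n (q n (val z))) qi linear0 subr0.
- by move=> n x; rewrite /= subrK.
- by move=> n x y /(congr1 val)/= xy; exact: val_inj.
- by move=> n h; have [z ->] := cls_surj h; exists z.
- by move=> n x; apply/eqP; rewrite cls_eq0; apply/presubP; exact: (valP x).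
- move=> n z /eqP; rewrite cls_eq0 => /presubP zB.
  by exists (exist (fun x => x \in imsub _) _ zB); exact: val_inj.
Qed.

Section Kunneth.
Variable R : comNzRingType.
Variables (C D : complex R) (HC HD : nat -> lmodType R).
Variables (SC : splitting C HC) (SD : splitting D HD).
Hypothesis (Cproj : forall n, projective (C n)).

Notation TC := (tcx C D).

Lemma tcx_extend n (z : tcx_obj C D n) : exists F : tfam C D,
  (forall p : bideg n, F (val p).1 (val p).2 = z p) /\
  forall i j, (i + j)%N != n -> F i j = 0.
Proof.
exact: (@extend_family (fun q => (q.1 + q.2)%N == n)
  (fun i j => tens (C i) (D j)) (fun i j => 0) z).
Qed.

Lemma tcx_diffE n (z : TC n.+1) (F : tfam C D) :
  (forall p : bideg n.+1, F (val p).1 (val p).2 = z p) ->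
  forall p : bideg n, cdiff TC n z p = tdiff F (val p).1 (val p).2.
Proof.
move=> FE p; rewrite /= /tcx_diff /tdiff.
by rewrite -(FE (bidegl p)) -(FE (bidegr p)).
Qed.

(** The extension by zero remains a cycle in every bidegree: away from total degree [n - 1], both
    neighbours entering [tdiff] are zero. *)
Lemma tcx_cycle n (z : TC n) : bdry TC n z = 0 -> exists F : tfam C D,
  [/\ forall p : bideg n, F (val p).1 (val p).2 = z p,
      forall i j, (i + j)%N != n -> F i j = 0 & forall i j, tdiff F i j = 0].
Proof.
move=> dz; have [F [FE F0]] := tcx_extend z; exists F; split=> // i j.
have [ijn|ijn] := eqVneq (i + j).+1 n; last first.
  by rewrite /tdiff !F0 ?addnS ?addSn // !tmap0 scaler0 addr0.
case: n z dz FE F0 ijn => // n z dz FE F0 [ijn].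
pose p : bideg n := exist (fun q => (q.1 + q.2)%N == n) (i, j) (introT eqP ijn).
rewrite -[LHS]/(tdiff F (val p).1 (val p).2) -(tcx_diffE FE).
by rewrite -[cdiff TC n z]/(bdry TC n.+1 z) dz.
Qed.

Lemma tcx_cycle_family n (F : tfam C D) : (forall i j, tdiff F i j = 0) ->
  bdry TC n (fun p => F (val p).1 (val p).2) = 0.
Proof.
move=> dF; case: n => // n; apply: functional_extensionality_dep => p.
by rewrite [LHS](tcx_diffE (F := F)).
Qed.

Definition bideg_pred n := {p : nat * nat | (p.1 + p.2).+1%N == n}.

Definition bideg_predl n (p : bideg_pred n) : bideg n :=
  exist (fun q : nat * nat => (q.1 + q.2)%N == n)
    ((val p).1.+1, (val p).2) (valP p).

Variable n : nat.
Notation cyc := (submod (kersub (bdry TC n))).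

Definition hmap (z : cyc) : bisum n (fun i j => tens (HC i) (HD j)) :=
  fun p => htens SC SD (val p).1 (val p).2 ((val z : tcx_obj C D n) p).

Lemma hmap_linear : linear hmap.
Proof.
by move=> a x y; apply: functional_extensionality_dep => p; exact: linearP.
Qed.

Lemma gmap_ker (z : cyc) (p : bideg_pred n) :
  gtens SC SD (val p).1 (val p).2 ((val z : tcx_obj C D n) (bideg_predl p))
    \in kersub (tmap (sbdry SC (val p).1) (idfun : {linear HD (val p).2 -> _})).
Proof.
apply/kersubP; have [F [FE _ dF]] := tcx_cycle (kersub_val z).
by rewrite -(FE (bideg_predl p)); exact: gtens_cycle.
Qed.

Variable tau : forall i j,
  {linear submod (kersub (tmap (sbdry SC i) (idfun : {linear HD j -> _}))) ->
          Tor 1 (HC i) (HD j)}.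
Hypothesis tau_inj : forall i j, injective (@tau i j).
Hypothesis tau_surj : forall i j y, exists x, @tau i j x = y.

Definition gmap (z : cyc) : bisum_pred n (fun i j => Tor 1 (HC i) (HD j)) :=
  fun p => tau _ _ (exist (fun x => x \in kersub _) _ (gmap_ker z p)).

Lemma gmapE (z : cyc) (p : bideg_pred n) t :
  val t = gtens SC SD (val p).1 (val p).2 ((val z : tcx_obj C D n) (bideg_predl p)) ->
  gmap z p = tau (val p).1 (val p).2 t.
Proof. by move=> e; congr (tau _ _ _); exact: val_inj. Qed.

Lemma gmap_linear : linear gmap.
Proof.
move=> a x y; apply: functional_extensionality_dep => p.
rewrite -[RHS]/(a *: gmap x p + gmap y p) /gmap -linearP; congr (tau _ _ _).
by apply: val_inj; exact: linearP.
Qed.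

Lemma cycle_bdry (z : cyc) :
  z \in presub (submod_val (kersub (bdry TC n))) (imsub (cdiff TC n)) ->
  exists V : tfam C D, forall p : bideg n,
    (val z : tcx_obj C D n) p = tdiff V (val p).1 (val p).2.
Proof.
move=> /presubP/imsubP[y /= yE]; have [V [VE _]] := tcx_extend y.
by exists V => p; rewrite -(tcx_diffE VE) /= yE.
Qed.

(** Both maps are defined on cycles and descend because they vanish on [tdiff]. The three conditions
    of [short_exact_retract] are then supplied by [gtens_lift], [htens_lift] and [tfam_exact]. *)
Lemma kunneth_sequence : exists
  (f : {linear bisum n (fun i j => tens (HC i) (HD j)) -> homology TC n})
  (g : {linear homology TC n -> bisum_pred n (fun i j => Tor 1 (HC i) (HD j))}),
  short_exact f g.
Proof.
have hB z : z \in presub (submod_val (kersub (bdry TC n))) (imsub (cdiff TC n)) ->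
    mklin hmap_linear z = 0.
  move=> /cycle_bdry[V VE]; apply: functional_extensionality_dep => p.
  by rewrite /= /hmap VE htens_diff.
have gB z : z \in presub (submod_val (kersub (bdry TC n))) (imsub (cdiff TC n)) ->
    mklin gmap_linear z = 0.
  move=> /cycle_bdry[V VE]; apply: functional_extensionality_dep => p.
  rewrite [LHS](@gmapE z p 0) => [|/=]; first exact: linear0.
  by rewrite VE gtens_diff.
pose h : {linear homology TC n -> _} := qlift hB.
pose g : {linear homology TC n -> _} := qlift gB.
have hE z : h (cls _ z) = hmap z by exact: qliftE.
have gE z : g (cls _ z) = gmap z by exact: qliftE.
suff [f fg] : exists f : {linear bisum n (fun i j => tens (HC i) (HD j)) ->
    homology TC n}, short_exact f g by exists f; exists g.
pose famc (F : tfam C D) (dF : forall i j, tdiff F i j = 0) : cyc :=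
  exist (fun z => z \in kersub (bdry TC n)) _ (introT (kersubP _ _)
    (tcx_cycle_family n dF)).
apply: (@short_exact_retract _ _ _ _ g h).
- move=> w; pose T (p : bideg_pred n) := sval (cid (tau_surj (w p))).
  have [E [TE E0]] := @extend_family (fun q => (q.1 + q.2).+1%N == n)
    (fun i j => submod (kersub (tmap (sbdry SC i) (idfun : {linear HD j -> _}))))
    (fun i j => 0) T.
  have [F dF gF] := @gtens_lift _ _ _ _ _ SC SD (fun i j => val (E i j))
    (fun i j => kersub_val (E i j)).
  exists (cls _ (famc F dF)); rewrite gE; apply: functional_extensionality_dep => p.
  rewrite (@gmapE _ p (E (val p).1 (val p).2)) => [|/=]; last by rewrite gF.
  by rewrite (TE p) /T; exact: (svalP (cid (tau_surj (w p)))).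
- move=> y; have [Y [YE _]] := @extend_family (fun q => (q.1 + q.2)%N == n)
    (fun i j => tens (HC i) (HD j)) (fun i j => 0) y.
  have [F [dF gF hF]] := htens_lift SC SD Y.
  exists (cls _ (famc F dF)).
    rewrite gE; apply: functional_extensionality_dep => p.
    rewrite (@gmapE _ p 0) => [|/=]; first exact: linear0.
    by rewrite gF.
  rewrite hE; apply: functional_extensionality_dep => p.
  by rewrite /hmap /= hF; exact: YE.
move=> v; have [z ->] := cls_surj v; rewrite gE hE => gz hz.
have [F [FE F0 dF]] := tcx_cycle (kersub_val z).
have [||V VE] := @tfam_exact _ _ _ _ _ SC SD Cproj F dF.
- move=> i j; have [ijn|ijn] := eqVneq (i + j).+1 n; last first.
    by rewrite F0 ?linear0.
  pose p : bideg_pred n :=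
    exist (fun q => (q.1 + q.2).+1%N == n) (i, j) (introT eqP ijn).
  have gzp : gmap z p = 0 by rewrite gz.
  have : tau i j (exist (fun x => x \in kersub _) _ (gmap_ker z p)) = tau i j 0.
    by rewrite linear0; exact: gzp.
  by move=> /tau_inj/(congr1 val)/= <-; rewrite -(FE (bideg_predl p)).
- move=> i j; have [ijn|ijn] := eqVneq (i + j)%N n; last by rewrite F0 ?linear0.
  pose p : bideg n :=
    exist (fun q => (q.1 + q.2)%N == n) (i, j) (introT eqP ijn).
  have <- : hmap z p = 0 by rewrite hz.
  by rewrite /hmap -FE.
apply/eqP; rewrite cls_eq0; apply/presubP/imsubP.
exists (fun p => V (val p).1 (val p).2).
apply: functional_extensionality_dep => p.
by rewrite (tcx_diffE (F := V)) // VE FE.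
Qed.
End Kunneth.

Theorem kunneth (R : comNzRingType) (C D : complex R) n :
  (forall n, projective (C n)) ->
  (forall n, projective (submod (kersub (bdry C n)))) ->
  (forall n, projective (submod (imsub (cdiff C n)))) ->
  (forall n, projective (submod (imsub (cdiff D n)))) ->
  exists (f : {linear bisum n (fun i j => tens (homology C i) (homology D j)) ->
                      homology (tcx C D) n})
         (g : {linear homology (tcx C D) n ->
                      bisum_pred n (fun i j => Tor 1 (homology C i) (homology D j))}),
    short_exact f g.
Proof.
move=> Cp Zp Bp Bp'; have [SC [ZE BE]] := projective_splitting Bp.
have [SD _] := projective_splitting Bp'.
have ZpS m : projective (sZ SC m) by rewrite ZE.
have BpS m : projective (sB SC m) by rewrite BE.
have tauE i j := Tor1_resolution (homology D j) (BpS i) (ZpS i)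
  (@sbdry_inj _ _ _ SC i) (@sproj_surj _ _ _ SC i) (@sproj_bdry _ _ _ SC i)
  (@sproj_ker _ _ _ SC i).
apply: (@kunneth_sequence R C D _ _ SC SD Cp n (fun i j => sval (cid (tauE i j)))).
- by move=> i j; case: (svalP (cid (tauE i j))).
- by move=> i j; case: (svalP (cid (tauE i j))).
Qed.

(** * Shuffle products of chains *)

Definition ccons (C : smallcat) n (x y : C) (f : hom x y) (c : chain n y) :
  chain n.+1 x := existT (fun y => (hom x y * chain n y)%type) y (f, c).

Section AltFace.
Variables (R : comNzRingType) (V : lmodType R) (C : smallcat).

(** The faces that keep the starting object. The initial face is treated apart, since it changes the
    object on which the type of the chain depends; [bsum] is that face minus [altface]. *)
Definition altface n (x : C) (phi : chain n x -> V) (c : chain n.+1 x) : V :=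
  \sum_(i < n.+1) (-1) ^+ i *: phi (cface i c).

Definition altface_pred n (x : C) : (chain n.-1 x -> V) -> chain n x -> V :=
  match n with 0 => fun _ _ => 0 | m.+1 => @altface m x end.

Lemma altface1 (x : C) (phi : chain 0 x -> V) c : altface phi c = phi tt.
Proof. by rewrite /altface big_ord1 scale1r. Qed.

Lemma altfaceS n (x y z : C) (f : hom x y) (g : hom y z) (c : chain n z) phi :
  altface phi (ccons f (ccons g c)) =
  phi (ccons (comp f g) c) - altface (fun s => phi (ccons f s)) (ccons g c).
Proof.
rewrite /altface big_ord_recl scale1r -sumrN; congr (_ + _).
by apply: eq_bigr => i _; rewrite exprS mulN1r scaleNr.
Qed.

(** Isolates the inner face at a newly added first arrow, the one face for which shuffling produces
    arrows moving in both factors. *)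
Definition absorb n (x y : C) (f : hom x y) (phi : chain n.+1 x -> V)
    (c : chain n.+1 y) : V :=
  phi (ccons (comp f (projT2 c).1) (projT2 c).2).

Lemma altface_absorb n (x y : C) (f : hom x y) (phi : chain n.+1 x -> V)
    (c : chain n.+1 y) :
  altface phi (ccons f c) = absorb f phi c - altface (fun s => phi (ccons f s)) c.
Proof. by case: c => z [g c]; exact: altfaceS. Qed.

Lemma altface_predD n (x : C) (phi psi : chain n.-1 x -> V) a c :
  altface_pred (fun s => phi s + a *: psi s) c =
  altface_pred phi c + a *: altface_pred psi c.
Proof.
case: n phi psi c => [|n] phi psi c; first by rewrite /= scaler0 addr0.
rewrite /= /altface scaler_sumr -big_split; apply: eq_bigr => i _ /=.
by rewrite scalerDr !scalerA mulrC.
Qed.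
End AltFace.

Section Shuffle.
Variables (R : comNzRingType) (C D : smallcat).
Notation CD := (prodcat C D).

Definition pcons l (x y : C) (x' y' : D) (f : hom x y) (h : hom x' y')
    (s : chain l ((y, y') : CD)) : chain l.+1 ((x, x') : CD) :=
  @ccons CD l (x, x') (y, y') (f, h) s.

(** The shuffle product of two chains, evaluated at a function [phi] on chains of
    length [l]; it vanishes unless [l] is the sum of the two lengths.  Keeping [l]
    apart avoids casts along equalities between sums of lengths. *)
Fixpoint shprod (V : lmodType R) l : forall m n (x : C) (x' : D),
    chain m x -> chain n x' -> (chain l ((x, x') : CD) -> V) -> V :=
  match l with
  | 0 => fun m n x x' _ _ phi => if (m == 0%N) && (n == 0%N) then phi tt else 0
  | l.+1 => fun m n x x' c c' phi =>
    match m return chain m x -> V with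
    | 0 => fun _ => 0
    | m.+1 => fun c => shprod (projT2 c).2 c'
        (fun s : chain l ((projT1 c, x') : CD) => phi (pcons (projT2 c).1 (idm x') s))
    end c + (-1) ^+ m *:
    match n return chain n x' -> V with
    | 0 => fun _ => 0
    | n.+1 => fun c' => shprod c (projT2 c').2
        (fun s : chain l ((x, projT1 c') : CD) => phi (pcons (idm x) (projT2 c').1 s))
    end c'
  end.

Section Values.
Variable V : lmodType R.
Implicit Types (l m n : nat).

Lemma eq_shprod l m n (x : C) (x' : D) (c : chain m x) (c' : chain n x')
    (phi psi : chain l ((x, x') : CD) -> V) :
  phi =1 psi -> shprod c c' phi = shprod c c' psi.
Proof. by move=> e; congr shprod; apply: functional_extensionality_dep. Qed.

Lemma shprod_lin l m n (x : C) (x' : D) (c : chain m x) (c' : chain n x')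
    (phi psi : chain l ((x, x') : CD) -> V) a :
  shprod c c' (fun s => phi s + a *: psi s) = shprod c c' phi + a *: shprod c c' psi.
Proof.
elim: l m n x x' c c' phi psi => [|l IH] m n x x' c c' phi psi /=.
  by case: ifP => //; rewrite scaler0 addr0.
case: m n c c' => [|m] [|n] c c'.
- by rewrite !scaler0 !addr0 scaler0 addr0.
- by rewrite !add0r IH scalerDr !scalerA [a * _]mulrC.
- by rewrite !scaler0 !addr0 IH.
- by rewrite !IH !scalerDr addrACA !scalerA [a * _]mulrC.
Qed.

Lemma shprod_sub l m n (x : C) (x' : D) (c : chain m x) (c' : chain n x')
    (phi psi : chain l ((x, x') : CD) -> V) :
  shprod c c' (fun s => phi s - psi s) = shprod c c' phi - shprod c c' psi.
Proof.
rewrite -scaleN1r -shprod_lin; apply: eq_shprod => s; by rewrite scaleN1r.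
Qed.

Lemma shprod_map (W : lmodType R) (F : {linear V -> W}) l m n (x : C) (x' : D)
    (c : chain m x) (c' : chain n x') (phi : chain l ((x, x') : CD) -> V) :
  F (shprod c c' phi) = shprod c c' (fun s => F (phi s)).
Proof.
elim: l m n x x' c c' phi => [|l IH] m n x x' c c' phi /=.
  by case: ifP => // _; exact: linear0.
case: m n c c' => [|m] [|n] c c';
  by rewrite linearD linearZ_LR /= ?IH ?linear0.
Qed.

Lemma shprod_in (S : submodClosed V) (P : forall x y : C, hom x y -> Prop)
    (P' : forall x y : D, hom x y -> Prop)
    (Q : forall x y : CD, hom x y -> Prop)
    (QL : forall x y (f : hom x y) x', P x y f -> Q (x, x') (y, x') (f, idm x'))
    (QR : forall x x' y' (f : hom x' y'), P' x' y' f -> Q (x, x') (x, y') (idm x, f))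
    l m n (x : C) (x' : D) (c : chain m x) (c' : chain n x')
    (phi : chain l ((x, x') : CD) -> V) :
  chain_all P c -> chain_all P' c' ->
  (forall s, chain_all Q s -> phi s \in S) -> shprod c c' phi \in S.
Proof.
elim: l m n x x' c c' phi => [|l IH] m n x x' c c' phi Pc Pc' Qphi /=.
  by case: ifP => // _; [exact: Qphi | exact: rpred0].
rewrite rpredD //; last rewrite rpredZ //.
- case: m c Pc => [|m] c; first by rewrite rpred0.
  by case=> Pf Pc; apply: IH => // s Qs; apply: Qphi; split=> //; exact: QL.
- case: n c' Pc' => [|n] c'; first by rewrite rpred0.
  by case=> Pf Pc'; apply: IH => // s Qs; apply: Qphi; split=> //; exact: QR.
Qed.

Lemma shprod_eq0 l m n (x : C) (x' : D) (c : chain m x) (c' : chain n x')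
    (phi : chain l ((x, x') : CD) -> V) :
  (forall s, phi s = 0) -> shprod c c' phi = 0.
Proof.
move=> phi0; rewrite (eq_shprod c c' (psi := fun s => phi s + (-1) *: phi s)).
  by rewrite shprod_lin scaleN1r subrr.
by move=> s; rewrite phi0 scaler0 addr0.
Qed.

Lemma is_id_prod (x y : CD) (f : hom x y) : is_id f <-> is_id f.1 /\ is_id f.2.
Proof.
split=> [[]|]; first by split; exact: IsId.
have idP (u v : C) (g : hom u v) (u' v' : D) (h : hom u' v') :
    is_id g -> is_id h -> is_id ((g, h) : @hom CD (u, u') (v, v')).
  by move=> gid hid; case: v g / gid; case: v' h / hid; exact: (@IsId CD (u, u')).
by case: x y f => x x' [y y'] [f g] [fid gid]; exact: idP.
Qed.

(** Every shuffle pairs an arrow of one chain with an identity of the other factor, so an identity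
    in either chain becomes an identity of the product in each shuffle. *)
Lemma shprod_deg l m n (x : C) (x' : D) (c : chain m x) (c' : chain n x')
    (phi : chain l ((x, x') : CD) -> V) :
  ~ chain_all (fun x y (f : hom x y) => ~ is_id f) c \/
  ~ chain_all (fun x y (f : hom x y) => ~ is_id f) c' ->
  (forall s, ~ chain_all (fun x y (f : hom x y) => ~ is_id f) s -> phi s = 0) ->
  shprod c c' phi = 0.
Proof.
elim: l m n x x' c c' phi => [|l IH] m n x x' c c' phi ndc phi0 /=.
  case: ifP => // /andP[/eqP m0 /eqP n0]; move: c c' ndc.
  by rewrite m0 n0 => c c' [] [].
rewrite [X in X + _](_ : _ = 0) ?add0r; last first.
  case: m c ndc => [//|m] c [|] ndc; last first.
    by apply: IH => [|s nds]; [right | apply: phi0 => -[_ /nds]].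
  have [fid|fnid] := pselect (is_id (projT2 c).1).
    apply: shprod_eq0 => s; apply: phi0 => -[+ _]; apply; apply/is_id_prod.
    by split=> //=.
  apply: IH => [|s nds]; last by apply: phi0 => -[_ /nds].
  by left=> cnd; apply: ndc.
rewrite (_ : match n with 0 => _ | _ => _ end c' = 0) ?scaler0 //.
case: n c' ndc => [//|n] c' [|] ndc.
  by apply: IH => [|s nds]; [left | apply: phi0 => -[_ /nds]].
have [fid|fnid] := pselect (is_id (projT2 c').1).
  apply: shprod_eq0 => s; apply: phi0 => -[+ _]; apply; apply/is_id_prod.
  by split=> //=.
apply: IH => [|s nds]; last by apply: phi0 => -[_ /nds].
by right=> cnd; apply: ndc.
Qed.

Lemma shprod_nil m n (x : C) (x' : D) (c : chain m x) (c' : chain n x')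
    (phi : chain 0 ((x, x') : CD) -> V) :
  shprod c c' phi = if (m == 0%N) && (n == 0%N) then phi tt else 0.
Proof. by []. Qed.

Local Arguments shprod : simpl never.

Section Leibniz.
Variables (l : nat).

Definition shprodl m n (x : C) (x' : D) (c : chain m x) (c' : chain n x')
    (phi : chain l.+1 ((x, x') : CD) -> V) : V :=
  match m return chain m x -> V with
  | 0 => fun _ => 0
  | m.+1 => fun c => shprod (projT2 c).2 c'
      (fun s : chain l ((projT1 c, x') : CD) => phi (pcons (projT2 c).1 (idm x') s))
  end c.

Definition shprodr m n (x : C) (x' : D) (c : chain m x) (c' : chain n x')
    (phi : chain l.+1 ((x, x') : CD) -> V) : V :=
  match n return chain n x' -> V with
  | 0 => fun _ => 0
  | n.+1 => fun c' => shprod c (projT2 c').2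
      (fun s : chain l ((x, projT1 c') : CD) => phi (pcons (idm x) (projT2 c').1 s))
  end c'.

Lemma shprodE m n (x : C) (x' : D) (c : chain m x) (c' : chain n x') phi :
  shprod c c' phi = shprodl c c' phi + (-1) ^+ m *: shprodr c c' phi.
Proof. by []. Qed.

Variables (x y : C) (x' y' : D) (f : hom x y) (g : hom x' y').
Variables (m n : nat) (c : chain m y) (c' : chain n y').
Variable phi : chain l.+1 ((x, x') : CD) -> V.

(** In the second summand the composed arrow moves in both factors. The same mixed terms appear in
    [shprod_absorbr], and they cancel in [shprod_altface]. *)
Lemma shprod_absorbl k (d : chain k x') :
  shprod c d (@absorb R V CD l (x, x') (y, x') (f, idm x') phi) =
  match m return chain m y -> V with
  | 0 => fun _ => 0
  | _.+1 => fun c => shprod (projT2 c).2 d (fun s : chain l ((projT1 c, x') : CD) =>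
      phi (pcons (comp f (projT2 c).1) (idm x') s))
  end c + (-1) ^+ m *:
  match k return chain k x' -> V with
  | 0 => fun _ => 0
  | _.+1 => fun d => shprod c (projT2 d).2 (fun s : chain l ((y, projT1 d) : CD) =>
      phi (pcons f (projT2 d).1 s))
  end d.
Proof.
rewrite shprodE; congr (_ + _ *: _).
  case: (m) c => // m1 c1; apply: eq_shprod => s.
  by rewrite /absorb /= /prod_comp /= compIm.
case: k d => // k d; apply: eq_shprod => s.
by rewrite /absorb /= /prod_comp /= compIm compmI.
Qed.

Lemma shprod_absorbr k (d : chain k x) :
  shprod d c' (@absorb R V CD l (x, x') (x, y') (idm x, g) phi) =
  match k return chain k x -> V with
  | 0 => fun _ => 0
  | _.+1 => fun d => shprod (projT2 d).2 c' (fun s : chain l ((projT1 d, y') : CD) =>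
      phi (pcons (projT2 d).1 g s))
  end d + (-1) ^+ k *:
  match n return chain n y' -> V with
  | 0 => fun _ => 0
  | _.+1 => fun c' => shprod d (projT2 c').2 (fun s : chain l ((x, projT1 c') : CD) =>
      phi (pcons (idm x) (comp g (projT2 c').1) s))
  end c'.
Proof.
rewrite shprodE; congr (_ + _ *: _).
  case: k d => // k d; apply: eq_shprod => s.
  by rewrite /absorb /= /prod_comp /= compIm compmI.
case: (n) c' => // n1 c1; apply: eq_shprod => s.
by rewrite /absorb /= /prod_comp /= compIm.
Qed.

Lemma altface_shprodl k (d : chain k x') :
  altface (fun e => shprodl e d phi) (ccons f c) =
  match m return chain m y -> V with
  | 0 => fun _ => 0
  | _.+1 => fun c => shprod (projT2 c).2 d (fun s : chain l ((projT1 c, x') : CD) =>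
      phi (pcons (comp f (projT2 c).1) (idm x') s))
  end c - altface_pred (fun e => shprod e d
    (fun s : chain l ((y, x') : CD) => phi (pcons f (idm x') s))) c.
Proof.
case: (m) c => [|m1] c1; first by rewrite altface1 subr0.
by rewrite altface_absorb.
Qed.

Lemma altface_shprodr k (d : chain k x) :
  altface (fun e => shprodr d e phi) (ccons g c') =
  match n return chain n y' -> V with
  | 0 => fun _ => 0
  | _.+1 => fun c' => shprod d (projT2 c').2 (fun s : chain l ((x, projT1 c') : CD) =>
      phi (pcons (idm x) (comp g (projT2 c').1) s))
  end c' - altface_pred (fun e => shprod d e
    (fun s : chain l ((x, y') : CD) => phi (pcons (idm x) g s))) c'.
Proof.
case: (n) c' => [|n1] c1; first by rewrite altface1 subr0.
by rewrite altface_absorb.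
Qed.
End Leibniz.

(** Here [u] is the mixed term, met once from each order of the two first arrows with opposite
    signs, and [s] is the sign of the first chain without its first arrow. *)
Lemma leibniz_signs (s : R) (tl tr u a1 a2 a3 a4 : V) : s * s = 1 ->
  (tl + s *: u - (a1 + s *: a2)) +
    (- s) *: (u + (- s) *: tr - (a3 + (- s) *: a4)) =
  (tl - a1 + s *: a3) + (- s) *: (a2 + (- s) *: (tr - a4)).
Proof.
move=> ss; rewrite !(scalerDr, scalerN, scaleNr, opprD, opprK) !scalerA ss.
rewrite !scale1r !addrA [LHS](ACl (2*5*1*3*7*4*6*8)) /= subrr add0r.
by [].
Qed.

Lemma shprod_altface l m n (x : C) (x' : D) (c : chain m x) (c' : chain n x')
    (phi : chain l ((x, x') : CD) -> V) :
  shprod c c' (altface phi) = altface_pred (fun e => shprod e c' phi) c +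
    (-1) ^+ m *: altface_pred (fun e => shprod c e phi) c'.
Proof.
elim: l m n x x' c c' phi => [|l IH] m n x x' c c' phi.
  rewrite shprodE; congr (_ + _ *: _).
    case: m c => // m c; rewrite /= shprod_nil altface1.
    case: m c => [|m] c; first by rewrite altface1.
    by rewrite /altface big1 // => i _; rewrite scaler0.
  case: n c' => // n c'; rewrite /= shprod_nil altface1.
  case: n c' => [|n] c'; first by rewrite altface1.
  by rewrite andbC /altface big1 // => i _; rewrite shprod_nil andbC scaler0.
rewrite shprodE.
have -> : shprodl c c' (altface phi) = match m return chain m x -> V with
    | 0 => fun _ => 0
    | _.+1 => fun c =>
      shprod (projT2 c).2 c' (@absorb R V CD l (x, x') (projT1 c, x')
        ((projT2 c).1, idm x') phi) -
      (altface_pred (fun e => shprod e c' (fun s : chain l ((_, x') : CD) =>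
        phi (pcons (projT2 c).1 (idm x') s))) (projT2 c).2 +
      (-1) ^+ m.-1 *: altface_pred (fun e => shprod (projT2 c).2 e
        (fun s : chain l ((_, x') : CD) =>
        phi (pcons (projT2 c).1 (idm x') s))) c') end c.
  case: m c => // m [y [f c]] /=; rewrite -IH -shprod_sub.
  by apply: eq_shprod => s; exact: (@altface_absorb _ _ CD).
have -> : shprodr c c' (altface phi) = match n return chain n x' -> V with
    | 0 => fun _ => 0
    | _.+1 => fun c' =>
      shprod c (projT2 c').2 (@absorb R V CD l (x, x') (x, projT1 c')
        (idm x, (projT2 c').1) phi) -
      (altface_pred (fun e => shprod e (projT2 c').2
        (fun s : chain l ((x, _) : CD) =>
        phi (pcons (idm x) (projT2 c').1 s))) c +
      (-1) ^+ m *: altface_pred (fun e => shprod c e (fun s : chain l ((x, _) : CD) =>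
        phi (pcons (idm x) (projT2 c').1 s))) (projT2 c').2) end c'.
  case: n c' => // n [y [f c']] /=; rewrite -IH -shprod_sub.
  by apply: eq_shprod => s; exact: (@altface_absorb _ _ CD).
have sq k : (-1) ^+ k * (-1) ^+ k = 1 :> R by rewrite -expr2 sqrr_sign.
have EL : altface_pred (fun e => shprod e c' phi) c =
    altface_pred (fun e => shprodl e c' phi) c +
    (-1) ^+ m.-1 *: altface_pred (fun e => shprodr e c' phi) c.
  by rewrite -altface_predD.
have ER : altface_pred (fun e => shprod c e phi) c' =
    altface_pred (fun e => shprodl c e phi) c' +
    (-1) ^+ m *: altface_pred (fun e => shprodr c e phi) c'.
  by rewrite -altface_predD.
rewrite {}EL {}ER.
have altz (X : smallcat) k (z : X) (d : chain k.+1 z) : altface (fun=> 0 : V) d = 0.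
  by rewrite /altface big1 // => i _; rewrite scaler0.
case: m c => [|m] c; case: n c' => [|n] c'.
- by rewrite /= !(scaler0, addr0).
- case: c' => y' [g c']; rewrite shprod_absorbr /=.
  rewrite -/(ccons g c') altface_shprodr altz.
  by rewrite !(expr0, scale1r, scaler0, add0r, addr0).
- case: c => y [f c]; rewrite shprod_absorbl /=.
  rewrite -/(ccons f c) altface_shprodl altz.
  by rewrite !(scaler0, addr0).
case: c => y [f c]; case: c' => y' [g c']; rewrite shprod_absorbl shprod_absorbr /=.
rewrite -/(ccons f c) -/(ccons g c') altface_shprodl altface_shprodr exprS mulN1r.
exact: leibniz_signs (sq m).
Qed.
End Values.
End Shuffle.

Section NerveBasis.
Variables (R : comNzRingType) (C : smallcat).
Implicit Types V W : lmodType R.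

Lemma symbE n (t : ndsimplex C n) : symb R (val t : simplex C n) = <<t>>.
Proof. by rewrite /symb valK. Qed.

Variant symb_spec n (s : simplex C n) : nerve_obj R C n -> Prop :=
| SymbNondeg (t : ndsimplex C n) of val t = s & nondeg s : symb_spec s <<t>>
| SymbDeg of ~ nondeg s : symb_spec s 0.

Lemma symbP n (s : simplex C n) : symb_spec s (symb R s).
Proof.
rewrite /symb; case: insubP => [t nds tE|/asboolPn]; last exact: SymbDeg.
by apply: SymbNondeg tE _; exact/asboolP.
Qed.

Lemma nerve_lift V n (G : simplex C n -> V) :
  (forall s, ~ nondeg s -> G s = 0) ->
  {F : {linear nerve R C n -> V} | forall s, F (symb R s) = G s}.
Proof.
move=> G0; exists (freelift (fun t : ndsimplex C n => G (val t))) => s.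
case: symbP => [t <- _|/G0 ->]; last exact: linear0.
exact: freeliftU.
Qed.

Lemma nerve_eq V n (F G : {linear nerve R C n -> V}) :
  (forall s, F (symb R s) = G (symb R s)) -> F =1 G.
Proof. by move=> FG; apply: freelift_eq => t; rewrite -symbE. Qed.

Lemma bsum_altface n (x : C) (c : chain n.+1 x) :
  bsum R (existT _ x c) = symb R (existT _ (projT1 c) (projT2 c).2) -
    altface (fun e => symb R (existT _ x e)) c.
Proof.
rewrite /bsum big_ord_recl scale1r /altface -sumrN; congr (_ + _).
by apply: eq_bigr => i _; rewrite exprS mulN1r scaleNr.
Qed.

Lemma altface_map V W (F : {linear V -> W}) n (x : C) (phi : chain n x -> V) c :
  F (altface phi c) = altface (fun e => F (phi e)) c.
Proof.
by rewrite linear_sum; apply: eq_bigr => i _; exact: linearZ_LR.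
Qed.
End NerveBasis.

Section TensNerve.
Variables (R : comNzRingType) (C D : smallcat) (V : lmodType R) (m n : nat).

Lemma tens_nerve_lift (G : simplex C m -> simplex D n -> V) :
  (forall s t, ~ nondeg s \/ ~ nondeg t -> G s t = 0) ->
  {F : {linear tens (nerve R C m) (nerve R D n) -> V} |
    forall s t, F (pure (symb R s) (symb R t)) = G s t}.
Proof.
move=> G0.
have F1 s : {F : {linear nerve R D n -> V} | forall t, F (symb R t) = G s t}.
  by apply: nerve_lift => t nt; apply: G0; right.
pose B u v := freelift (fun s : ndsimplex C m => sval (F1 (val s)) v) u.
have [|u a v w|F FE] := @tens_lift R (nerve R C m) (nerve R D n) V B.
- by move=> v a u w; exact: linearP.
- rewrite /B !freeliftE scaler_sumr -big_split; apply: eq_bigr => s _ /=.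
  by rewrite linearP scalerDr !scalerA mulrC.
exists F => s t; rewrite FE /B; case: (symbP R s) => [s' <- _|ns].
  by rewrite freeliftU; exact: (svalP (F1 _)).
by rewrite linear0 G0 //; left.
Qed.

Lemma tens_nerve_eq (F G : {linear tens (nerve R C m) (nerve R D n) -> V}) :
  (forall s t, F (pure (symb R s) (symb R t)) = G (pure (symb R s) (symb R t))) ->
  F =1 G.
Proof.
move=> FG; apply: tens_eq => u v.
have purel w : linear (fun u : nerve R C m => pure u w : tens _ (nerve R D n)).
  by move=> a x y; rewrite pureDl pureZl.
have purer w : linear (fun v : nerve R D n => pure w v : tens (nerve R C m) _).
  by move=> a x y; rewrite pureDr pureZr.
apply: (nerve_eq (F := F \o mklin (purel v)) (G := G \o mklin (purel v))) => s.
apply: (nerve_eq (F := F \o mklin (purer _)) (G := G \o mklin (purer _))) => t.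
exact: FG.
Qed.
End TensNerve.

Section EilenbergZilber.
Variables (R : comNzRingType) (C D : smallcat).
Notation CD := (prodcat C D).

Definition symb2 l (x : C) (x' : D) (s : chain l ((x, x') : CD)) : nerve R CD l :=
  symb R (existT _ ((x, x') : CD) s).

Definition shuffle l m n (t : simplex C m) (t' : simplex D n) : nerve R CD l :=
  shprod (projT2 t) (projT2 t') (@symb2 l (projT1 t) (projT1 t')).

Lemma shuffle_deg l m n (t : simplex C m) (t' : simplex D n) :
  ~ nondeg t \/ ~ nondeg t' -> shuffle l t t' = 0.
Proof. by move=> ndt; apply: shprod_deg => // s nds; exact: symb_deg. Qed.

Definition EZ l m n : {linear tens (nerve R C m) (nerve R D n) -> nerve R CD l} :=
  sval (tens_nerve_lift (@shuffle_deg l m n)).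

Lemma EZ_symb l m n (t : simplex C m) (t' : simplex D n) :
  EZ l m n (pure (symb R t) (symb R t')) = shuffle l t t'.
Proof. exact: (svalP (tens_nerve_lift (@shuffle_deg l m n))). Qed.

Definition symb_tail l (x : C) (x' : D) (s : chain l.+1 ((x, x') : CD)) :
  nerve R CD l := symb R (existT _ (projT1 s) (projT2 s).2).

Lemma EZ_bdryl l m n (t : simplex C m) (t' : simplex D n) :
  EZ l m.-1 n (pure (bdry (nerve R C) m (symb R t)) (symb R t')) =
  shprodl (projT2 t) (projT2 t') (@symb_tail l _ _) -
  altface_pred (fun e => shprod e (projT2 t') (@symb2 l _ _)) (projT2 t).
Proof.
case: m t => [|m] [x c] /=; first by rewrite pure0l linear0 subr0.
rewrite nerve_diff_symb bsum_altface.
have purel w : linear (fun u : nerve R C m => pure u w : tens _ (nerve R D n)).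
  by move=> a u v; rewrite pureDl pureZl.
pose F : {linear _ -> _} := EZ l m n \o mklin (purel (symb R t')).
rewrite -[LHS]/(F _) linearB altface_map /F /= EZ_symb.
by congr (_ - _); apply: eq_bigr => i _; rewrite EZ_symb.
Qed.

Lemma EZ_bdryr l m n (t : simplex C m) (t' : simplex D n) :
  EZ l m n.-1 (pure (symb R t) (bdry (nerve R D) n (symb R t'))) =
  shprodr (projT2 t) (projT2 t') (@symb_tail l _ _) -
  altface_pred (fun e => shprod (projT2 t) e (@symb2 l _ _)) (projT2 t').
Proof.
case: n t' => [|n] [x' c'] /=; first by rewrite pure0r linear0 subr0.
rewrite nerve_diff_symb bsum_altface.
have purer w : linear (fun v : nerve R D n => pure w v : tens (nerve R C m) _).
  by move=> a u v; rewrite pureDr pureZr.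
pose F : {linear _ -> _} := EZ l m n \o mklin (purer (symb R t)).
rewrite -[LHS]/(F _) linearB altface_map /F /= EZ_symb.
by congr (_ - _); apply: eq_bigr => i _; rewrite EZ_symb.
Qed.

(** The initial face of a shuffle removes the first arrow of one of the two chains, which matches
    the two halves of [shprodE]; the other faces obey the Leibniz rule [shprod_altface]. *)
Lemma EZ_diff l m n (z : tens (nerve R C m) (nerve R D n)) :
  cdiff (nerve R CD) l (EZ l.+1 m n z) =
  EZ l m.-1 n (tmap (bdry (nerve R C) m) idfun z) +
  (-1) ^+ m *: EZ l m n.-1 (tmap idfun (bdry (nerve R D) n) z).
Proof.
pose F : {linear tens (nerve R C m) (nerve R D n) -> nerve R CD l} :=
  cdiff (nerve R CD) l \o EZ l.+1 m n.
pose G : {linear tens (nerve R C m) (nerve R D n) -> nerve R CD l} :=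
  (EZ l m.-1 n \o tmap (bdry (nerve R C) m) idfun) \+
  ((-1) ^+ m \*: (EZ l m n.-1 \o tmap idfun (bdry (nerve R D) n))).
rewrite -[LHS]/(F z) -[RHS]/(G z); apply: tens_nerve_eq => t t'.
rewrite {}/F {}/G /= !tmapE EZ_bdryl EZ_bdryr EZ_symb /shuffle.
rewrite -[nerve_diff _]/(cdiff (nerve R CD) l _) shprod_map.
rewrite (eq_shprod _ _ (psi := fun s => symb_tail s - altface (@symb2 l _ _) s)).
  rewrite shprod_sub shprod_altface shprodE scalerBr opprD !addrA; congr (_ + _).
  exact: addrAC.
by move=> s; rewrite /= nerve_diff_symb bsum_altface.
Qed.

End EilenbergZilber.

(** * Words of marked chains in a box product *)

(** The letters of an arrow of a product category: [Some true] when only its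
    first component moves, [Some false] when only its second one does, and [None]
    when both do. *)
Notation word := (seq (option bool)).

Notation ndchain := (chain_all (fun x y (f : hom x y) => ~ is_id f)).

Section Words.
Variables (R : comNzRingType) (V : lmodType R).
Implicit Types (w u v : word) (Psi : word -> V).

(** The recursion of [shprod] with the chains forgotten and only their letters kept; [shprod_split]
    relates the two. *)
Fixpoint wshuffle l : forall (m n : nat) Psi, V :=
  match l with
  | 0 => fun m n Psi => if (m == 0%N) && (n == 0%N) then Psi [::] else 0
  | l.+1 => fun m n Psi =>
    (if m is m'.+1 then wshuffle l m' n (fun w => Psi (Some true :: w)) else 0)
    + (-1) ^+ m *:
    (if n is n'.+1 then wshuffle l m n' (fun w => Psi (Some false :: w)) else 0)
  end.

Definition stdword m n : word := nseq m (Some true) ++ nseq n (Some false).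

Lemma wshuffle0 l m n Psi :
  (forall w, None \notin w -> Psi w = 0) -> wshuffle l m n Psi = 0.
Proof.
elim: l m n Psi => [|l IH] m n Psi Psi0 /=; first by case: ifP => // _; exact: Psi0.
case: m => [|m]; case: n => [|n];
  rewrite ?IH ?scaler0 ?addr0 // => w wn; apply: Psi0;
  by rewrite inE negb_or.
Qed.

(** The standard word occurs for a single shuffle, with sign 1: a letter of the second factor
    contributes the parity of the first-factor letters still to come, and here none are left. *)
Lemma wshuffle_std l m n Psi :
  (m + n)%N = l -> (forall w, w != stdword m n -> Psi w = 0) ->
  wshuffle l m n Psi = Psi (stdword m n).
Proof.
elim: l m n Psi => [|l IH] m n Psi; first by case: m; case: n.
case: m => [|m] mn Psi0 /=.
  case: n mn Psi0 => // n [mn] Psi0; rewrite add0r expr0 scale1r IH // => w wn.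
  exact: Psi0.
rewrite IH => [|//|w wn]; [|by case: mn|exact: Psi0].
case: n {mn} Psi0 => [|n] Psi0; first by rewrite scaler0 addr0.
rewrite (_ : wshuffle _ _ _ _ = 0) ?scaler0 ?addr0 //.
have Psi1 w : Psi (Some false :: w) = 0 by apply: Psi0.
by apply: wshuffle0 => w _; exact: Psi1.
Qed.

(** The image of a word under the alternating sum of the inner faces, restricted
    to the faces that create a letter [None]. *)
Fixpoint wmerge w Psi : V :=
  if w is a :: w' then
    (if w' is b :: w'' then if a == b then 0 else Psi (None :: w'') else 0)
    - wmerge w' (fun v => Psi (a :: v))
  else 0.

Lemma eq_wmerge w Psi Psi' : Psi =1 Psi' -> wmerge w Psi = wmerge w Psi'.
Proof. by move=> e; congr wmerge; exact: functional_extensionality_dep. Qed.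

Lemma wmerge0 w Psi : (forall v, Psi v = 0) -> wmerge w Psi = 0.
Proof.
elim: w Psi => //= a [|b w] IH Psi Psi0; rewrite IH ?subr0 //.
by rewrite Psi0 if_same.
Qed.
End Words.

Section WordCoefficients.
Variable R : comNzRingType.
Implicit Types (w u v : word).

(** A letter [None] arises only from two distinct adjacent letters, so exactly two words can merge
    to the given one; the sign records the position of the merge. *)
Lemma wmerge_coef w u v : None \notin w -> None \notin u ->
  wmerge w (fun w' => (w' == u ++ None :: v)%:R : R^o) =
  (-1) ^+ size u *: ((w == u ++ Some true :: Some false :: v)%:R +
                     (w == u ++ Some false :: Some true :: v)%:R).
Proof.
elim: u w => [|x u IH] w.
  case: w => [|a [|b w]] wn _; rewrite ?scale1r /=.
  - by rewrite addr0.
  - by case: a wn => [[]|] //; rewrite !eqseq_cons /= ?addr0 ?subr0 ?andbF ?addr0.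
  rewrite [X in _ - X](_ : _ = 0).
    rewrite subr0 !eqseq_cons; move: wn; rewrite !inE.
    by case: a => [[]|]; case: b => [[]|] //=; rewrite ?addr0 ?add0r.
  apply: (@wmerge0 R R^o (b :: w) (fun w' => (a :: w' == None :: v)%:R)) => w'.
  by move: wn; rewrite inE eqseq_cons; case: a.
case: w => [|a w]; rewrite !inE ?negb_or => wn /andP[xn un] /=.
  by rewrite addr0 scaler0.
move/andP: wn => [an wn].
rewrite [X in X - _](_ : _ = 0) ?sub0r; last first.
  case: (w) => // b w'; case: ifP => // _; rewrite eqseq_cons.
  by case: x xn.
rewrite !eqseq_cons; case: eqP => [->|ax] /=; last first.
  rewrite addr0 scaler0 wmerge0 ?oppr0 // => w'.
  by rewrite eqseq_cons; case: eqP.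
rewrite exprS mulN1r scaleNr -IH //; congr (- _); apply: eq_wmerge => w'.
by rewrite eqseq_cons eqxx.
Qed.

(** Adjacent exchanges sort any word into a standard one and change [a] only by a sign. The prefix
    [u] is quantified in [norm] so that sorting can proceed from the right. *)
Lemma antisymmetric_word_function (a : word -> R) :
  (forall u v, None \notin u ->
    a (u ++ Some true :: Some false :: v) + a (u ++ Some false :: Some true :: v)
    = 0) ->
  (forall i j, a (stdword i j) = 0) -> forall w, None \notin w -> a w = 0.
Proof.
move=> aS a0.
have move_right i u v : None \notin u ->
    a (u ++ Some false :: nseq i (Some true) ++ v) =
    (-1) ^+ i * a (u ++ nseq i (Some true) ++ Some false :: v).
  elim: i u => [|i IH] u un; first by rewrite mul1r.
  have := aS u (nseq i (Some true) ++ v) un => /eqP; rewrite addrC addr_eq0 /=.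
  move=> /eqP->; rewrite exprS mulN1r mulNr; congr (- _).
  have := IH (rcons u (Some true)); rewrite !cat_rcons; apply.
  by rewrite mem_rcons inE.
suff norm w : None \notin w -> exists i j, forall u, None \notin u ->
    exists e, a (u ++ w) = e * a (u ++ stdword i j).
  move=> w wn; have [i [j /(_ [::] isT)[e /= ->]]] := norm w wn.
  by rewrite a0 mulr0.
elim: w => [|[[]|] w IH] //; first by exists 0%N, 0%N => u _; exists 1; rewrite mul1r.
  move=> /IH[i [j wE]]; exists i.+1, j => u un.
  have [|e eE] := wE (rcons u (Some true)); first by rewrite mem_rcons inE.
  by exists e; rewrite -cat_rcons eE cat_rcons.
move=> /IH[i [j wE]]; exists i, j.+1 => u un.
have [|e eE] := wE (rcons u (Some false)); first by rewrite mem_rcons inE.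
exists (e * (-1) ^+ i); rewrite -cat_rcons eE cat_rcons /stdword move_right //.
by rewrite mulrA.
Qed.
End WordCoefficients.

(** In [split] it is applied only to identities [f], where it plays the part of a transport of the
    chain from [y] to [x]. *)
Definition precomp (C : smallcat) n (x y : C) (f : hom x y) :
    chain n y -> chain n x :=
  match n with
  | 0 => fun _ => tt
  | _.+1 => fun c => ccons (comp f (projT2 c).1) (projT2 c).2
  end.

Lemma precomp_id (C : smallcat) n (x : C) (c : chain n x) : precomp (idm x) c = c.
Proof. by case: n c => [[]//|n [y [f c]]]; rewrite /= compIm. Qed.

Lemma is_id_idm (C : smallcat) (x : C) : `[< is_id (idm x) >] = true.
Proof. exact/asboolP/IsId. Qed.

(** * Projections of chains in a product category *)

Section Split.
Variables (R : comNzRingType) (C D : smallcat).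
Notation CD := (prodcat C D).

(** The type of continuations: the lengths of the two projections depend on the chain, so they are
    handed to a function accepting all lengths. *)
Definition parts (V : Type) (p : CD) :=
  forall m n, chain m p.1 -> chain n p.2 -> word -> V.

(** The two projections of a chain of a product category, with the identities
    composed away, together with the word of the chain; chains containing an
    identity are sent to [0]. *)
Fixpoint split (V : lmodType R) l : forall p : CD, chain l p -> parts V p -> V :=
  match l with
  | 0 => fun p _ Phi => Phi 0%N 0%N tt tt [::]
  | l.+1 => fun p s Phi =>
    let f := (projT2 s).1.1 in
    let h := (projT2 s).1.2 in
    if `[< is_id f >] then
      if `[< is_id h >] then 0 else
      split (projT2 s).2 (fun m n c c' w =>
        Phi m n.+1 (precomp f c) (ccons h c') (Some false :: w))
    else if `[< is_id h >] then
      split (projT2 s).2 (fun m n c c' w =>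
        Phi m.+1 n (ccons f c) (precomp h c') (Some true :: w))
    else
      split (projT2 s).2 (fun m n c c' w =>
        Phi m.+1 n.+1 (ccons f c) (ccons h c') (None :: w))
  end.

(** Rebuilds a chain from its two projections and its word. The value 0 covers mixed letters and
    words that do not fit the chains, which marked non-degenerate chains never produce. *)
Fixpoint unsplit (V : lmodType R) l :
    forall (p : CD) m n, chain m p.1 -> chain n p.2 -> word -> (chain l p -> V) -> V :=
  match l with
  | 0 => fun p _ _ _ _ _ phi => phi tt
  | l.+1 => fun p m n c c' w phi =>
    match w with
    | Some true :: w => match m return chain m p.1 -> V with
      | 0 => fun _ => 0
      | m.+1 => fun c => @unsplit V l (projT1 c, p.2) m n (projT2 c).2 c' w
          (fun s => phi (@ccons CD l p (projT1 c, p.2) ((projT2 c).1, idm p.2) s))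
      end c
    | Some false :: w => match n return chain n p.2 -> V with
      | 0 => fun _ => 0
      | n.+1 => fun c' => @unsplit V l (p.1, projT1 c') m n c (projT2 c').2 w
          (fun s => phi (@ccons CD l p (p.1, projT1 c') (idm p.1, (projT2 c').1) s))
      end c'
    | _ => 0
    end
  end.

Section Values.
Variable V : lmodType R.
Implicit Types l m n : nat.

Lemma eq_split l (p : CD) (s : chain l p) (Phi Psi : parts V p) :
  (forall m n c c' w, Phi m n c c' w = Psi m n c c' w) -> split s Phi = split s Psi.
Proof.
move=> e; congr split; do 5!(apply: functional_extensionality_dep => ?).
exact: e.
Qed.

Lemma splitL l (p : CD) (y : C) (f : hom p.1 y) (s : chain l ((y, p.2) : CD))
    (Phi : parts V p) : ~ is_id f ->
  split (@ccons CD l p (y, p.2) (f, idm p.2) s) Phi =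
  split s (fun m n c c' w => Phi m.+1 n (ccons f c) c' (Some true :: w)).
Proof.
move=> fn; rewrite /= (asboolF fn) is_id_idm.
by apply: eq_split => m n c c' w; rewrite precomp_id.
Qed.

Lemma splitR l (p : CD) (y : D) (g : hom p.2 y) (s : chain l ((p.1, y) : CD))
    (Phi : parts V p) : ~ is_id g ->
  split (@ccons CD l p (p.1, y) (idm p.1, g) s) Phi =
  split s (fun m n c c' w => Phi m n.+1 c (ccons g c') (Some false :: w)).
Proof.
move=> fn; rewrite /= (asboolF fn) is_id_idm.
by apply: eq_split => m n c c' w; rewrite precomp_id.
Qed.

Lemma splitM l (p q : CD) (f : hom p.1 q.1) (g : hom p.2 q.2) (s : chain l q)
    (Phi : parts V p) : ~ is_id f -> ~ is_id g ->
  split (@ccons CD l p q (f, g) s) Phi =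
  split s (fun m n c c' w => Phi m.+1 n.+1 (ccons f c) (ccons g c') (None :: w)).
Proof. by move=> fn gn; rewrite /= (asboolF fn) (asboolF gn). Qed.

Lemma split_deg l (p : CD) (s : chain l p) (Phi : parts V p) :
  ~ ndchain s -> split s Phi = 0.
Proof.
elim: l p s Phi => [|l IH] p s Phi /=; first by case.
case: s => q [[f g] s] /= nds.
have [fid|fnid] := asboolP (is_id f); have [gid|gnid] := asboolP (is_id g);
  rewrite // IH // => ndss; apply: nds; split=> // /is_id_prod[];
  by [].
Qed.

Lemma split_map (W : lmodType R) (F : {linear V -> W}) l (p : CD) (s : chain l p)
    (Phi : parts V p) :
  F (split s Phi) = split s (fun m n c c' w => F (Phi m n c c' w)).
Proof.
elim: l p s Phi => [|l IH] p s Phi //=.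
by case: ifP => _; case: ifP => _; rewrite ?linear0 ?IH.
Qed.

(** All shuffles of two non-degenerate chains project back to these chains, so they differ only in
    their words. *)
Lemma shprod_split l m n (x : C) (x' : D) (c : chain m x) (c' : chain n x')
    (Phi : parts V ((x, x') : CD)) :
  ndchain c -> ndchain c' ->
  shprod c c' (fun s : chain l ((x, x') : CD) => split s Phi) =
  wshuffle l m n (fun w => Phi m n c c' w).
Proof.
elim: l m n x x' c c' Phi => [|l IH] m n x x' c c' Phi ndc ndc'.
  rewrite shprod_nil [RHS]/=; case: ifP => // /andP[/eqP m0 /eqP n0].
  by move: c c' {ndc ndc'}; rewrite m0 n0 => -[] [].
rewrite shprodE /=; congr (_ + _ *: _).
  case: m c ndc => // m [y [f c]] [/= fn ndc].
  apply: etrans (IH _ _ _ _ c c' (fun m n c c' w =>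
    Phi m.+1 n (ccons f c) c' (Some true :: w)) ndc ndc'); apply: eq_shprod => s.
  exact: (@splitL l (x, x') y f s Phi fn).
case: n c' ndc' => // n [y [f c']] [/= fn ndc'].
apply: etrans (IH _ _ _ _ c c' (fun m n c c' w =>
  Phi m n.+1 c (ccons f c') (Some false :: w)) ndc ndc'); apply: eq_shprod => s.
exact: (@splitR l (x, x') y f s Phi fn).
Qed.
End Values.
End Split.

Section BoxChains.
Variables (R : comNzRingType) (M M' : markedcat).
Notation CD := (prodcat M M').
Notation mchain := (chain_all (fun x y (f : hom x y) => marked f)).
Notation bchain := (chain_all (fun p q (a : @hom CD p q) => @marked (box M M') p q a)).

(** An inversion principle with the source [p] kept as a variable, which avoids destructing pairs
    inside dependent types of chains. *)
Lemma box_marked_ind (p : CD) (Q : forall q : CD, hom p q -> Prop) :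
  (forall (y : M) (f : hom p.1 y), marked f -> Q (y, p.2) (f, idm p.2)) ->
  (forall (y : M') (g : hom p.2 y), marked g -> Q (p.1, y) (idm p.1, g)) ->
  forall q (a : hom p q), box_marked a -> Q q a.
Proof.
move=> QL QR q a Ba; case: p q a / Ba Q QL QR => [x y m c' mm|c x' y' m' mm] Q QL QR.
  exact: (QL y m).
exact: (QR y' m').
Qed.

Lemma split_box l (p : CD) (s : chain l p) : bchain s -> ndchain s ->
  exists m n (c : chain m p.1) (c' : chain n p.2) (w : word),
  [/\ [/\ mchain c, mchain c', ndchain c & ndchain c'],
      (m + n)%N = l, perm_eq w (stdword m n),
      forall (V : lmodType R) (Phi : parts V p), split s Phi = Phi m n c c' w
    & forall (V : lmodType R) (phi : chain l p -> V), unsplit c c' w phi = phi s].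
Proof.
elim: l p s => [|l IH] p s.
  by case: s => _ _; exists 0%N, 0%N, tt, tt, [::].
case: s => q [a s] [/= Ba Bs] [an nds].
move: Bs nds an; move: s; move: q a Ba.
apply: box_marked_ind => [y f mf|y g mg] s Bs nds an.
  have fn : ~ is_id f.
    by move=> fid; apply: an; apply/is_id_prod; split=> //; exact: IsId.
  have [m [n [c [c' [w [[mc mc' ndc ndc'] mn wmn sE uE]]]]]] := IH _ s Bs nds.
  exists m.+1, n, (ccons f c), c', (Some true :: w); split=> //; first by rewrite addSn mn.
  - by rewrite /stdword /= perm_cons.
  - by move=> V Phi; rewrite [LHS](splitL s Phi fn) sE.
have gn : ~ is_id g.
  by move=> gid; apply: an; apply/is_id_prod; split=> //; exact: IsId.
have [m [n [c [c' [w [[mc mc' ndc ndc'] mn wmn sE uE]]]]]] := IH _ s Bs nds.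
exists m, n.+1, c, (ccons g c'), (Some false :: w); split=> //; first by rewrite addnS mn.
- apply: (@perm_trans _ ([:: Some false] ++ stdword m n)).
    by rewrite perm_cons.
  exact/permPl/perm_catCA.
- by move=> V Phi; rewrite [LHS](splitR s Phi gn) sE.
Qed.

Lemma stdword_notM m n w : perm_eq w (stdword m n) -> None \notin w.
Proof.
by move=> /perm_mem->; rewrite mem_cat !mem_nseq !andbF.
Qed.

(** Only the faces composing two arrows of different factors create a letter
    [None], so these are the only ones seen by [Phi]. *)
Lemma altface_split (V : lmodType R) l (p : CD) (s : chain l.+1 p)
    (Phi : parts V p) : bchain s -> ndchain s ->
  (forall m n c c' w, None \notin w -> Phi m n c c' w = 0) ->
  altface (fun e => split e Phi) s =
  split s (fun m n c c' w => wmerge w (Phi m n c c')).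
Proof.
have split0 k (q : CD) (t : chain k q) (Psi : parts V q) : bchain t ->
    (forall m n c c' w, None \notin w -> Psi m n c c' w = 0) -> split t Psi = 0.
  move=> Bt Psi0; have [ndt|] := pselect (ndchain t); last exact: split_deg.
  have [m [n [c [c' [w [_ _ /stdword_notM wM -> _]]]]]] := split_box Bt ndt.
  exact: Psi0.
elim: l p s Phi => [|l IH] p [q [a s]] Phi Bas ndas Phi0.
  rewrite altface1 /= Phi0 //.
  by case: ifP => _; case: ifP => _ //; rewrite /= subr0.
change (chain l.+1 q) in s.
have [Ba [an Bbs ndbs]] : box_marked a /\ [/\ ~ is_id a, bchain s & ndchain s].
  by have [[Ba Bs] [an nds]] := (Bas, ndas).
case: s Bbs ndbs {Bas ndas} => r [b s] Bbs ndbs.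
change (chain l r) in s.
have [Bb bn] : box_marked b /\ ~ is_id b.
  by have [[Bb Bs] [bn nds]] := (Bbs, ndbs).
have [Bs nds] : bchain s /\ ndchain s.
  by have [[Bb' Bs] [bn' nds]] := (Bbs, ndbs).
rewrite -/(ccons b s) -/(ccons a (ccons b s)) in Bbs ndbs *; rewrite altfaceS.
move: an r b Bb bn s Bs nds ndbs Bbs; move: q a Ba.
apply: box_marked_ind => [y f mf|y f mf] an r b Bb bn s Bs nds ndbs Bbs.
  have fn : ~ is_id f.
    by move=> fid; apply: an; apply/is_id_prod; split=> //; exact: IsId.
  pose Psi m n (c : chain m y) (c' : chain n p.2) := Phi m.+1 n (ccons f c) c'.
  have -> : altface (fun t => split (@ccons CD _ p (y, p.2) (f, idm p.2) t) Phi)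
      (ccons b s) = split (ccons b s) (fun m n c c' w =>
        wmerge w (fun v => Psi m n c c' (Some true :: v))).
    rewrite -(IH _ (ccons b s) (fun m n c c' w => Psi m n c c' (Some true :: w))) //.
      by apply: eq_bigr => i _; rewrite (splitL (cface i (ccons b s)) Phi fn).
    by move=> m n c c' w wn; apply: Phi0; rewrite inE.
  rewrite [RHS](splitL (ccons b s) _ fn).
  (* This is the face composing the first two arrows. If both lie in the same factor, its word has
     no [None] and [Phi] vanishes; otherwise the composite is the mixed arrow counted by
     [wmerge]. *)
  suff -> : split (ccons (comp (s := CD) ((f, idm p.2) : @hom CD p (y, p.2)) b) s) Phi =
      split (ccons b s) (fun m n c c' w =>
        if w is x :: w' then if Some true == x then 0 else Psi m n c c' (None :: w')
        else 0).
    by have [m [n [c [c' [w [_ _ _ sE _]]]]]] := split_box Bbs ndbs; rewrite !sE.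
  move: r b Bb bn s Bs nds {ndbs Bbs}.
  apply: box_marked_ind => [z g mg|z g mg] bn s Bs nds.
    have gn : ~ is_id g.
      by move=> gid; apply: bn; apply/is_id_prod; split=> //; exact: IsId.
    rewrite (splitL s _ gn) [RHS]split0 //.
    rewrite -[LHS]/(split (@ccons CD _ p (z, p.2)
      (comp f g, comp (idm p.2) (idm p.2)) s) Phi) /= compIm is_id_idm.
    case: ifP => // _; rewrite split0 // => m n c c' w wn; apply: Phi0.
    by rewrite inE.
  have gn : ~ is_id g.
    by move=> gid; apply: bn; apply/is_id_prod; split=> //; exact: IsId.
  rewrite (splitR s _ gn).
  rewrite -[LHS]/(split (@ccons CD _ p (y, z)
    (comp f (idm y), comp (idm p.2) g) s) Phi) compIm compmI.
  exact: (@splitM _ _ _ _ _ p (y, z) f g s Phi fn gn).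
have fn : ~ is_id f.
  by move=> fid; apply: an; apply/is_id_prod; split=> //; exact: IsId.
pose Psi m n (c : chain m p.1) (c' : chain n y) := Phi m n.+1 c (ccons f c').
have -> : altface (fun t => split (@ccons CD _ p (p.1, y) (idm p.1, f) t) Phi)
    (ccons b s) = split (ccons b s) (fun m n c c' w =>
      wmerge w (fun v => Psi m n c c' (Some false :: v))).
  rewrite -(IH _ (ccons b s) (fun m n c c' w => Psi m n c c' (Some false :: w))) //.
    by apply: eq_bigr => i _; rewrite (splitR (cface i (ccons b s)) Phi fn).
  by move=> m n c c' w wn; apply: Phi0; rewrite inE.
rewrite [RHS](splitR (ccons b s) _ fn).
suff -> : split (ccons (comp (s := CD) ((idm p.1, f) : @hom CD p (p.1, y)) b) s) Phi =
    split (ccons b s) (fun m n c c' w =>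
      if w is x :: w' then if Some false == x then 0 else Psi m n c c' (None :: w')
      else 0).
  by have [m [n [c [c' [w [_ _ _ sE _]]]]]] := split_box Bbs ndbs; rewrite !sE.
move: r b Bb bn s Bs nds {ndbs Bbs}.
apply: box_marked_ind => [z g mg|z g mg] bn s Bs nds.
  have gn : ~ is_id g.
    by move=> gid; apply: bn; apply/is_id_prod; split=> //; exact: IsId.
  rewrite (splitL s _ gn).
  rewrite -[LHS]/(split (@ccons CD _ p (z, y)
    (comp (idm p.1) g, comp f (idm y)) s) Phi) compIm compmI.
  exact: (@splitM _ _ _ _ _ p (z, y) g f s Phi gn fn).
have gn : ~ is_id g.
  by move=> gid; apply: bn; apply/is_id_prod; split=> //; exact: IsId.
rewrite (splitR s _ gn) [RHS]split0 //.
rewrite -[LHS]/(split (@ccons CD _ p (p.1, z)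
  (comp (idm p.1) (idm p.1), comp f g) s) Phi) /= compIm is_id_idm.
case: ifP => // _; rewrite split0 // => m n c c' w wn; apply: Phi0.
by rewrite inE.
Qed.
End BoxChains.

Lemma submodB (R : comNzRingType) (V : lmodType R) (S : submodClosed V) (x y : V) :
  x \in S -> y \in S -> x - y \in S.
Proof. by move=> xS yS; rewrite -scaleN1r rpredD // rpredZ. Qed.

Lemma span_in (R : comNzRingType) (V W : lmodType R) (A : V -> Prop)
    (f : {linear V -> W}) (S : submodClosed W) :
  (forall x, A x -> f x \in S) -> forall x, x \in span A -> f x \in S.
Proof.
move=> fA x /mksubmodP[r rA ->]; rewrite linear_sum big_seq rpred_sum // => p rp.
by rewrite linearZ_LR rpredZ //; exact/fA/rA.
Qed.

Lemma marked_in (R : comNzRingType) (M : markedcat) l (V : lmodType R)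
    (F : {linear nerve R M l -> V}) (S : submodClosed V) :
  (forall p (s : chain l p), chain_all (fun x y (f : hom x y) => marked f) s ->
    ndchain s -> F (symb R (existT _ p s)) \in S) ->
  forall x, x \in marked_sub R M l -> F x \in S.
Proof.
move=> FS; apply: span_in => _ [[p s] ms ->].
have [nds|nds] := pselect (nondeg (existT (chain l) p s)); first exact: FS.
by rewrite (symb_deg R nds) linear0 rpred0.
Qed.

Lemma marked_eq0 (R : comNzRingType) (M : markedcat) l (V : lmodType R)
    (F : {linear nerve R M l -> V}) :
  (forall p (s : chain l p), chain_all (fun x y (f : hom x y) => marked f) s ->
    ndchain s -> F (symb R (existT _ p s)) = 0) ->
  forall x, x \in marked_sub R M l -> F x = 0.
Proof.
move=> F0; apply: span_eq0 => _ [[p s] ms ->].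
have [nds|nds] := pselect (nondeg (existT (chain l) p s)); first exact: F0.
by rewrite (symb_deg R nds) linear0.
Qed.

Lemma wshuffle_map (R : comNzRingType) (V W : lmodType R) (F : {linear V -> W})
    l m n (Psi : word -> V) :
  F (wshuffle l m n Psi) = wshuffle l m n (fun w => F (Psi w)).
Proof.
elim: l m n Psi => [|l IH] m n Psi /=; first by case: ifP; rewrite ?linear0.
by rewrite linearD linearZ_LR; case: m => [|m]; case: n => [|n];
   rewrite ?IH ?linear0.
Qed.

(** * Coefficients of marked chains and their antisymmetry *)

Section Totals.
Variables (R : comNzRingType) (C : smallcat).

(** Gathering all dimensions in one type lets projections of varying lengths index a single free
    module. *)
Definition total_simplex : choiceType := {m : nat & {classic simplex C m}}.

Definition total m (s : simplex C m) : total_simplex :=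
  existT (fun m => {classic simplex C m}) m s.

Definition total_symb m (u : total_simplex) : nerve R C m :=
  if @eqP _ (tag u) m is ReflectT e
  then symb R (ecast k (simplex C k) e (tagged u)) else 0.

Lemma total_symbE m (s : simplex C m) : total_symb m (total s) = symb R s.
Proof. by rewrite /total_symb; case: eqP => // e; rewrite (eq_axiomK e). Qed.

Lemma total_symb_neq m k (s : simplex C k) : k != m -> total_symb m (total s) = 0.
Proof. by rewrite /total_symb; case: eqP => // -> ; rewrite eqxx. Qed.

Lemma coeff_total_symb m (t : ndsimplex C m) (u : total_simplex) :
  coeff t (total_symb m u) = (u == total (val t))%:R.
Proof.
case: u => k s; have [km|nkm] := eqVneq k m; last first.
  rewrite (total_symb_neq (s : simplex C k) nkm) coeff0.
  by case: eqP => // /(congr1 tag)/eqP; rewrite (negPf nkm).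
subst k; rewrite (total_symbE (s : simplex C m)).
rewrite eq_Tagged /=; case: symbP => [t' <- _|nds].
  by rewrite coeffU mul1r.
rewrite coeff0; case: eqP => // sE; case: nds.
by rewrite sE; apply/asboolP; exact: valP t.
Qed.
End Totals.

Section Antisymmetry.
Variables (R : comNzRingType) (M M' : markedcat).
Notation CD := (prodcat M M').
Notation N := (nerve R M).
Notation N' := (nerve R M').
Notation NB := (nerve R CD).
Notation mchain := (chain_all (fun x y (f : hom x y) => marked f)).
Notation bchain := (chain_all (fun p q (a : @hom CD p q) => @marked (box M M') p q a)).

(** The basis in which coefficients are compared: exchanging two letters changes the word and leaves
    both simplices fixed. *)
Definition triple : choiceType := (total_simplex M * total_simplex M' * word)%type.

Definition mk_triple (p : CD) m n (c : chain m p.1) (c' : chain n p.2) (w : word) :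
  triple := (total (existT _ p.1 c), total (existT _ p.2 c'), w).

Lemma triples_deg l (s : simplex CD l) : ~ nondeg s ->
  split (projT2 s) (fun m n c c' w => << mk_triple c c' w >> : {freeg triple / R}) = 0.
Proof. exact: split_deg. Qed.

Definition triples l : {linear NB l -> {freeg triple / R}} :=
  sval (nerve_lift (@triples_deg l)).

Lemma triples_symb l (s : simplex CD l) : triples l (symb R s) =
  split (projT2 s) (fun m n c c' w => << mk_triple c c' w >>).
Proof. exact: (svalP (nerve_lift (@triples_deg l))). Qed.

Lemma triples_EZ l m n (t : simplex M m) (t' : simplex M' n) :
  nondeg t -> nondeg t' ->
  triples l (EZ R M M' l m n (pure (symb R t) (symb R t'))) =
  wshuffle l m n (fun w => << ((total t, total t'), w) : triple >>).
Proof.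
case: t t' => x c [x' c'] ndt ndt'; rewrite EZ_symb shprod_map.
apply: etrans (@shprod_split R M M' _ l m n x x' c c'
  (fun m n c c' w => << @mk_triple (x, x') m n c c' w >>) ndt ndt').
by apply: eq_shprod => s; exact: triples_symb.
Qed.

(** The component of bidegree [(m, n)] of the Alexander-Whitney map; on marked
    simplices of a box product it only sees those with word [L^m R^n]. *)
Definition AW l m n : {linear NB l -> tens (N m) (N' n)} :=
  freelift (fun u : triple => if u.2 == stdword m n
    then pure (total_symb R m u.1.1) (total_symb R n u.1.2) else 0) \o triples l.

Lemma AW_EZ l m n (z : tens (N m) (N' n)) : (m + n)%N = l ->
  AW l m n (EZ R M M' l m n z) = z.
Proof.
move=> mn; rewrite -[LHS]/((AW l m n \o EZ R M M' l m n) z).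
rewrite -[RHS]/((idfun : {linear _ -> _}) z); apply: tens_nerve_eq => t t' /=.
have [ndt|ndt] := pselect (nondeg t); last first.
  by rewrite (symb_deg R ndt) pure0l !linear0.
have [ndt'|ndt'] := pselect (nondeg t'); last first.
  by rewrite (symb_deg R ndt') pure0r !linear0.
rewrite triples_EZ // wshuffle_map wshuffle_std // => [|w wn].
  by rewrite /= freeliftU /= eqxx !total_symbE.
by rewrite /= freeliftU /= (negPf wn).
Qed.

Lemma AW_EZ0 l m n m1 n1 (z : tens (N m1) (N' n1)) : m1 != m ->
  AW l m n (EZ R M M' l m1 n1 z) = 0.
Proof.
move=> mn; rewrite -[LHS]/((AW l m n \o EZ R M M' l m1 n1) z).
rewrite -[RHS]/((\0 : {linear _ -> _}) z); apply: tens_nerve_eq => t t' /=.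
have [ndt|ndt] := pselect (nondeg t); last first.
  by rewrite (symb_deg R ndt) pure0l !linear0.
have [ndt'|ndt'] := pselect (nondeg t'); last first.
  by rewrite (symb_deg R ndt') pure0r !linear0.
rewrite triples_EZ // wshuffle_map wshuffle0 // => w _.
by rewrite /= freeliftU /= total_symb_neq // pure0l if_same.
Qed.

(** The product of the coordinate forms of [t] and [t'], applied to [AW], gives exactly the
    coefficient at the corresponding standard triple. *)
Lemma AW_coeff l m n (t : ndsimplex M m) (t' : ndsimplex M' n) (x : NB l) :
  AW l m n x = 0 ->
  coeff ((total (val t : simplex M m), total (val t' : simplex M' n),
    stdword m n) : triple) (triples l x) = 0.
Proof.
have [|u a v v'|cf cfE] := @tens_lift R (N m) (N' n) R^o
    (fun u v => coeff t u * coeff t' v).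
- by move=> v a u u'; rewrite coeffD coeffZ mulrDl -mulrA.
- by rewrite coeffD coeffZ mulrDr [a *: _]mulrCA.
set tau : triple := (_, _, _).
move=> /(congr1 cf); rewrite linear0 => <-; rewrite /AW /=.
pose G : {linear {freeg triple / R} -> tens (N m) (N' n)} :=
  freelift (fun u : triple => if u.2 == stdword m n
    then pure (total_symb R m u.1.1) (total_symb R n u.1.2) else 0).
apply: (@freelift_eq R triple R^o (coefl R tau) (cf \o G)) => u.
rewrite coeflU /G /= freeliftU; case: u => [[u u'] w] /=.
rewrite /tau !xpair_eqE; case: (w == _); last by rewrite andbF linear0.
rewrite cfE !coeff_total_symb andbT.
by case: (u == _); case: (u' == _); rewrite /= ?mulr0 ?mulr1.
Qed.

Lemma triples_marked l (x : NB l) (u : triple) :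
  x \in marked_sub R (box M M') l -> coeff u (triples l x) != 0 ->
  [/\ nondeg (tagged u.1.1 : simplex M _), nondeg (tagged u.1.2 : simplex M' _),
      (tag u.1.1 + tag u.1.2)%N = l & perm_eq u.2 (stdword (tag u.1.1) (tag u.1.2))].
Proof.
move=> xm; apply: contraPP => nQ; apply/negP; rewrite negbK; apply/eqP.
apply: (@marked_eq0 R (box M M') l R^o (coefl R u \o triples l) _ x xm).
move=> p s Bs nds; rewrite /= triples_symb /=.
have [m [n [c [c' [w [[mc mc' ndc ndc'] mn wmn sE _]]]]]] := split_box R Bs nds.
rewrite sE coeffU mul1r; case: eqP => // uE; case: nQ.
by rewrite -uE; split.
Qed.

(** For a marked chain, deleting the first arrow leaves a word without [None]. The mixed coefficient
    of the boundary thus comes from inner faces alone, and [wmerge_coef] finds the two words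
    responsible. *)
Lemma triples_swap l (x : NB l.+1) (u u' : _) (v v' : word) :
  x \in marked_sub R (box M M') l.+1 -> None \notin v ->
  coeff (((u, u'), v ++ None :: v') : triple) (triples l (cdiff NB l x)) +
  (-1) ^+ size v *
    (coeff (((u, u'), v ++ Some true :: Some false :: v') : triple) (triples l.+1 x) +
     coeff (((u, u'), v ++ Some false :: Some true :: v') : triple) (triples l.+1 x))
  = 0.
Proof.
move=> xm vn; set tM : triple := (_, _ ++ None :: _).
set t1 : triple := (_, _ ++ Some true :: _); set t2 : triple := (_, _ ++ Some false :: _).
pose F : {linear NB l.+1 -> R^o} := (coefl R tM \o triples l \o cdiff NB l) \+
  ((-1) ^+ size v \*: ((coefl R t1 \o triples l.+1) \+ (coefl R t2 \o triples l.+1))).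
change (F x = 0); apply: (@marked_eq0 R (box M M') l.+1 R^o F _ x xm) => p s Bs nds.
have [m [n [c [c' [w [[mc mc' ndc ndc'] mn wmn sE _]]]]]] := split_box R Bs nds.
pose G : {linear NB l -> R^o} := coefl R tM \o triples l.
have GE e : G (symb R e) =
    split (projT2 e) (fun m n c c' w => coeff tM << mk_triple c c' w >> : R^o).
  rewrite /G /= triples_symb.
  exact: (split_map (coefl R tM)).
rewrite /F /= nerve_diff_symb bsum_altface -[coeff tM _]/(G _) linearB altface_map.
have -> : G (symb R (existT (chain l) (projT1 s) (projT2 s).2)) = 0.
  case: s Bs nds {sE} => q [a s] [Ba Bs] [an nds]; rewrite GE /=.
  have [m1 [n1 [c1 [c1' [w1 [_ _ /stdword_notM w1M -> _]]]]]] := split_box R Bs nds.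
  rewrite coeffU; case: eqP => [tE|]; rewrite ?mulr0 //; case/negP: w1M.
  by move/(congr1 snd): tE => /= ->; rewrite mem_cat mem_head orbT.
rewrite sub0r !triples_symb !sE !coeffU !mul1r.
have -> : altface (fun e => G (symb R (existT (chain l) p e))) s =
    wmerge w (fun w' => coeff tM << mk_triple c c' w' >> : R^o).
  rewrite -(sE _ (fun m n c c' w =>
    wmerge w (fun w' => coeff tM << mk_triple c c' w' >> : R^o))).
  rewrite -(altface_split (Phi := fun m n c c' w =>
    coeff tM << mk_triple c c' w >> : R^o) Bs nds).
    by apply: eq_bigr => i _; rewrite GE.
  move=> m1 n1 c1 c1' w1 w1M; rewrite coeffU; case: eqP => [tE|]; rewrite ?mulr0 //.
  case/negP: w1M; move/(congr1 snd): tE => /= ->.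
  by rewrite mem_cat mem_head orbT.
rewrite (eq_wmerge w (Psi' := fun w' =>
    (((mk_triple c c' w).1 == (u, u')) && (w' == v ++ None :: v'))%:R : R^o)).
  have -> : (mk_triple c c' w == t1) = ((mk_triple c c' w).1 == (u, u')) &&
      (w == v ++ Some true :: Some false :: v') by [].
  have -> : (mk_triple c c' w == t2) = ((mk_triple c c' w).1 == (u, u')) &&
      (w == v ++ Some false :: Some true :: v') by [].
  case: (_ == (u, u')) => /=; last by rewrite wmerge0 // oppr0 addr0 scaler0 addr0.
  by rewrite wmerge_coef ?(stdword_notM wmn) // addNr.
by move=> w'; rewrite coeffU mul1r.
Qed.

(** Reassembling each triple by [unsplit] gives a left inverse on marked simplices. *)
Lemma triples_inj l (x : NB l) :
  x \in marked_sub R (box M M') l -> triples l x = 0 -> x = 0.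
Proof.
move=> xm tx; pose beta : {linear {freeg triple / R} -> NB l} :=
  freelift (fun u : triple => @unsplit R M M' (NB l) l
    (projT1 (tagged u.1.1 : simplex M _), projT1 (tagged u.1.2 : simplex M' _)) _ _
    (projT2 (tagged u.1.1 : simplex M _)) (projT2 (tagged u.1.2 : simplex M' _)) u.2
    (@symb2 R M M' l _ _)).
apply/subr0_eq; rewrite -[X in _ - X](linear0 beta) -tx.
rewrite -[LHS]/((idfun \- (beta \o triples l)) x).
apply: (@marked_eq0 R (box M M') l _ _ _ x xm) => -[p p'] s Bs nds.
have [m [n [c [c' [w [_ _ _ sE uE]]]]]] := split_box R Bs nds.
rewrite [LHS]/(symb R _ - beta (triples l _)) triples_symb sE [beta _]freeliftU.
by rewrite uE; exact: subrr.
Qed.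

Lemma symb_marked (X : markedcat) l (x : X) (s : chain l x) :
  chain_all (fun x y (f : hom x y) => marked f) s ->
  symb R (existT _ x s) \in marked_sub R X l.
Proof.
move=> ms; apply/mksubmodP; exists [:: (1, symb R (existT _ x s))] => [q|].
  by rewrite inE => /eqP->; exists (existT _ x s).
by rewrite big_seq1 scale1r.
Qed.

Lemma EZ_marked l m n (t : simplex M m) (t' : simplex M' n) :
  mchain (projT2 t) -> mchain (projT2 t') ->
  EZ R M M' l m n (pure (symb R t) (symb R t')) \in marked_sub R (box M M') l.
Proof.
move=> mt mt'; rewrite EZ_symb.
apply: (@shprod_in R M M' (NB l) _ (fun x y f => marked f) (fun x y f => marked f)
  (fun p q a => @marked (box M M') p q a)) => //.
- by move=> x y f x' mf; exact: BoxL.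
- by move=> x x' y' f mf; exact: BoxR.
- by move=> s; exact: (@symb_marked (box M M')).
Qed.

Variant AW_symb_spec m n : tens (N m) (N' n) -> Prop :=
| AWSymb0 : AW_symb_spec 0
| AWSymb (t : simplex M m) (t' : simplex M' n) of
    mchain (projT2 t) & mchain (projT2 t') :
    AW_symb_spec (pure (symb R t) (symb R t')).

Lemma AW_symbP l m n p (s : chain l p) : bchain s -> ndchain s ->
  AW_symb_spec (AW l m n (symb R (existT _ p s))).
Proof.
move=> Bs nds; have [m1 [n1 [c [c' [w [[mc mc' _ _] _ _ sE _]]]]]] := split_box R Bs nds.
rewrite /AW /= triples_symb sE freeliftU /=; case: ifP => _; last exact: AWSymb0.
have [m1m|mm] := eqVneq m1 m; last by rewrite total_symb_neq // pure0l; exact: AWSymb0.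
have [n1n|nn] := eqVneq n1 n; last first.
  by rewrite (total_symb_neq _ _ nn) pure0r; exact: AWSymb0.
by subst m1 n1; rewrite !total_symbE; exact: AWSymb.
Qed.

Lemma EZ_AW_marked l m n (x : NB l) : x \in marked_sub R (box M M') l ->
  EZ R M M' l m n (AW l m n x) \in marked_sub R (box M M') l.
Proof.
move: x; apply: (@marked_in R (box M M') l _ (EZ R M M' l m n \o AW l m n)).
move=> p s Bs nds.
suff : EZ R M M' l m n (AW l m n (symb R (existT _ p s : simplex CD l)))
  \in marked_sub R (box M M') l by [].
case: (AW_symbP m n Bs nds) => [|t t' mt mt'].
  by rewrite linear0 rpred0.
exact: EZ_marked.
Qed.

Lemma triples_EZ_mixed l m n (z : tens (N m) (N' n)) u u' (v v' : word) :
  coeff (((u, u'), v ++ None :: v') : triple) (triples l (EZ R M M' l m n z)) = 0.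
Proof.
set tM : triple := (_, _).
apply: (@tens_nerve_eq R M M' R^o m n (coefl R tM \o triples l \o EZ R M M' l m n)
  \0) => t t' /=.
have [ndt|ndt] := pselect (nondeg t); last first.
  by rewrite (symb_deg R ndt) pure0l !linear0 coeff0.
have [ndt'|ndt'] := pselect (nondeg t'); last first.
  by rewrite (symb_deg R ndt') pure0r !linear0 coeff0.
rewrite triples_EZ // -[LHS]/(coefl R tM _) wshuffle_map wshuffle0 // => w wM /=.
rewrite coeffU; case: eqP => [[_ _ wE]|]; rewrite ?mulr0 //.
by move: wM; rewrite wE mem_cat mem_head orbT.
Qed.

(** The coefficients of [x] are determined by those at the words [L^m R^n]: the
    marked part of the boundary does not see the letters [None], which forces the
    coefficients to change sign when two adjacent letters are exchanged. *)
Theorem EZ_AW l (x : NB l) : x \in marked_sub R (box M M') l ->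
  bdry NB l x \in marked_sub R (box M M') l.-1 ->
  x = \sum_(i < l.+1) EZ R M M' l i (l - i) (AW l i (l - i) x).
Proof.
move=> xm dxm; apply/subr0_eq; set S := \sum_(i < _) _.
have ym : x - S \in marked_sub R (box M M') l.
  apply: (@submodB _ _ (marked_sub R (box M M') l)) => //.
  by apply: (@rpred_sum _ (marked_sub R (box M M') l)) => i _; exact: EZ_AW_marked.
have AWy i : (i <= l)%N -> AW l i (l - i) (x - S) = 0.
  move=> il; apply/eqP; rewrite linearB subr_eq0 eq_sym; apply/eqP.
  rewrite /S linear_sum (bigD1 (Ordinal (il : (i < l.+1)%N))) //.
  rewrite (@AW_EZ l i (l - i)) ?subnKC // big1 => [|j]; first exact: addr0.
  by rewrite -val_eqE => ij; exact: AW_EZ0.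
apply: triples_inj => //; apply/eqP/freeg_eqP => -[[u u'] w]; rewrite coeff0.
have [wM|wM] := boolP (None \in w).
  apply/eqP; apply: contraT => /(triples_marked ym)[_ _ _ /stdword_notM] /=.
  by rewrite wM.
move: w wM; apply: antisymmetric_word_function => [v v' vM|i j]; last first.
  (* A nonzero coefficient would force [i] and [j] to be the dimensions of the two simplices, by
     counting letters; [AW_coeff] then makes it vanish. *)
  apply/eqP; apply: contraT => cn; have [/= ndu ndu' lE wE] := triples_marked ym cn.
  have iE : i = tag u.
    have := permP wE (pred1 (Some true)); rewrite /stdword !count_cat !count_nseq /=.
    by rewrite !mul1n !mul0n !addn0.
  have jE : j = tag u'.
    have := permP wE (pred1 (Some false)); rewrite /stdword !count_cat !count_nseq /=.
    by rewrite !mul1n !mul0n !add0n.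
  subst i j; case/negP: cn; apply/eqP.
  have ul : (tag u <= l)%N by rewrite -lE leq_addr.
  case: u u' ndu ndu' lE ul {wE} => m t [n t'] /= ndt ndt' lE ul.
  have nE : n = (l - m)%N by rewrite -lE addKn.
  subst n.
  have td : `[< nondeg (t : simplex M m) >] by exact/asboolP.
  have td' : `[< nondeg (t' : simplex M' (l - m)) >] by exact/asboolP.
  exact: (@AW_coeff l m (l - m) (exist _ t td) (exist _ t' td') _ (AWy m ul)).
have SE : S = \sum_(i < l.+1) EZ R M M' l i (l - i) (AW l i (l - i) x) by [].
case: l x xm dxm S ym SE {AWy} => [|l] x xm dxm S ym SE.
  (* In degree 0 only the empty word occurs, so the exchange relation, about words of length at
     least two, holds trivially. *)
  have zero w : (1 < size w)%N ->
      coeff (((u, u'), w) : triple) (triples 0 (x - S)) = 0.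
    move=> sw; apply/eqP; apply: contraT => /(triples_marked ym)[_ _ /= /eqP lE].
    move: lE; rewrite addn_eq0 => /andP[/eqP-> /eqP->] /perm_size /= wE.
    by move: sw; rewrite wE.
  by rewrite !zero ?addr0 // size_cat /= !addnS.
have := triples_swap u u' v' ym vM.
rewrite [X in X + _ = _](_ : _ = 0).
  move/(congr1 (fun c => (-1) ^+ size v * c)).
  by rewrite add0r mulrA -expr2 sqrr_sign mul1r mulr0.
(* The mixed coefficient vanishes for two different reasons: the boundary of [x] is marked by
   hypothesis, while that of [S] is again a combination of shuffle products, whose words have no
   [None]. *)
rewrite linearB linearB coeffB [X in X - _](_ : _ = 0) ?sub0r.
  rewrite SE !linear_sum raddf_sum big1 ?oppr0 // => i _.
  rewrite EZ_diff (linearD (triples l)) (linearZ_LR (triples l)).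
  rewrite [LHS]coeffD coeffZ.
  by rewrite !triples_EZ_mixed mulr0 addr0.
apply/eqP; apply: contraT => /(triples_marked dxm)[_ _ _ /stdword_notM /=].
by rewrite mem_cat mem_head orbT.
Qed.
End Antisymmetry.

(** * Path complexes of box products *)

Section HomologyIso.
Variables (R : comNzRingType) (C D : complex R) (f : forall n, {linear C n -> D n}).
Hypothesis f_bij : forall n, bijective (f n).
Hypothesis f_diff : forall n x, f n (cdiff C n x) = cdiff D n (f n.+1 x).

Lemma chain_map_bdry n x : bdry D n (f n x) = f n.-1 (bdry C n x).
Proof. by case: n x => [|n] x; rewrite /= ?linear0 ?f_diff. Qed.

Lemma homology_iso n : exists h : {linear homology C n -> homology D n}, bijective h.
Proof.
have fk x : x \in kersub (bdry C n) -> f n x \in kersub (bdry D n).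
  by move=> /kersubP dx; apply/kersubP; rewrite chain_map_bdry dx linear0.
pose F : {linear submod (kersub (bdry C n)) -> homology D n} := cls _ \o restrict fk.
have F0 z : z \in presub (submod_val (kersub (bdry C n))) (imsub (cdiff C n)) ->
    F z = 0.
  move=> /presubP/imsubP[y yE]; apply/eqP; rewrite cls_eq0; apply/presubP/imsubP.
  by exists (f n.+1 y); rewrite -f_diff yE.
pose h : {linear homology C n -> homology D n} := qlift F0.
have hE z : h (cls _ z) = F z by exact: qliftE.
have finj := bij_inj (f_bij n).
have [||g [hK gK]] := @linear_inverse _ _ _ h; last by exists h, g.
- apply: linear_inj => u; have [z ->] := cls_surj u; rewrite hE => /eqP.
  rewrite cls_eq0 => /presubP/imsubP[y yE]; apply/eqP; rewrite cls_eq0.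
  apply/presubP/imsubP; have [g _ gK] := f_bij n.+1.
  by exists (g y); apply: finj; rewrite f_diff gK.
- move=> v; have [[z kz] ->] := cls_surj v.
  have [g _ gK] := f_bij n; have kgz : g z \in kersub (bdry C n).
    apply/kersubP/(bij_inj (f_bij n.-1)); rewrite -chain_map_bdry gK linear0.
    exact/kersubP.
  exists (cls _ (exist (fun x => x \in kersub (bdry C n)) _ kgz : submod _)).
  by rewrite hE; congr (cls _ _); apply: val_inj; exact: gK.
Qed.
End HomologyIso.

Lemma short_exact_iso (R : comNzRingType) (U V V' W : lmodType R)
    (f : {linear U -> V}) (g : {linear V -> W}) (h : {linear V' -> V}) :
  bijective h -> short_exact f g ->
  exists (f' : {linear U -> V'}) (g' : {linear V' -> W}), short_exact f' g'.
Proof.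
move=> hb [finj fg gs]; have hs v : exists v', h v' = v.
  by have [k _ kK] := hb; exists (k v); exact: kK.
have [k [hK kK]] := linear_inverse (bij_inj hb) hs.
exists (k \o f), (g \o h); split.
- exact: inj_comp (can_inj kK) finj.
- move=> y; split=> [/fg[x xE]|[x <-]]; last by rewrite /= kK; apply/fg; exists x.
  by exists x; rewrite /= xE hK.
- by move=> z; have [y <-] := gs z; exists (k y); rewrite /= kK.
Qed.

Lemma subfree_pair (R : comNzRingType) (V W : lmodType R) :
  subfree V -> subfree W -> subfree (V * W)%type.
Proof.
move=> [S [f finj]] [T [g ginj]].
pose i1 : {linear {freeg S / R} -> {freeg (S + T)%type / R}} :=
  freelift (fun s => <<(inl s : S + T)>>).
pose i2 : {linear {freeg T / R} -> {freeg (S + T)%type / R}} :=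
  freelift (fun t => <<(inr t : S + T)>>).
pose p1 : {linear {freeg (S + T)%type / R} -> {freeg S / R}} :=
  freelift (fun u : S + T => if u is inl s then <<s>> else 0).
pose p2 : {linear {freeg (S + T)%type / R} -> {freeg T / R}} :=
  freelift (fun u : S + T => if u is inr s then <<s>> else 0).
have p1i1 D : p1 (i1 D) = D.
  rewrite -[LHS]/((p1 \o i1) D) -[RHS]/((idfun : {linear _ -> _}) D).
  by apply: freelift_eq => s /=; rewrite !freeliftU.
have p1i2 D : p1 (i2 D) = 0.
  rewrite -[LHS]/((p1 \o i2) D) -[RHS]/((\0 : {linear _ -> _}) D).
  by apply: freelift_eq => s /=; rewrite !freeliftU.
have p2i2 D : p2 (i2 D) = D.
  rewrite -[LHS]/((p2 \o i2) D) -[RHS]/((idfun : {linear _ -> _}) D).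
  by apply: freelift_eq => s /=; rewrite !freeliftU.
have p2i1 D : p2 (i1 D) = 0.
  rewrite -[LHS]/((p2 \o i1) D) -[RHS]/((\0 : {linear _ -> _}) D).
  by apply: freelift_eq => s /=; rewrite !freeliftU.
have lin : linear (fun x : V * W => i1 (f x.1) + i2 (g x.2)).
  by move=> a x y; rewrite /= !linearP scalerDr addrACA.
exists (S + T)%type, (mklin lin); apply: linear_inj => -[v w] /= vw.
have := congr1 p1 vw; have := congr1 p2 vw.
rewrite !linearD p1i1 p1i2 p2i1 p2i2 !linear0 addr0 add0r => gw fv.
by congr pair; [apply: finj | apply: ginj]; rewrite ?fv ?gw linear0.
Qed.

(** The kernel of [s] splits off [A], because its image is projective. *)
Lemma tens_kernels (K : idomainType) (K_PID : is_PID K) (A A' E E' : lmodType K)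
    (s : {linear A -> E}) (s' : {linear A' -> E'})
    (S : submodClosed A) (S' : submodClosed A') :
  projective A -> projective A' -> subfree E -> subfree E' ->
  (forall x, s x = 0 -> x \in S) -> (forall x, s' x = 0 -> x \in S') ->
  forall x : tens A A', tmap s idfun x = 0 -> tmap idfun s' x = 0 ->
  exists y : tens (submod S) (submod S'), tmap (submod_val S) (submod_val S') y = x.
Proof.
move=> Ap A'p Ef E'f sS s'S x sx s'x.
have retract (B B' : lmodType K) (t : {linear B -> B'}) (T : submodClosed B) :
    subfree B' -> (forall x, t x = 0 -> x \in T) ->
    exists (q : {linear B -> submod (imsub t)}) (u : {linear submod (imsub t) -> B})
      (r : {linear B -> submod T}),
    (forall x, val (q x) = t x) /\ (forall x, val (r x) + u (q x) = x).
  move=> B'f tT; have tI z : t z \in imsub t by apply/imsubP; exists z.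
  pose q := corestrict tI.
  have [|u uE] := @projective_lift _ _ _ _ q idfun
      (subfree_projective K_PID (subfree_submod (imsub t) B'f)).
    by move=> z; have /imsubP[b bE] := valP z; exists b; exact: val_inj.
  have rT z : (idfun \- (u \o q)) z \in T.
    apply: tT; rewrite /= linearB; have /= -> := congr1 val (uE (q z)).
    by rewrite subrr.
  by exists q, u, (corestrict rT); split=> // z; rewrite /= subrK.
have [q [u [r [qE rE]]]] := retract _ _ s S Ef sS.
have [q' [u' [r' [q'E r'E]]]] := retract _ _ s' S' E'f s'S.
(* By flatness of [A'], the target [E] may be replaced by the image of [s], on which the section [u]
   is defined. *)
have qx : tmap q idfun x = 0.
  apply: (projective_flatl A'p (@submod_val_inj _ _ (imsub s))); rewrite tmap0.
  by rewrite (tmap_fuse (f2 := s) (g2 := idfun)) //.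
have q'x : tmap idfun q' x = 0.
  apply: (projective_flatr Ap (@submod_val_inj _ _ (imsub s'))); rewrite tmap0.
  by rewrite (tmap_fuse (f2 := idfun) (g2 := s')) //.
have rx : tmap (submod_val S \o r) idfun x = x.
  rewrite -[RHS](tmap_id (f := (submod_val S \o r) \+ (u \o q)) (g := idfun)) //.
  rewrite tmapDl.
  have <- : tmap u idfun (tmap q idfun x) = tmap (u \o q) idfun x by exact: tmap_fuse.
  by rewrite qx tmap0 addr0.
have r'x : tmap idfun (submod_val S' \o r') x = x.
  rewrite -[RHS](tmap_id (f := idfun) (g := (submod_val S' \o r') \+ (u' \o q'))) //.
  rewrite tmapDr.
  have <- : tmap idfun u' (tmap idfun q' x) = tmap idfun (u' \o q') x.
    exact: tmap_fuse.
  by rewrite q'x tmap0 addr0.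
exists (tmap r r' x); rewrite -[RHS]rx -[in RHS]r'x !tmap_comp.
exact: tmap_ext.
Qed.

(** * Path complexes as kernels, and the isomorphism for box products *)

Section Unmarked.
Variables (R : comNzRingType) (M : markedcat).
Notation mchain := (chain_all (fun x y (f : hom x y) => marked f)).

(** Induces the projection onto unmarked simplices, which stands in for the quotient by marked
    chains: its values lie in a free module, as [tens_kernels] requires. *)
Definition unmarked_symb n (s : simplex M n) : nerve R M n :=
  if `[< mchain (projT2 s) >] then 0 else symb R s.

Lemma unmarked_symb_deg n (s : simplex M n) : ~ nondeg s -> unmarked_symb s = 0.
Proof. by move=> nds; rewrite /unmarked_symb symb_deg ?if_same. Qed.

Definition unmarked n : {linear nerve R M n -> nerve R M n} :=
  sval (nerve_lift (@unmarked_symb_deg n)).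

Lemma unmarkedE n (s : simplex M n) : unmarked n (symb R s) = unmarked_symb s.
Proof. exact: (svalP (nerve_lift (@unmarked_symb_deg n))). Qed.

Lemma unmarked_marked n (s : simplex M n) :
  mchain (projT2 s) -> unmarked n (symb R s) = 0.
Proof. by move=> ms; rewrite unmarkedE /unmarked_symb; case: asboolP. Qed.

Lemma unmarked0 n x : unmarked n x = 0 -> x \in marked_sub R M n.
Proof.
move=> ux; rewrite -cls_eq0; apply/eqP.
rewrite -[x]subr0 -ux -[LHS]/((cls (marked_sub R M n) \o (idfun \- unmarked n)) x).
rewrite -[RHS]/((\0 : {linear _ -> _}) x); apply: nerve_eq => -[p s] /=.
rewrite unmarkedE /unmarked_symb; case: asboolP => [ms|_].
  by rewrite subr0; apply/eqP; rewrite cls_eq0; exact: symb_marked.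
by rewrite subrr linear0.
Qed.

Lemma omega_test_linear n : linear (fun x : nerve R M n =>
  (unmarked n x, unmarked n.-1 (bdry (nerve R M) n x)) :
    (nerve R M n * nerve R M n.-1)%type).
Proof. by move=> a x y; rewrite !linearP. Qed.

Definition omega_test n :
    {linear nerve R M n -> (nerve R M n * nerve R M n.-1)%type} :=
  mklin (@omega_test_linear n).

Lemma omega_test0 n x : omega_test n x = 0 ->
  x \in subcx_sub (C := nerve R M) (marked_sub R M) n.
Proof.
case=> ux udx; apply/mksubmodP; split; first exact: unmarked0.
by apply/mksubmodP; exact: unmarked0.
Qed.
End Unmarked.

Section OmegaBox.
Variables (K : idomainType) (K_PID : is_PID K) (M M' : markedcat).
Notation CD := (prodcat M M').
Notation N := (nerve K M).
Notation N' := (nerve K M').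
Notation NB := (nerve K CD).
Notation Om := (Omega K M).
Notation Om' := (Omega K M').
Notation OmB := (Omega K (box M M')).
Notation EZ := (EZ K M M').
Notation AW := (AW K M M').

Lemma EZ_sum_diff n (F : tfam N N') :
  cdiff NB n (\sum_(i < n.+2) EZ n.+1 i (n.+1 - i) (F i (n.+1 - i)%N)) =
  \sum_(i < n.+1) EZ n i (n - i) (tdiff F i (n - i)%N).
Proof.
pose G1 i j : NB n := EZ n i.-1 j (tmap (bdry N i) idfun (F i j)).
pose G2 i j : NB n := (-1) ^+ i *: EZ n i j.-1 (tmap idfun (bdry N' j) (F i j)).
rewrite linear_sum (eq_bigr (fun i : 'I_n.+2 =>
  G1 i (n.+1 - i)%N + G2 i (n.+1 - i)%N)); last by move=> i _; exact: EZ_diff.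
rewrite big_split /= big_ord_recl [X in _ + X]big_ord_recr /=.
rewrite [G1 0%N _](_ : _ = 0); last by rewrite /G1 tmap0l // linear0.
rewrite [G2 n.+1 _](_ : _ = 0); last by rewrite /G2 subnn tmap0r // linear0 scaler0.
(* The two boundary terms dropped above involve a differential out of degree 0. After shifting the
   first sum, both are indexed by the bidegrees of total degree [n]. *)
rewrite add0r addr0 -big_split; apply: eq_bigr => i _ /=.
rewrite /bump /= add1n subSS subSn ?leq_ord //.
by rewrite /G1 /G2 /tdiff linearD linearZ_LR.
Qed.

Lemma EZ_pure_marked l m n x y :
  x \in marked_sub K M m -> y \in marked_sub K M' n ->
  EZ l m n (pure x y) \in marked_sub K (box M M') l.
Proof.
have purel w : linear (fun u : N m => pure u w : tens _ (N' n)).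
  by move=> a u v; rewrite pureDl pureZl.
have purer w : linear (fun v : N' n => pure w v : tens (N m) _).
  by move=> a u v; rewrite pureDr pureZr.
move=> xm ym; move: x xm.
apply: (@marked_in K M m _ (EZ l m n \o mklin (purel y))) => p s ms nds.
move: y ym; apply: (@marked_in K M' n _ (EZ l m n \o mklin (purer _))) => q t mt ndt.
exact: (@EZ_marked K M M' l m n (existT _ p s) (existT _ q t)).
Qed.

Lemma EZ_tmap_marked (V W : lmodType K) l m n (f : {linear V -> N m})
    (g : {linear W -> N' n}) (z : tens V W) :
  (forall v, f v \in marked_sub K M m) -> (forall w, g w \in marked_sub K M' n) ->
  EZ l m n (tmap f g z) \in marked_sub K (box M M') l.
Proof.
move=> fm gm; elim/tens_ind: z => [|x y hx hy|v w].
- by rewrite tmap0 linear0 rpred0.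
- by rewrite tmapD linearD rpredD.
- by rewrite tmapE; exact: EZ_pure_marked.
Qed.

Definition iota (X : markedcat) n : {linear Omega K X n -> nerve K X n} :=
  submod_val (subcx_sub (marked_sub K X) n).

Lemma iota_marked (X : markedcat) n x : iota X n x \in marked_sub K X n.
Proof. by have /mksubmodP[] := valP x. Qed.

Lemma bdry_iota_marked (X : markedcat) n x :
  bdry (nerve K X) n (iota X n x) \in marked_sub K X n.-1.
Proof. by have /mksubmodP[_ /mksubmodP] := valP x. Qed.

Lemma Omega_subfree (X : markedcat) n : subfree (Omega K X n).
Proof. exact/subfree_submod/subfree_freeg. Qed.

Notation iota2 i j := (tmap (iota M i) (iota M' j)).

(** A tensor product of two inclusions is injective here by changing one factor at a time: the nerve
    is free and [Omega] is projective, so both are flat. *)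
Lemma iota2_inj i j : injective (iota2 i j).
Proof.
have Omp : projective (Om i) by exact: subfree_projective (Omega_subfree _ _).
have N'p : projective (N' j) by exact: freeg_projective.
have i1 := projective_flatl N'p (@submod_val_inj _ _ (subcx_sub (marked_sub K M) i)).
have i2 := projective_flatr Omp (@submod_val_inj _ _ (subcx_sub (marked_sub K M') j)).
move=> x y xy; apply/i2/i1.
rewrite [LHS](tmap_fuse (f2 := iota M i) (g2 := iota M' j)) //.
by rewrite [RHS](tmap_fuse (f2 := iota M i) (g2 := iota M' j)).
Qed.

Lemma iota2_diff (F : tfam Om Om') i j :
  iota2 i j (tdiff F i j) = tdiff (fun i j => iota2 i j (F i j) : tens (N i) (N' j)) i j.
Proof.
rewrite /tdiff tmapD tmapZ; congr (_ + _ *: _); rewrite !tmap_comp;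
  exact: tmap_ext.
Qed.

Definition ord_bideg n (i : 'I_n.+1) : bideg n :=
  exist (fun q : nat * nat => (q.1 + q.2)%N == n) (i : nat, n - i)%N
    (introT eqP (subnKC (leq_ord i))).

Lemma ord_bidegP n (p : bideg n) : exists i, p = ord_bideg i.
Proof.
case: p => -[i j] ij; have il : (i < n.+1)%N.
  by rewrite ltnS -(eqP ij) leq_addr.
exists (Ordinal il); apply: val_inj => /=.
by rewrite -(eqP ij) addKn.
Qed.

Definition theta n (z : tcx_obj Om Om' n) : NB n :=
  \sum_(i < n.+1) EZ n i (n - i) (iota2 i (n - i)%N (z (ord_bideg i))).

Lemma theta_linear n : linear (@theta n).
Proof.
move=> a x y; rewrite /theta scaler_sumr -big_split; apply: eq_bigr => i _ /=.
rewrite -linearZ_LR -tmapZ -linearD -tmapD; congr (EZ _ _ _ (tmap _ _ _)).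
Qed.

Lemma theta_Omega n z : theta z \in subcx_sub (marked_sub K (box M M')) n.
Proof.
apply/mksubmodP; split.
  apply: (@rpred_sum _ (marked_sub K (box M M') n)) => i _.
  by apply: EZ_tmap_marked; exact: iota_marked.
apply/mksubmodP; case: n z => [|n] z; first exact: rpred0.
rewrite [bdry _ _ _](linear_sum (cdiff NB n)).
apply: (@rpred_sum _ (marked_sub K (box M M') n)) => i _.
rewrite [X in X \in _](EZ_diff).
apply: (@rpredD _ (marked_sub K (box M M') n)).
  rewrite (tmap_fuse (f2 := bdry N i \o iota M i) (g2 := iota M' (n.+1 - i))) //.
  by apply: EZ_tmap_marked; [exact: bdry_iota_marked | exact: iota_marked].
apply: (@rpredZ _ _ (marked_sub K (box M M') n)).
rewrite (tmap_fuse (f2 := iota M i) (g2 := bdry N' _ \o iota M' (n.+1 - i))) //.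
by apply: EZ_tmap_marked; [exact: iota_marked | exact: bdry_iota_marked].
Qed.

Definition Theta n : {linear tcx Om Om' n -> OmB n} :=
  @corestrict _ _ _ (mklin (@theta_linear n)) _ (@theta_Omega n).

Lemma Theta_diff n z : Theta n (cdiff (tcx Om Om') n z) = cdiff OmB n (Theta n.+1 z).
Proof.
apply: val_inj; rewrite -[RHS]/(cdiff NB n (theta z)).
have [F [FE _]] := tcx_extend z.
have -> : theta z = \sum_(i < n.+2) EZ n.+1 i (n.+1 - i)
    ((fun i j => iota2 i j (F i j) : tens (N i) (N' j)) i (n.+1 - i)%N).
  by apply: eq_bigr => i _; rewrite -(FE (ord_bideg i)).
rewrite [RHS](@EZ_sum_diff n (fun i j => iota2 i j (F i j))).
by apply: eq_bigr => i _; rewrite -iota2_diff (tcx_diffE FE).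
Qed.

Lemma AW_theta n (z : tcx_obj Om Om' n) (i : 'I_n.+1) :
  AW n i (n - i) (theta z) = iota2 i (n - i)%N (z (ord_bideg i)).
Proof.
rewrite linear_sum (bigD1 i) //= big1 => [|j ij]; last exact: AW_EZ0.
by rewrite addr0; apply: AW_EZ; exact: subnKC (leq_ord i).
Qed.

Lemma Theta_inj n : injective (Theta n).
Proof.
apply: linear_inj => z /(congr1 val) tz.
apply: functional_extensionality_dep => p; have [i ->] := ord_bidegP p.
apply: iota2_inj; rewrite -AW_theta [theta z](tz : theta z = 0).
by rewrite linear0 [RHS]tmap0.
Qed.

Lemma AW_unmarkedl n i j (x : NB n) : x \in marked_sub K (box M M') n ->
  tmap (unmarked K M i) idfun (AW n i j x) = 0.
Proof.
move: x; apply: (@marked_eq0 K (box M M') n _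
  (tmap (unmarked K M i) idfun \o AW n i j)) => p s ms nds.
suff: tmap (unmarked K M i) idfun (AW n i j (symb K (existT _ p s : simplex CD n))) = 0.
  by [].
case: (@AW_symbP K M M' n i j p s ms nds) => [|t t' mt mt']; first exact: tmap0.
by rewrite tmapE unmarked_marked // pure0l.
Qed.

Lemma AW_unmarkedr n i j (x : NB n) : x \in marked_sub K (box M M') n ->
  tmap idfun (unmarked K M' j) (AW n i j x) = 0.
Proof.
move: x; apply: (@marked_eq0 K (box M M') n _
  (tmap idfun (unmarked K M' j) \o AW n i j)) => p s ms nds.
suff: tmap idfun (unmarked K M' j) (AW n i j (symb K (existT _ p s : simplex CD n))) = 0.
  by [].
case: (@AW_symbP K M M' n i j p s ms nds) => [|t t' mt mt']; first exact: tmap0.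
by rewrite tmapE unmarked_marked // pure0r.
Qed.

(** [AW] ignores mixed arrows and need not commute with differentials on the whole nerve. On [Omega]
    it does, because [EZ_AW] writes [x] as a sum of shuffle products, where the differential is
    known. *)
Lemma AW_diff n i j (x : NB n.+1) : (i + j)%N = n ->
  x \in subcx_sub (marked_sub K (box M M')) n.+1 ->
  AW n i j (cdiff NB n x) = tdiff (fun i j => AW n.+1 i j x : tens (N i) (N' j)) i j.
Proof.
move=> ij /mksubmodP[xm /mksubmodP dxm].
have il : (i < n.+1)%N by rewrite ltnS -ij leq_addr.
have jE : j = (n - i)%N by rewrite -ij addKn.
subst j; rewrite [in LHS](EZ_AW xm dxm).
rewrite (@EZ_sum_diff n (fun i j => AW n.+1 i j x)).
rewrite linear_sum (bigD1 (Ordinal il)) // big1 => [|k ik]; last exact: AW_EZ0.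
by rewrite [LHS]addr0; apply: AW_EZ; exact: subnKC.
Qed.

(** The boundary of [x] is marked, so its component in each bidegree is marked in both factors. The
    differential of the second factor leaves the first factor marked, hence the first differential
    is marked there on its own, and symmetrically. *)
Lemma AW_bdry_unmarked n i j (x : NB n) : (i + j)%N = n ->
  x \in subcx_sub (marked_sub K (box M M')) n ->
  tmap (unmarked K M i.-1 \o bdry N i) idfun (AW n i j x) = 0 /\
  tmap idfun (unmarked K M' j.-1 \o bdry N' j) (AW n i j x) = 0.
Proof.
move=> ij xO; have /mksubmodP[xm /mksubmodP dxm] := xO.
have ul k l := AW_unmarkedl k l xm; have ur k l := AW_unmarkedr k l xm.
split.
  case: i ij => [|i] ij; first by rewrite tmap0l // => u; exact: linear0.
  case: n ij x xO xm dxm ul ur => // n [ij] x xO xm dxm ul ur.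
  have := AW_unmarkedl i j dxm; rewrite AW_diff // /tdiff tmapD tmapZ.
  rewrite [X in _ + _ *: X](_ : _ = 0) => [|].
    by rewrite scaler0 addr0 !tmap_comp => <-; exact: tmap_ext.
  rewrite -[RHS](tmap0 idfun (cdiff N' j)) -(ul i j.+1) !tmap_comp.
  exact: tmap_ext.
case: j ij => [|j] ij; first by rewrite tmap0r // => u; exact: linear0.
case: n ij x xO xm dxm ul ur => [|n] ij x xO xm dxm ul ur; first by rewrite addnS in ij.
have {}ij : (i + j)%N = n by rewrite addnS in ij; case: ij.
have := AW_unmarkedr i j dxm; rewrite AW_diff // /tdiff tmapD tmapZ.
rewrite [X in X + _](_ : _ = 0) => [|].
  rewrite add0r => /(congr1 (fun y => (-1) ^+ i *: y)).
  rewrite scaler0 scalerA -expr2 sqrr_sign scale1r tmap_comp => <-.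
  exact: tmap_ext.
rewrite -[RHS](tmap0 (cdiff N i) idfun) -(ur i.+1 j) !tmap_comp.
exact: tmap_ext.
Qed.

Lemma AW_Omega n i j (x : NB n) : (i + j)%N = n ->
  x \in subcx_sub (marked_sub K (box M M')) n ->
  exists y, iota2 i j y = AW n i j x.
Proof.
move=> ij xO; have /mksubmodP[xm _] := xO.
have [dl dr] := AW_bdry_unmarked ij xO.
have subfreeN (X : markedcat) k : subfree (nerve K X k * nerve K X k.-1)%type.
  by apply: subfree_pair; exact: subfree_freeg.
pose N2 (X : markedcat) k : lmodType K := (nerve K X k * nerve K X k.-1)%type.
(* Writing the pair [omega_test] as a sum of its two coordinates lets its tensor with the identity
   be tested on each coordinate separately. *)
have NE (X : markedcat) k :
    {e : {linear nerve K X k -> N2 X k} * {linear nerve K X k.-1 -> N2 X k} |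
    forall u, omega_test K X k u = ((e.1 \o unmarked K X k) \+
      (e.2 \o (unmarked K X k.-1 \o bdry (nerve K X) k))) u}.
  have l1 : linear (fun u : nerve K X k => (u, 0) : N2 X k).
    by move=> a u v; congr pair; rewrite /= ?scaler0 ?addr0.
  have l2 : linear (fun u : nerve K X k.-1 => (0, u) : N2 X k).
    by move=> a u v; congr pair; rewrite /= ?scaler0 ?addr0.
  by exists (mklin l1, mklin l2) => u; congr pair; rewrite /= ?addr0 ?add0r.
apply: (@tens_kernels _ K_PID _ _ _ _ (omega_test K M i) (omega_test K M' j)).
- exact: freeg_projective.
- exact: freeg_projective.
- exact: subfreeN.
- exact: subfreeN.
- exact: omega_test0.
- exact: omega_test0.
- have [e eE] := NE M i; rewrite (tmap_ext (g' := idfun) _ eE) // tmapDl.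
  rewrite -[X in X + _](tmap_fuse (f := e.1) (f' := unmarked K M i) (g := idfun)
    (g' := idfun)) // AW_unmarkedl // tmap0 add0r.
  by rewrite -(tmap_fuse (f := e.2) (g := idfun) (g' := idfun)
    (f' := unmarked K M i.-1 \o bdry N i)) // dl tmap0.
- have [e eE] := NE M' j; rewrite (tmap_ext (f' := idfun) _ _ eE) // tmapDr.
  rewrite -[X in X + _](tmap_fuse (g := e.1) (g' := unmarked K M' j) (f := idfun)
    (f' := idfun)) // AW_unmarkedr // tmap0 add0r.
  by rewrite -(tmap_fuse (g := e.2) (f := idfun) (f' := idfun)
    (g' := unmarked K M' j.-1 \o bdry N' j)) // dr tmap0.
Qed.

Lemma Theta_surj n x : exists z, Theta n z = x.
Proof.
pose y (p : bideg n) := sval (cid (AW_Omega (eqP (valP p)) (valP x))).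
exists y; apply: val_inj; have /mksubmodP[xm /mksubmodP dxm] := valP x.
rewrite [RHS](EZ_AW xm dxm); apply: eq_bigr => i _; congr (EZ _ _ _ _).
exact: (svalP (cid (AW_Omega _ _))).
Qed.

Theorem Omega_box_iso : complex_iso OmB (tcx Om Om').
Proof.
have inv n := linear_inverse (@Theta_inj n) (@Theta_surj n).
exists (fun n => sval (inv n)) => [n|n x].
  by case: (inv n) => g [gK Kg]; exists (Theta n).
case: (inv n) (inv n.+1) => g [gK Kg] [g1 [g1K Kg1]] /=.
by apply: (can_inj gK); rewrite Kg Theta_diff Kg1.
Qed.
End OmegaBox.

Theorem proposition10p7 (K : idomainType) (K_PID : is_PID K)
    (M M' : markedcat) :
  complex_iso (Omega K (box M M')) (tcx (Omega K M) (Omega K M')) /\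
  (forall n : nat,
    exists (f : {linear bisum n (fun i j => tens (PH K M i) (PH K M' j)) ->
                        PH K (box M M') n})
           (g : {linear PH K (box M M') n ->
                        bisum_pred n (fun i j => Tor 1 (PH K M i) (PH K M' j))}),
      short_exact f g).
Proof.
have iso := Omega_box_iso K_PID M M'; split=> // n.
have [f fbij fdiff] := iso.
have [h hbij] := homology_iso fbij fdiff n.
have pr (X : markedcat) k : projective (Omega K X k).
  exact/subfree_projective/Omega_subfree.
have prS (X : markedcat) k (S : submodClosed (Omega K X k)) : projective (submod S).
  exact/subfree_projective/subfree_submod/Omega_subfree.
have [f' [g' fg]] := kunneth n (pr M) (fun k => prS M k _) (fun k => prS M k _)
  (fun k => prS M' k _).
exact: short_exact_iso hbij fg.
Qed.
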